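(* Let $d\ge1$ and let $X=(X^1,\dots,X^d)$ be an $\mathbb R^d$-valued homogeneous (strict sense stationary) and ergodic random field on $T$ over $(\Omega_X,\mathcal F_X,P_X)$ with $E_X[|X^l(0)|^2]<\infty$ for $l=1,\dots,d$, and suppose that the covariance matrix $\Sigma$ of the vector $X(0)$ is nonsingular. Let $\{T_n\}$ be a pointwise averaging sequence of sets in $T$, $k_n\in\mathbb N$, $k_n\uparrow\infty$, and let $\tau_{n,1},\dots,\tau_{n,k_n}$ be i.i.d. points uniformly distributed on $T_n$, independent of $X$; the same sets $T_n$ and the same points $\tau_{n,i}$ are used for all components. Let $V$ be a Gaussian vector with mean $0$ and covariance matrix $\Sigma$. Then, as $n\to\infty$, $$\left(k_n^{-1/2}\sum_{i=1}^{k_n}(X^1(\tau_{n,i})-M_n^1),\dots,k_n^{-1/2}\sum_{i=1}^{k_n}(X^d(\tau_{n,i})-M_n^d)\right)\Longrightarrow V$$ in distribution with respect to $P_{X,\tau}$. If moreover, with $\mu^l=E_X[X^l(0)]$, $k_n^{1/2}(M_n^l-\mu^l)\Longrightarrow0$ in distribution with respect to $P_X$ for each $l=1,\dots,d$, then also $$\left(k_n^{-1/2}\sum_{i=1}^{k_n}(X^1(\tau_{n,i})-\mu^1),\dots,k_n^{-1/2}\sum_{i=1}^{k_n}(X^d(\tau_{n,i})-\mu^d)\right)\Longrightarrow V$$ in distribution with respect to $P_{X,\tau}$.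
   Context: $T=\mathbb R^m$ or $T=\mathbb Z^m$, $m\ge1$; $\mathcal B$ is the Borel $\sigma$-field of $T$ (all subsets if $T=\mathbb Z^m$); $\lambda$ is Lebesgue measure on $\mathbb R^m$, resp. counting measure on $\mathbb Z^m$. A random field is a family $X(t)$, $t\in T$, of random vectors on a probability space $(\Omega_X,\mathcal F_X,P_X)$ (expectation $E_X$); when $T=\mathbb R^m$ the map $(t,\omega)\mapsto X(t,\omega)$ is assumed $\mathcal B\otimes\mathcal F_X$-measurable. A field is homogeneous if all its finite-dimensional distributions are invariant under shifts of $T$. For a homogeneous field $Y$, $\mathcal I_Y$ denotes the $\sigma$-field of events $\{Y\in A\}$, $A$ in the product $\sigma$-field of the space of functions on $T$, with $P_X(\{Y\in A\}\triangle\{Y(\cdot+t)\in A\})=0$ for all $t\in T$; $Y$ is ergodic if every event of $\mathcal I_Y$ has probability $0$ or $1$. Pointwise averaging: a sequence $\{T_n\}$ of bounded Borel subsets of $T$ with $\lambda(T_n)>0$, $\lambda(T_n)\to\infty$, is pointwise averaging if for every scalar homogeneous random field $Y$ on $T$ (over any probability space) and every measurable $f:\mathbb R\to\mathbb R$ with $E[|f(Y(0))|]<\infty$, with probability 1, $\lim_{n}\frac1{\lambda(T_n)}\int_{T_n}f(Y(t))\lambda(dt)=E[f(Y(0))\mid\mathcal I_Y]$. The points $\tau_{n,i}$ are defined on a probability space $(\Omega_\tau,\mathcal F_\tau,P_\tau)$; for each $n$ they are i.i.d. and uniform on $T_n$ with respect to $\lambda$. Everything is considered on $(\Omega_X\times\Omega_\tau,\mathcal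 F_X\otimes\mathcal F_\tau,P_{X,\tau})$, $P_{X,\tau}:=P_X\times P_\tau$. $M_n^l:=\frac1{\lambda(T_n)}\int_{T_n}X^l(t)\lambda(dt)$. *)

(* Defs.v *)
From HB Require Import structures.
From mathcomp Require Import all_boot all_order all_algebra.
From mathcomp Require Import all_classical all_reals all_analysis.
From mathcomp Require Import measurable_realfun.

Set Implicit Arguments.
Unset Strict Implicit.
Unset Printing Implicit Defensive.

Import Order.TTheory GRing.Theory Num.Theory.
Import numFieldNormedType.Exports.

Local Open Scope classical_set_scope.
Local Open Scope ring_scope.

Definition borel_row_display (R : realType) (m : nat) : measure_display.
Proof. exact: default_measure_display. Qed.

HB.instance Definition _ (R : realType) (m : nat) :=
  @isMeasurable.Build (borel_row_display R m) 'rV[R]_m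
    <<s [set A : set 'rV[R]_m | open A] >>
    (@sigma_algebra0 _ setT _) (@sigma_algebraC _ _)
    (@sigma_algebra_bigcup _ setT _).

Lemma row_ballE (R : realType) (m : nat) (x : 'rV[R]_m) (e : R) :
  0 < e -> ball x e = \bigcap_(i in [set: 'I_m]) [set y | ball (x 0 i) e (y 0 i)].
Proof.
move=> e0; apply/seteqP; split => [y [_ xy] i _ //|y xy]; first exact: xy.
by split=> // i j; rewrite (ord1 i); exact: xy.
Qed.

Lemma measurable_row_of_tuple (R : realType) (m : nat) :
  measurable_fun [set: m.-tuple R]
    (fun t => \row_(i < m) tnth t i : 'rV[R]_m).
Proof.
set f := fun t : m.-tuple R => _.
pose G := image_set_system setT f (@measurable _ (m.-tuple R)).
have sG : sigma_algebra setT G.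
  apply: sigma_algebra_image; exact: sigma_algebra_measurable.
suff : <<s [set A : set 'rV[R]_m | open A] >> `<=` G.
  by move=> h _ B mB; exact: h.
apply: smallest_sub => // U oU.
rewrite /G /image_set_system/= setTI.
pose q (c : 'rV[rat]_m) : 'rV[R]_m := map_mx ratr c.
pose B (p : 'rV[rat]_m * nat) := ball (q p.1) (p.2.+1%:R^-1 : R).
have -> : U = \bigcup_(p in [set: 'rV[rat]_m * nat])
    (if `[< B p `<=` U >] then B p else set0).
  apply/seteqP; split => [x Ux|x [p _]]; last first.
    by case: ifPn => // /asboolP; exact.
  have /nbhs_ballP[e /= e0 xeU] : nbhs x U by exact: open_nbhs_nbhs.
  have [n ne] : exists n, (n.+1%:R^-1 : R) < e / 2.
    have [n _ /(_ n (leqnn n))] := near_infty_natSinv_lt (PosNum (divr_gt0 e0 (ltr0n R 2))).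
    by exists n.
  have dens i : exists r : rat, ball (x 0 i) (n.+1%:R^-1 : R) (ratr r : R).
    have [r] := @rat_in_itvoo R (x 0 i - n.+1%:R^-1) (x 0 i + n.+1%:R^-1)
      ltac:(by rewrite ltrBlDr -addrA ltrDl addr_gt0).
    rewrite in_itv/= => /andP[r1 r2]; exists r.
    by rewrite /ball/= ltr_distlC r1 r2.
  have [c cP] := choice dens.
  pose c' : 'rV[rat]_m := \row_i c i.
  have xB : B (c', n) x.
    rewrite /B row_ballE//= => i _ /=.
    by rewrite !mxE; apply: ball_sym; exact: cP.
  exists (c', n) => //.
  rewrite ifT//; apply/asboolP => y By; apply: xeU.
  rewrite [e]splitr; apply: (@ball_triangle _ _ (q c')).
    by apply: ball_sym; apply: le_ball xB; exact: ltW.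
  by apply: le_ball By; exact: ltW.
rewrite preimage_bigcup; apply: countable_bigcupT_measurable.
  exact: countableP.
move=> p; case: ifPn => _; last by rewrite preimage_set0.
rewrite /B row_ballE// preimage_bigcap; apply: fin_bigcap_measurable => [|i _].
  exact: finite_finset.
have -> : f @^-1` [set y | ball (q p.1 0 i) p.2.+1%:R^-1 (y 0 i)] =
    setT `&` (@tnth m R ^~ i) @^-1` (ball (q p.1 0 i) p.2.+1%:R^-1).
  by rewrite setTI; apply/seteqP; split=> t /=; rewrite !mxE.
apply: measurable_tnth => //; exact: measurable_ball.
Qed.

(* Built by hand because the canonical sigma-finite structure of a product of
   two sigma-finite measures is not found by unification. *)
Section tuple_measure.
Context d (T : measurableType d) (R : realType).
Variable mu : {sigma_finite_measure set T -> \bar R}.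

Definition cons_pair (n : nat) (p : T * n.-tuple T) : n.+1.-tuple T :=
  [tuple of p.1 :: p.2].

Lemma measurable_cons_pair n : measurable_fun [set: T * n.-tuple T] (@cons_pair n).
Proof. exact: measurable_cons. Qed.

Definition cons_measure (n : nat)
    (nu : {sigma_finite_measure set (n.-tuple T) -> \bar R}) :
    set (n.+1.-tuple T) -> \bar R :=
  pushforward (mu \x nu)%E (@cons_pair n).

Section cons_measure.
Variables (n : nat) (nu : {sigma_finite_measure set (n.-tuple T) -> \bar R}).

Let cons_measure0 : cons_measure nu set0 = 0%E.
Proof. by rewrite /cons_measure /pushforward preimage_set0 measure0. Qed.

Let cons_measure_ge0 A : (0 <= cons_measure nu A)%E.
Proof. by rewrite /cons_measure /pushforward; exact: measure_ge0. Qed.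

Let cons_measure_sigma_additive : semi_sigma_additive (cons_measure nu).
Proof.
pose rho : {measure set _ -> \bar R} :=
  measure_function_pushforward__canonical__measure_function_Measure
    (mu \x nu)%E (@measurable_cons_pair n).
exact: (@measure_semi_sigma_additive _ _ _ rho).
Qed.

HB.instance Definition _ := isMeasure.Build _ _ _ (cons_measure nu)
  cons_measure0 cons_measure_ge0 cons_measure_sigma_additive.

Let cons_measure_sigma_finite : sigma_finite setT (cons_measure nu).
Proof.
have /sigma_finiteP[F [TF ndF Foo]] := sigma_finiteT mu.
have /sigma_finiteP[G [TG ndG Goo]] := sigma_finiteT nu.
pose g (t : n.+1.-tuple T) := (thead t, [tuple of behead t]).
have mg : measurable_fun [set: n.+1.-tuple T] g.
  apply/measurable_fun_pairP; split; first exact: measurable_tnth.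
  exact: measurable_behead.
exists (fun k => g @^-1` (F k `*` G k)).
  rewrite -preimage_bigcup (_ : \bigcup_k _ = setT) ?preimage_setT//.
  apply/seteqP; split => // -[x y] _.
  have [[i _ Fx] [j _ Gy]] : (\bigcup_i F i) x /\ (\bigcup_i G i) y.
    by rewrite -TF -TG.
  exists (maxn i j) => //; split.
    by move: x Fx; exact/subsetPset/ndF/leq_maxl.
  by move: y Gy; exact/subsetPset/ndG/leq_maxr.
move=> k; have [mFk Fk] := Foo k; have [mGk Gk] := Goo k; split.
  by rewrite -[X in measurable X]setTI; apply: mg => //; exact: measurableX.
rewrite /cons_measure /pushforward -comp_preimage.
rewrite (_ : g \o _ = id) ?preimage_id.
  by rewrite product_measure1E// lte_mul_pinfty// ge0_fin_numE.
apply/funext => -[x t]; rewrite /g/=; congr pair.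
exact/val_inj.
Qed.

HB.instance Definition _ := @Measure_isSigmaFinite.Build _ _ _
  (cons_measure nu) cons_measure_sigma_finite.

End cons_measure.

Fixpoint tuple_measure (n : nat) :
    {sigma_finite_measure set (n.-tuple T) -> \bar R} :=
  match n with
  | 0 => \d_([tuple])
  | n'.+1 => cons_measure (tuple_measure n')
  end.

Lemma tuple_measure_box (n : nat) (A : 'I_n -> set T) :
  (forall i, measurable (A i)) ->
  tuple_measure n [set t | forall i, A i (tnth t i)] =
  (\prod_(i < n) mu (A i))%E.
Proof.
elim: n A => [|n ih] A mA.
  rewrite big_ord0 /= diracE (_ : _ \in _) //.
  by rewrite inE/= => -[].
rewrite big_ord_recl -ih// /= /cons_measure /pushforward.
have mB : measurable [set t : n.-tuple T | forall i, A (lift ord0 i) (tnth t i)].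
  rewrite (_ : mkset _ = \bigcap_(i in [set: 'I_n])
      ((@tnth n T ^~ i) @^-1` A (lift ord0 i))); last first.
    by apply/seteqP; split => t /= tA i => [_|]; exact: tA.
  apply: fin_bigcap_measurable => [|i _]; first exact: finite_finset.
  by rewrite -[X in measurable X]setTI; exact: measurable_tnth.
rewrite -product_measure1E//; congr (_ _).
apply/seteqP; split => -[x t] /=.
  by move=> At; split => [|i]; [exact: (At ord0)|have := At (lift ord0 i); rewrite tnthS].
move=> [Ax At] i; have [j ->|->//] := unliftP ord0 i.
by rewrite tnthS.
Qed.

End tuple_measure.

(* The m-fold product of the Lebesgue measure, carried from tuples to row
   vectors; lebesgue_row_box gives its value on boxes. *)
Definition lebesgue_row (R : realType) (m : nat) : set 'rV[R]_m -> \bar R :=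
  pushforward
    (tuple_measure (@lebesgue_measure R : {sigma_finite_measure set _ -> \bar R}) m)
    (fun t => \row_(i < m) tnth t i).

Section lebesgue_row.
Variables (R : realType) (m : nat).

Let lebesgue_row0 : lebesgue_row (set0 : set 'rV[R]_m) = 0%E.
Proof. by rewrite /lebesgue_row /pushforward preimage_set0 measure0. Qed.

Let lebesgue_row_ge0 (A : set 'rV[R]_m) : (0 <= lebesgue_row A)%E.
Proof. by rewrite /lebesgue_row /pushforward; exact: measure_ge0. Qed.

Let lebesgue_row_sigma_additive :
  semi_sigma_additive (@lebesgue_row R m).
Proof.
pose rho : {measure set _ -> \bar R} :=
  measure_function_pushforward__canonical__measure_function_Measure
    (tuple_measure (@lebesgue_measure R : {sigma_finite_measure set _ -> \bar R}) m)
    (@measurable_row_of_tuple R m).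
exact: (@measure_semi_sigma_additive _ _ _ rho).
Qed.

HB.instance Definition _ := isMeasure.Build _ _ _ (@lebesgue_row R m)
  lebesgue_row0 lebesgue_row_ge0 lebesgue_row_sigma_additive.

End lebesgue_row.

Lemma lebesgue_row_box (R : realType) (m : nat) (a b : 'rV[R]_m) :
  (forall i, a 0 i <= b 0 i) ->
  lebesgue_row [set x : 'rV[R]_m | forall i, a 0 i <= x 0 i <= b 0 i] =
  (\prod_(i < m) (b 0 i - a 0 i))%:E.
Proof.
move=> ab; rewrite /lebesgue_row /pushforward.
have -> : (\prod_(i < m) (b 0 i - a 0 i))%:E =
    (\prod_(i < m) lebesgue_measure `[a 0%R i, b 0%R i]%classic)%E.
  rewrite -prodEFin; apply: eq_bigr => i _.
  rewrite lebesgue_measure_itv/= lte_fin lt_neqAle ab andbT.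
  by case: eqVneq => [->|_]; rewrite ?subrr ?EFinB.
rewrite -(@tuple_measure_box _ (measurableTypeR R) R lebesgue_measure m
  (fun i => `[a 0 i, b 0 i]%classic) (fun i => measurable_itv _)).
congr (tuple_measure _ _ _); apply/seteqP.
by split => t /= abt i; move: (abt i); rewrite mxE in_itv.
Qed.

(* An alias, so that Z^m carries the discrete sigma-algebra. *)
Definition int_row (m : nat) := 'rV[int]_m.

HB.instance Definition _ (m : nat) := Choice.on (int_row m).
HB.instance Definition _ (m : nat) :=
  isPointed.Build (int_row m) (0 : 'rV[int]_m).
HB.instance Definition _ (m : nat) :=
  @isMeasurable.Build default_measure_display (int_row m)
    discrete_measurable discrete_measurable0
    discrete_measurableC discrete_measurableU.

(* The data on the parameter set T that the notions below use. *)
Record index_space (R : realType) := IndexSpace {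
  index_display : measure_display;
  index_type :> measurableType index_display;
  index_origin : index_type;
  index_add : index_type -> index_type -> index_type;
  index_measure : {measure set index_type -> \bar R};
  index_bounded : set index_type -> Prop }.

Definition real_index (R : realType) (m : nat) : index_space R :=
  @IndexSpace R _ 'rV[R]_m 0 (fun s t => s + t) (@lebesgue_row R m)
    (fun A => bounded_set A).

Definition int_index (R : realType) (m : nat) : index_space R :=
  @IndexSpace R _ (int_row m) (0 : 'rV[int]_m)
    (fun s t => (s : 'rV[int]_m) + t) (@counting _ R)
    (fun A => exists M : int, forall t : 'rV[int]_m, A t ->
      forall i, `|t 0 i| <= M).

Inductive index_kind := RealIndex | IntIndex.

Definition index_set (R : realType) (K : index_kind) (m : nat) : index_space R :=
  match K with
  | RealIndex => real_index R m
  | IntIndex => int_index R m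
  end.

Section random_fields.
Context (R : realType) (K : index_kind) (m : nat).
Local Notation T := (index_set R K m).
Local Notation lambda := (index_measure T).

Section field.
Context dS (S : measurableType dS) dO (O : measurableType dO).
Context (P : probability O R) (Y : T -> O -> S).

(* On Z^m joint measurability is automatic. *)
Definition random_field : Prop :=
  (forall t, measurable_fun [set: O] (Y t)) /\
  (K = RealIndex -> measurable_fun [set: T * O] (fun p => Y p.1 p.2)).

Definition homogeneous : Prop :=
  forall (n : nat) (t : 'I_n -> T) (h : T) (B : set (n.-tuple S)),
    measurable B ->
    P [set w | B [tuple Y (index_add (t i) h) w | i < n]] =
    P [set w | B [tuple Y (t i) w | i < n]].

Definition product_sigma_algebra : set (set (T -> S)) :=
  <<s [set A | exists (t : T) (B : set S),
         measurable B /\ A = [set y | B (y t)]] >>.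

Definition invariant_events : set (set O) :=
  [set E | exists2 A, product_sigma_algebra A &
    E = [set w | A (fun s => Y s w)] /\
      forall t, P (E `+` [set w | A (fun s => Y (index_add s t) w)]) = 0%E].

Definition ergodic : Prop :=
  forall E, invariant_events E -> P E = 0%E \/ P E = 1%E.

End field.

(* G is a sigma-algebra of events; Z is one version, unique up to a null set. *)
Definition is_cond_expectation dO (O : measurableType dO)
    (P : probability O R) (G : set (set O)) (U Z : O -> R) : Prop :=
  [/\ forall B, measurable B -> G (Z @^-1` B),
      P.-integrable [set: O] (EFin \o Z) &
      forall E, G E -> \int[P]_(w in E) Z w = \int[P]_(w in E) U w].

Definition average (A : set T) (g : T -> R) : R :=
  (fine (lambda A))^-1 * \int[lambda]_(t in A) g t.

(* The conditional expectation is only defined almost surely: the limit is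
   required for every version Z of it. *)
Definition pointwise_averaging (Tn : nat -> set T) : Prop :=
  [/\ forall n, [/\ measurable (Tn n), index_bounded (Tn n) &
                    (0 < lambda (Tn n))%E],
      lambda (Tn n) @[n --> \oo] --> +oo%E &
      forall dO (O : measurableType dO) (P : probability O R)
          (Y : T -> O -> R) (f : R -> R),
        random_field Y -> homogeneous P Y -> measurable_fun [set: R] f ->
        P.-integrable [set: O] (fun w => (f (Y (index_origin T) w))%:E) ->
        forall Z : O -> R,
          is_cond_expectation P (invariant_events P Y)
            (fun w => f (Y (index_origin T) w)) Z ->
          {ae P, forall w,
            average (Tn n) (fun t => f (Y t w)) @[n --> \oo] --> Z w}].

Definition uniform_on dO (O : measurableType dO) (P : probability O R)
    (A : set T) (U : O -> T) : Prop :=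
  measurable_fun [set: O] U /\
  forall B, measurable B ->
    P (U @^-1` B) = (fine (lambda (A `&` B)) / fine (lambda A))%:E.

End random_fields.

Definition mutually_independent dO (O : measurableType dO) (R : realType)
    (P : probability O R) dS (S : measurableType dS) (k : nat)
    (U : 'I_k -> O -> S) : Prop :=
  forall (J : {set 'I_k}) (B : 'I_k -> set S),
    (forall i, measurable (B i)) ->
    P [set w | forall i, i \in J -> B i (U i w)] =
    (\prod_(i in J) P (U i @^-1` B i))%E.

Definition covariance_mx dO (O : measurableType dO) (R : realType)
    (P : probability O R) (d : nat) (V : O -> 'rV[R]_d) : 'M[R]_d :=
  \matrix_(j, l)
    fine (covariance P (fun w => V w 0 j) (fun w => V w 0 l)).

(* s is the standard deviation; normal_prob m 0 is not the Dirac mass at m,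
   hence the case distinction. *)
Definition normal_law (R : realType) (m s : R) (B : set R) : \bar R :=
  if s == 0 then \d_m B else normal_prob m s B.

(* All linear combinations of the components are normal, possibly
   degenerate. *)
Definition gaussian_vector dO (O : measurableType dO) (R : realType)
    (P : probability O R) (d : nat) (V : O -> 'rV[R]_d) : Prop :=
  measurable_fun [set: O] V /\
  forall a : 'I_d -> R, exists m s : R, forall B : set R, measurable B ->
    P [set w | B (\sum_(l < d) a l * V w 0 l)] = normal_law m s B.

(* The laws of the U n under P converge weakly to the law of V under Q. *)
Definition cvg_in_law (R : realType) (S : topologicalType)
    dO (O : measurableType dO) (P : probability O R) (U : nat -> O -> S)
    dV (OV : measurableType dV) (Q : probability OV R) (V : OV -> S) : Prop :=
  forall g : S -> R, continuous g -> (exists M, forall x, `|g x| <= M) ->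
    \int[P]_w g (U n w) @[n --> \oo] --> \int[Q]_w g (V w).

(* Main.v *)
Require Import Defs.
From HB Require Import structures.
From mathcomp Require Import all_boot all_order all_algebra.
From mathcomp Require Import all_classical all_reals all_analysis.
From mathcomp Require Import measurable_realfun ring lra.

(* By the Cramer-Wold idea it is enough to test with x |-> cos (a . x + b).

   For fixed X the summands sampled in row n are i.i.d., and the law of a
   sampled point is the average over T_n.  Applied to the scalar field a . X
   and to the functions z, z^2 and (z - mu)^2 min(1, |z - mu| / N), pointwise
   averaging and ergodicity give, for almost every X, convergence of means and
   variances together with a Lindeberg condition.  A second order expansion of
   cos and sin, one summand at a time, then yields the limit
   exp(- a Sigma a^T / 2) cos b conditionally on X, hence unconditionally by
   dominated convergence.  For V the same value comes from Stein's identity for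
   the normal density.

   Passing from cosines to bounded continuous g needs tightness, which follows
   from second moments, and an approximation of g by trigonometric polynomials:
   take the Bernstein polynomial of g on a large cube [-1/c, 1/c]^d at the point
   with coordinates sin(c x_l) / c, which is close to x on compact sets.

   The second claim adds the shift sqrt(k_n) (M_n - mu), which tends to 0 in
   probability. *)

Set Implicit Arguments.
Unset Strict Implicit.
Unset Printing Implicit Defensive.

Import Order.TTheory GRing.Theory Num.Theory.
Import numFieldNormedType.Exports.

Local Open Scope classical_set_scope.
Local Open Scope ring_scope.

(** * Elementary inequalities *)

Section real_inequalities.
Context {R : realType}.
Implicit Types (x y c h : R).

(** Cosines with an arbitrary phase replace complex exponentials: sines and constants are special
    cases, products of cosines are again sums of cosines, and everything stays real. The Lindeberg
    truncation natural for row n sits at sqrt(k_n) and moves with n, whereas pointwise averaging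
    speaks of one fixed function. So the truncation is made at a fixed N, which only enlarges the
    bound once N <= sqrt(k_n); n tends to infinity first and N afterwards. Countably many functions
    suffice, and their exceptional sets can be united. For the same reason the truncation is centred
    at the constant mu, although the summands are centred at the random M_n; the discrepancy costs a
    multiple of (mu - M_n)^2, which vanishes in the limit. The conditional limit is only integrated
    for one pair (a, b) at a time, so the exceptional set of X may depend on that pair. *)

Lemma le_norm_derive (f f' : R -> R) x c :
  (forall y : R, is_derive y (1 : R) f (f' y)) ->
  (forall y, `|y| <= `|x| -> `|f' y| <= c) -> `|f x - f 0| <= c * `|x|.
Proof.
move=> df f'c.
have cf A : {within A, continuous f}.
  apply: continuous_subspaceT => y; apply: differentiable_continuous.
  by apply/derivable1_diffP; have [] := df y.
have [x0|x0] := leP 0 x.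
  have [y yx ->] := MVT_segment x0 (fun y _ => df y) (cf _).
  rewrite subr0 normrM ler_wpM2r// f'c//.
  by move: yx; rewrite in_itv/= => /andP[y0 yx]; rewrite !ger0_norm.
have [y yx] := MVT_segment (ltW x0) (fun y _ => df y) (cf _).
rewrite distrC sub0r => ->; rewrite normrM normrN ler_wpM2r// f'c//.
by move: yx; rewrite in_itv/= => /andP[y0 yx]; rewrite !ler0_norm ?lerN2// ltW.
Qed.

Lemma norm_sin_le x : `|sin x| <= `|x|.
Proof.
have := @le_norm_derive sin cos x 1 (fun y => is_derive_sin y)
  (fun y _ => cos_max y).
by rewrite sin0 subr0 mul1r.
Qed.

Lemma norm_cosB1_le x : `|cos x - 1| <= `|x|.
Proof.
have := @le_norm_derive cos (fun y => - sin y) x 1 (fun y => is_derive_cos y).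
by rewrite cos0 mul1r; apply => y _; rewrite normrN sin_max.
Qed.

Lemma norm_cosB1_le2 x : `|cos x - 1| <= `|x| ^+ 2.
Proof.
have := @le_norm_derive cos (fun y => - sin y) x `|x| (fun y => is_derive_cos y).
rewrite cos0 -expr2; apply => y yx; rewrite normrN.
exact: le_trans (norm_sin_le y) yx.
Qed.

Lemma norm_cosB_le x y : `|cos x - cos y| <= `|x - y|.
Proof.
have d (z : R) : is_derive z (1 : R) (fun z => cos (z + y)) (- sin (z + y)).
  by apply: is_derive_eq; rewrite addr0 mulr1.
have := le_norm_derive (x := x - y) (c := 1) d.
by rewrite subrK add0r mul1r; apply => z _; rewrite normrN sin_max.
Qed.

(** The derivative cos - 1 is bounded on [-|x|, |x|] both by |x| and by |x|^2, that is by |x| min(1,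
    |x|). Keeping the minimum gives a remainder that is cubic for small x but never worse than
    quadratic, as the Lindeberg argument needs. *)
Lemma norm_sinBid_le x : `|sin x - x| <= x ^+ 2 * Num.min 1 `|x|.
Proof.
have d (y : R) : is_derive y (1 : R) (fun y => sin y - y) (cos y - 1).
  by apply: is_derive_eq.
have h c : (forall y, `|y| <= `|x| -> `|cos y - 1| <= c) ->
    `|sin x - x| <= c * `|x|.
  by move=> yc; have := le_norm_derive d yc; rewrite sin0 subr0 subr0.
rewrite (_ : x ^+ 2 * _ = (`|x| * Num.min 1 `|x|) * `|x|); last first.
  by rewrite -[x ^+ 2](real_normK (num_real x)) expr2 mulrAC.
apply: h => y yx; case: (lerP 1 `|x|) => x1; rewrite ?mulr1.
  exact: le_trans (norm_cosB1_le y) yx.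
rewrite (le_trans (norm_cosB1_le2 y))//.
by rewrite expr2 ler_pM.
Qed.

(** The mean value theorem for cos y + y^2 / 2, whose derivative is y - sin y. For |x| >= 1 this
    derivative is at most |y| + |sin y| <= 2 |x|, the origin of the factor 2; for |x| < 1 the cubic
    case of [norm_sinBid_le] applies. *)
Lemma norm_cosB1D_le x :
  `|cos x - (1 - x ^+ 2 / 2)| <= 2 * (x ^+ 2 * Num.min 1 `|x|).
Proof.
have d (y : R) : is_derive y (1 : R) (fun y => cos y + y ^+ 2 / 2) (y - sin y).
  by apply: is_derive_eq; rewrite !scaler0 add0r /GRing.scale/=; field.
have h c : (forall y, `|y| <= `|x| -> `|y - sin y| <= c) ->
    `|cos x - (1 - x ^+ 2 / 2)| <= c * `|x|.
  move=> yc; have := le_norm_derive d yc; rewrite cos0 expr0n/= mul0r addr0.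
  by congr (`|_| <= _); ring.
rewrite (_ : 2 * _ = (2 * (`|x| * Num.min 1 `|x|)) * `|x|); last first.
  by rewrite -[x ^+ 2](real_normK (num_real x)); ring.
apply: h => y yx.
have yx2 : `|y| ^+ 2 <= `|x| ^+ 2 by rewrite !expr2 ler_pM.
have := norm_sinBid_le y; rewrite distrC; rewrite -(real_normK (num_real y)).
have := norm_sin_le y; have := ler_normB y (sin y).
case: (lerP 1 `|x|) => x1; rewrite ?mulr1; case: (lerP 1 `|y|) => y1; rewrite ?mulr1;
  have := normr_ge0 x; have := normr_ge0 y; nra.
Qed.

(** Multiply by 1 + x: exp(-x) (1 + x) <= exp(-x) exp(x) = 1 <= 1 + x^3 = (x^2 - x + 1) (1 + x). *)
Lemma norm_expRN_le x : 0 <= x -> `|expR (- x) - (1 - x)| <= x ^+ 2.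
Proof.
move=> x0; have e1 := expR_ge1Dx (- x); have e2 := expR_ge1Dx x.
have ee : expR (- x) * expR x = 1 by rewrite -expRD addNr expR0.
have e3 := expR_gt0 (- x).
rewrite ger0_norm; last by rewrite subr_ge0.
rewrite lerBlDr.
suff : expR (- x) * (1 + x) <= (x ^+ 2 + (1 - x)) * (1 + x).
  by rewrite ler_pM2r//; lra.
by nra.
Qed.

(** A continuous substitute for y^2 restricted to |y| > c, which it dominates. Rescaled by c it is
    exactly the remainder of the two expansions above. *)
Definition truncated_sqr c y : R := y ^+ 2 * Num.min 1 (`|y| / c).

Lemma truncated_sqr_ge0 c y : 0 < c -> 0 <= truncated_sqr c y.
Proof.
move=> c0; rewrite mulr_ge0 ?sqr_ge0// le_min ler01/=.
by rewrite divr_ge0// ltW.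
Qed.

Lemma truncated_sqr_le c y : truncated_sqr c y <= y ^+ 2.
Proof. by rewrite ler_piMr ?sqr_ge0// ge_min lexx. Qed.

Lemma truncated_sqrZ c y : 0 < c ->
  (y / c) ^+ 2 * Num.min 1 `|y / c| = truncated_sqr c y / c ^+ 2.
Proof.
move=> c0; rewrite /truncated_sqr normrM normfV (gtr0_norm c0).
by rewrite exprMn exprVn mulrAC.
Qed.

Lemma truncated_sqr_anti c c' y : 0 < c -> c <= c' ->
  truncated_sqr c' y <= truncated_sqr c y.
Proof.
move=> c0 cc'; rewrite ler_wpM2l ?sqr_ge0//.
rewrite le_min !ge_min lexx/=; apply/orP; right.
by rewrite ler_wpM2l// lef_pV2// posrE// (lt_le_trans c0).
Qed.

(** The larger of |x| and |h| is at least |x + h| / 2, and doubling an argument costs at most 4 in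
    the square and 2 in the minimum. This allows a change of centre under the truncation. *)
Lemma truncated_sqrD c x h : 0 < c ->
  truncated_sqr c (x + h) <= 8 * (truncated_sqr c x + truncated_sqr c h).
Proof.
move=> c0.
have mono a b : `|a| <= 2 * `|b| -> truncated_sqr c a <= 8 * truncated_sqr c b.
  move=> ab; rewrite /truncated_sqr -(real_normK (num_real a)).
  rewrite -(real_normK (num_real b)).
  set u := `|a| in ab *; set v := `|b| in ab *.
  have u0 : 0 <= u := normr_ge0 a; have v0 : 0 <= v := normr_ge0 b.
  rewrite (_ : 8 * _ = (2 * v) ^+ 2 * (2 * Num.min 1 (v / c))); last by ring.
  apply: ler_pM; rewrite ?sqr_ge0//.
  - by rewrite le_min ler01 divr_ge0// ltW.
  - by rewrite !expr2 ler_pM.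
  - rewrite minr_pMr// mulr1 le_min !ge_min; apply/andP; split.
      by rewrite (_ : 1 <= 2)// ler1n.
    by rewrite mulrA ler_wpM2r ?orbT// invr_ge0 ltW.
have := truncated_sqr_ge0 x c0; have := truncated_sqr_ge0 h c0.
have := ler_normD x h.
have [xh|/ltW hx] := leP `|x| `|h| => ? ? ?.
  have := mono (x + h) h; lra.
have := mono (x + h) x; lra.
Qed.

Lemma measurable_truncated_sqr c : measurable_fun setT (truncated_sqr c).
Proof.
apply: measurable_funM; first exact: measurable_funX.
apply: measurable_minr; first exact: measurable_cst.
apply: measurable_funM; last exact: measurable_cst.
exact: normr_measurable.
Qed.

End real_inequalities.

(** * Integrals and independence *)

Lemma measurable_fun_bigsum d (O : measurableType d) (R : realType)
    (I : Type) (s : seq I) (p : pred I) (h : I -> O -> R) :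
  (forall i, measurable_fun setT (h i)) ->
  measurable_fun setT (fun w => \sum_(i <- s | p i) h i w).
Proof.
move=> mh; elim: s => [|i s ih].
  by under eq_fun do rewrite big_nil; exact: measurable_cst.
under eq_fun do rewrite big_cons; case: (p i) => //.
exact: measurable_funD.
Qed.

Section probability_integral.
Context d (O : measurableType d) (R : realType) (P : probability O R).
Implicit Types f g : O -> R.

Lemma bounded_integrable f (M : R) : measurable_fun setT f ->
  (forall x, `|f x| <= M) -> P.-integrable setT (EFin \o f).
Proof.
move=> mf fM; apply: measurable_bounded_integrable => //.
  by rewrite -ge0_fin_numE// fin_num_measure.
exists M; split; first exact: num_real.
by move=> N MN x _ /=; rewrite (le_trans (fM x))// ltW.
Qed.

Lemma integrable_dominated f g : measurable_fun setT f ->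
  (forall x, `|f x| <= g x) -> P.-integrable setT (EFin \o g) ->
  P.-integrable setT (EFin \o f).
Proof.
move=> mf fg; apply: le_integrable => //; first exact/measurable_EFinP.
by move=> x _ /=; rewrite lee_fin (le_trans (fg x))// ler_norm.
Qed.

Lemma integrable_cst (c : R) : P.-integrable setT (EFin \o cst c).
Proof. exact: (@bounded_integrable _ `|c|). Qed.

Lemma Rintegral_prob_cst (c : R) : \int[P]_x c = c.
Proof.
rewrite Rintegral_cst//; transitivity (c * fine (1%:E : \bar R)); last by rewrite mulr1.
by congr (_ * fine _); exact: probability_setT.
Qed.

Lemma integrable_addr f g : P.-integrable setT (EFin \o f) ->
  P.-integrable setT (EFin \o g) ->
  P.-integrable setT (EFin \o (fun x => f x + g x)).
Proof.
by move=> fi gi; apply: eq_integrable (integrableD measurableT fi gi).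
Qed.

Lemma integrable_subr f g : P.-integrable setT (EFin \o f) ->
  P.-integrable setT (EFin \o g) ->
  P.-integrable setT (EFin \o (fun x => f x - g x)).
Proof.
by move=> fi gi; apply: eq_integrable (integrableB measurableT fi gi).
Qed.

Lemma integrable_mulr (c : R) f : P.-integrable setT (EFin \o f) ->
  P.-integrable setT (EFin \o (fun x => c * f x)).
Proof.
by move=> fi; apply: eq_integrable (integrableZl measurableT c fi).
Qed.

Lemma Rintegral_dist_le f g (h : O -> R) :
  P.-integrable setT (EFin \o f) -> P.-integrable setT (EFin \o g) ->
  P.-integrable setT (EFin \o h) -> (forall x, `|f x - g x| <= h x) ->
  `|\int[P]_x f x - \int[P]_x g x| <= \int[P]_x h x.
Proof.
move=> fi gi hi fgh; rewrite -RintegralB//.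
apply: le_trans (le_normr_Rintegral _ _) _ => //; first exact: integrable_subr.
apply: le_Rintegral => //; apply: integrable_norm.
exact: integrable_subr.
Qed.

Lemma sqr_integrable_integrable f : measurable_fun setT f ->
  P.-integrable setT (EFin \o (fun x => f x ^+ 2)) ->
  P.-integrable setT (EFin \o f).
Proof.
move=> mf f2; apply: (integrable_dominated (g := fun x => 1 + f x ^+ 2)) => //.
  move=> x; rewrite ler_norml.
  by have := sqr_ge0 (f x + 1); have := sqr_ge0 (f x - 1); nra.
by apply: integrable_addr => //; exact: integrable_cst.
Qed.

End probability_integral.

Lemma Rintegral_sum dO (O : measurableType dO) (R : realType)
    (P : probability O R) (I : Type) (s : seq I) (f : I -> O -> R) :
  (forall i, P.-integrable setT (EFin \o f i)) ->
  P.-integrable setT (EFin \o (fun w => \sum_(i <- s) f i w)) /\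
  \int[P]_w (\sum_(i <- s) f i w) = \sum_(i <- s) \int[P]_w f i w.
Proof.
move=> fi; elim: s => [|i s [ih1 ih2]].
  rewrite big_nil (_ : (fun w => _) = cst 0); last first.
    by apply/funext => w; rewrite big_nil.
  by split; [exact: integrable_cst|exact: Rintegral_prob_cst].
rewrite big_cons (_ : (fun w => _) = fun w => f i w + \sum_(i <- s) f i w).
  by split; [exact: integrable_addr|rewrite RintegralD// ih2].
by apply/funext => w; rewrite big_cons.
Qed.

(** * Independence and sums of independent variables *)

Section independence.
Context d (O : measurableType d) (R : realType) (P : probability O R).

Definition independent_pair d1 (S1 : measurableType d1) d2 (S2 : measurableType d2)
    (W : O -> S1) (Z : O -> S2) : Prop :=
  forall A B, measurable A -> measurable B ->
    P (W @^-1` A `&` Z @^-1` B) = (P (W @^-1` A) * P (Z @^-1` B))%E.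

Lemma independent_pair_comp (W Z : O -> R) (f g : R -> R) :
  measurable_fun setT f -> measurable_fun setT g ->
  independent_pair W Z -> independent_pair (f \o W) (g \o Z).
Proof.
move=> mf mg WZ A B mA mB; apply: (WZ (f @^-1` A) (g @^-1` B)).
  by rewrite -[X in measurable X]setTI; exact: mf.
by rewrite -[X in measurable X]setTI; exact: mg.
Qed.

Section product.
Variables (W Z : O -> R).
Hypotheses (mW : measurable_fun setT W) (mZ : measurable_fun setT Z).
Hypothesis WZ : independent_pair W Z.

Let W' : {mfun O >-> R} := mfun_Sub (mem_set mW).
Let Z' : {mfun O >-> R} := mfun_Sub (mem_set mZ).
Let mWZ : measurable_fun setT (fun w => (W w, Z w)).
Proof. by apply/measurable_fun_pairP. Qed.
Let WZ' : {mfun O >-> (R * R)%type} := mfun_Sub (mem_set mWZ).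

Let lawE (X : set (R * R)) : measurable X ->
  (distribution P W' \x distribution P Z')%E X = distribution P WZ' X.
Proof.
apply: product_measure_unique => A B mA mB.
exact: WZ mA mB.
Qed.

Let ge0_integral_law (f : R * R -> \bar R) : measurable_fun setT f ->
  (forall x, 0 <= f x)%E ->
  (\int[P]_w f (W w, Z w) = \int[P]_w \int[P]_v f (W w, Z v))%E.
Proof.
move=> mf f0.
rewrite -[LHS](ge0_integral_distribution WZ')//.
rewrite (eq_measure_integral (distribution P W' \x distribution P Z')%E);
  last by move=> A mA _; exact/esym/lawE.
rewrite fubini_tonelli1// ge0_integral_distribution//; last 2 first.
- exact: measurable_fun_fubini_tonelli_F.
- by move=> x; exact: integral_ge0.
apply: eq_integral => w _; rewrite /= /fubini_F.
rewrite ge0_integral_distribution//.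
exact: measurableT_comp.
Qed.

Hypotheses (iW : P.-integrable setT (EFin \o W)) (iZ : P.-integrable setT (EFin \o Z)).

(** By Tonelli under the product law, E|W Z| = E|W| E|Z|, which is finite. *)
Lemma integrable_indep : P.-integrable setT (EFin \o (fun w => W w * Z w)).
Proof.
apply/integrableP; split; first exact/measurable_EFinP/measurable_funM.
rewrite [ltLHS](ge0_integral_law (f := fun p => `|(p.1 * p.2)%:E|%E))//; last first.
  apply: measurableT_comp => //; apply/measurable_EFinP.
  by apply: measurable_funM.
under eq_integral.
  move=> w _ /=.
  under eq_integral do rewrite normrM EFinM.
  rewrite ge0_integralZl//; last by do 2 apply: measurableT_comp => //.
  over.
rewrite /= ge0_integralZr//; last 2 first.
- by do 2 apply: measurableT_comp => //.
- exact: integral_ge0.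
rewrite lte_mul_pinfty//.
- exact: integral_ge0.
- by have /integrableP[_] := iW; rewrite ge0_fin_numE//; exact: integral_ge0.
- by have /integrableP[_] := iZ.
Qed.

Let intpair : (distribution P W' \x distribution P Z')%E.-integrable setT
   (fun p : R * R => (p.1 * p.2)%:E).
Proof.
have mf : measurable_fun setT (fun p : R * R => (p.1 * p.2)%:E).
  by apply/measurable_EFinP; apply: measurable_funM.
apply/integrableP; split => //.
rewrite (eq_measure_integral (distribution P WZ')); last first.
  by move=> A mA _; exact: lawE.
rewrite ge0_integral_distribution//; last exact: measurableT_comp.
by have /integrableP[_] := integrable_indep.
Qed.

Lemma Rintegral_indep : \int[P]_w (W w * Z w) = \int[P]_w W w * \int[P]_w Z w.
Proof.
have mf : measurable_fun setT (fun p : R * R => (p.1 * p.2)%:E).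
  by apply/measurable_EFinP; apply: measurable_funM.
rewrite /Rintegral -fineM//; last 2 first.
- exact: integrable_fin_num.
- exact: integrable_fin_num.
congr fine.
rewrite -[LHS](integral_distribution (X := WZ') mf integrable_indep).
rewrite (eq_measure_integral (distribution P W' \x distribution P Z')%E);
  last by move=> A mA _; exact/esym/lawE.
rewrite -integral12_prod_meas1// /fubini_F /=.
under eq_integral.
  move=> x _.
  under eq_integral do rewrite EFinM.
  rewrite integralZl//; last first.
    by apply: integrable_pushforward => //; rewrite preimage_setT.
  rewrite (integral_distribution (X := Z'))//.
  rewrite -(fineK (integrable_fin_num measurableT iZ)).
  over.
rewrite integralZr//=.
  by rewrite (integral_distribution (X := W'))// fineK// integrable_fin_num.
by apply: integrable_pushforward => //; rewrite preimage_setT.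
Qed.

End product.

(** For fixed C both sides are finite measures in D that agree on rectangles, a generating family
    stable under intersection. *)
Lemma independent_event_pair (W Z : O -> R) (C : set O) :
  measurable_fun setT W -> measurable_fun setT Z -> measurable C ->
  (forall A B, measurable A -> measurable B ->
    P (W @^-1` A `&` Z @^-1` B `&` C) = (P (W @^-1` A `&` Z @^-1` B) * P C)%E) ->
  forall D : set (R * R), measurable D ->
    P ((fun w => (W w, Z w)) @^-1` D `&` C) =
    (P ((fun w => (W w, Z w)) @^-1` D) * P C)%E.
Proof.
move=> mW mZ mC WZC D mD.
have mWZ : measurable_fun setT (fun w => (W w, Z w)).
  by apply/measurable_fun_pairP.
pose WZ' : {mfun O >-> (R * R)%type} := mfun_Sub (mem_set mWZ).
have PC0 : 0 <= fine (P C) by exact: fine_ge0.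
have PCE : P C = (fine (P C))%:E by rewrite fineK// fin_num_measure.
pose m1 : {measure set (R * R) -> \bar R} := 
  measure_function_pushforward__canonical__measure_function_Measure
    (mrestr P mC) mWZ.
pose m2 : {measure set (R * R) -> \bar R} :=
  mscale (NngNum PC0) (distribution P WZ').
suff : m1 D = m2 D.
  rewrite /m1 /m2 /= /mscale /= /pushforward /mrestr /= => ->.
  by rewrite muleC -PCE.
apply: (measure_unique [set A `*` B | A in measurable & B in measurable]
  (fun _ => setT)) => //.
- exact: measurable_prod_measurableType.
- move=> X Y [X1 mX1 [X2 mX2 <-{X}]] [Y1 mY1 [Y2 mY2 <-{Y}]].
  exists (X1 `&` Y1); first exact: measurableI.
  by exists (X2 `&` Y2); [exact: measurableI|rewrite setXI].
- by move=> _; exists setT => //; exists setT => //; rewrite setXTT.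
- by rewrite bigcup_const.
- move=> _ [A mA [B mB <-]].
  rewrite /m1 /m2 /= /mscale /= /pushforward /mrestr /=.
  by rewrite muleC -PCE -WZC.
- move=> _; have -> : m1 setT = P C.
    by rewrite /m1 /= /pushforward /mrestr /= preimage_setT setTI.
  by rewrite PCE ltry.
Qed.

Section partial_sums.
Variables (k : nat) (Y : 'I_k -> O -> R).
Hypothesis mY : forall i, measurable_fun setT (Y i).
Hypothesis indY : mutually_independent P Y.

(** The condition on i, rather than a shorter range, keeps the index type ['I_k] fixed during
    inductions on j. *)
Definition partial_sum (j : nat) (w : O) : R := \sum_(i < k | (i < j)%N) Y i w.

Lemma partial_sum0 : partial_sum 0 = cst 0.
Proof. by apply/funext => w; rewrite /partial_sum big_pred0. Qed.

Lemma partial_sumS (i : 'I_k) w : partial_sum i.+1 w = partial_sum i w + Y i w.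
Proof.
rewrite /partial_sum (bigD1 i)//= addrC; congr (_ + _).
by apply: eq_bigl => j; rewrite ltnS ltn_neqAle andbC.
Qed.

Lemma partial_sum_full : partial_sum k = fun w => \sum_(i < k) Y i w.
Proof.
by apply/funext => w; rewrite /partial_sum; apply: eq_bigl => j; rewrite ltn_ord.
Qed.

Lemma measurable_partial_sum j : measurable_fun setT (partial_sum j).
Proof.
by rewrite /partial_sum; exact: measurable_fun_bigsum.
Qed.

Let meas_block (J : {set 'I_k}) (B : 'I_k -> set R) : (forall i, measurable (B i)) ->
  measurable [set w | forall i, i \in J -> B i (Y i w)].
Proof.
move=> mB.
rewrite (_ : mkset _ = \bigcap_(i in [set` J]) (Y i @^-1` B i)); last first.
  by apply/seteqP; split => w h i; exact: h.
apply: fin_bigcap_measurable => // i _.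
by rewrite -[X in measurable X]setTI; exact: mY.
Qed.

(** A whole block J of later indices is carried along because the induction step moves one index
    from the block into the sum: the hypothesis for J with j added makes the pair (sum, Y j)
    independent of the block, and [independent_event_pair] passes from rectangles to the event that
    the new sum lies in A. *)
Lemma partial_sum_independent j A (J : {set 'I_k}) (B : 'I_k -> set R) :
  (forall i, i \in J -> (j <= i)%N) ->
  measurable A -> (forall i, measurable (B i)) ->
  P (partial_sum j @^-1` A `&` [set w | forall i, i \in J -> B i (Y i w)]) =
  (P (partial_sum j @^-1` A) * \prod_(i in J) P (Y i @^-1` B i))%E.
Proof.
elim: j A J B => [|j ih] A J B jJ mA mB.
  rewrite partial_sum0 -indY//.
  have [A0|nA0] := pselect (A 0).
    rewrite (_ : _ @^-1` A = setT); last by apply/seteqP; split.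
    by rewrite setTI (_ : P setT = 1%E) ?mul1e//; exact: probability_setT.
  rewrite (_ : _ @^-1` A = set0); last by apply/seteqP; split.
  by rewrite set0I measure0 mul0e.
have [jk|kj] := ltnP j k; last first.
  rewrite (_ : partial_sum j.+1 = partial_sum j); last first.
    apply/funext => w; rewrite /partial_sum; apply: eq_bigl => i.
    by rewrite !(leq_trans (ltn_ord i))// (leq_trans kj).
  by apply: ih => // i /jJ/ltnW.
pose i0 : 'I_k := Ordinal jk.
pose C := [set w | forall i, i \in J -> B i (Y i w)].
have mC : measurable C by exact: meas_block.
have i0J : i0 \notin J by apply/negP => /jJ; rewrite ltnn.
have PC : P C = (\prod_(i in J) P (Y i @^-1` B i))%E by exact: indY.
have PAB A' B' : measurable A' -> measurable B' ->
    P (partial_sum j @^-1` A' `&` Y i0 @^-1` B') =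
    (P (partial_sum j @^-1` A') * P (Y i0 @^-1` B'))%E.
  move=> mA' mB'.
  have := ih A' [set i0]%SET (fun=> B'); rewrite big_set1 => <-//.
    congr (P (_ `&` _)); apply/seteqP; split => w /=.
      by move=> Bw i /set1P ->.
    by apply; rewrite set11.
  by move=> i /set1P ->.
have PABC A' B' : measurable A' -> measurable B' ->
    P (partial_sum j @^-1` A' `&` Y i0 @^-1` B' `&` C) =
    (P (partial_sum j @^-1` A' `&` Y i0 @^-1` B') * P C)%E.
  move=> mA' mB'; rewrite PAB// PC.
  (* Put B' at the new index i0; as i0 is not in J, the other sets are unchanged. *)
  have := ih A' (i0 |: J)%SET (fun i => if i == i0 then B' else B i).
  rewrite big_setU1//= eqxx => h.
  rewrite -muleA (eq_bigr (fun i => P (Y i @^-1` (if i == i0 then B' else B i)))).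
    rewrite -h//.
    - rewrite -setIA; congr (P (_ `&` _)); apply/seteqP; split => w /=.
        move=> [Bw Cw] i; rewrite !inE; case: eqVneq => [->//|_ /=].
        exact: Cw.
      move=> H; split; first by have := H i0; rewrite !inE eqxx; exact.
      move=> i iJ; have := H i; rewrite !inE iJ orbT.
      by rewrite ifN; [exact|apply: contraNneq i0J => <-].
    - by move=> i; rewrite !inE => /predU1P[->//|/jJ/ltnW].
    - by move=> i; case: ifP.
  by move=> i iJ; rewrite ifN//; apply: contraNneq i0J => <-.
have := independent_event_pair (measurable_partial_sum j) (mY i0) mC PABC.
move=> /(_ [set p : R * R | A (p.1 + p.2)]); rewrite -PC.
rewrite (_ : partial_sum j.+1 @^-1` A =
  (fun w => (partial_sum j w, Y i0 w)) @^-1` [set p : R * R | A (p.1 + p.2)]).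
  apply; rewrite -[X in measurable X]setTI.
  have mD : measurable_fun setT (fun p : R * R => p.1 + p.2).
    exact: measurable_funD.
  exact: mD.
by apply/seteqP; split => w /=; rewrite (partial_sumS i0).
Qed.

Lemma partial_sum_independent_pair (i : 'I_k) :
  independent_pair (partial_sum i) (Y i).
Proof.
move=> A B mA mB.
have := partial_sum_independent (j := i) (J := [set i]%SET) (B := fun=> B) _ mA (fun=> mB).
rewrite big_set1 => <-.
  congr (P (_ `&` _)); apply/seteqP; split => w /=.
    by move=> Bw l /set1P ->.
  by apply; rewrite set11.
by move=> l /set1P ->.
Qed.

Lemma Rintegral_sqr_sum (v : R) :
  (forall i, P.-integrable setT (EFin \o (fun w => Y i w ^+ 2))) ->
  (forall i, \int[P]_w Y i w = 0) -> (forall i, \int[P]_w (Y i w) ^+ 2 = v) ->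
  P.-integrable setT (EFin \o (fun w => (\sum_(i < k) Y i w) ^+ 2)) /\
  \int[P]_w (\sum_(i < k) Y i w) ^+ 2 = k%:R * v.
Proof.
move=> Y2 Y0 Yv.
suff H j : (j <= k)%N ->
    P.-integrable setT (EFin \o (fun w => (partial_sum j w) ^+ 2)) /\
    \int[P]_w (partial_sum j w) ^+ 2 = j%:R * v.
  by have := H _ (leqnn k); rewrite partial_sum_full.
elim: j => [_|j ih jk].
  rewrite mul0r (_ : (fun w => _) = cst 0); last first.
    by apply/funext => w; rewrite partial_sum0 expr0n.
  split; first exact: integrable_cst.
  exact: Rintegral_prob_cst.
have [i2 ie] := ih (ltnW jk).
pose i0 : 'I_k := Ordinal jk.
have i1 := sqr_integrable_integrable (measurable_partial_sum j) i2.
have iY := sqr_integrable_integrable (mY i0) (Y2 i0).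
have ind : independent_pair (partial_sum j) (Y i0).
  exact: (partial_sum_independent_pair i0).
have ip := integrable_indep (measurable_partial_sum j) (mY i0) ind i1 iY.
have eE w : partial_sum j.+1 w ^+ 2 =
   (partial_sum j w ^+ 2 + 2 * (partial_sum j w * Y i0 w)) + Y i0 w ^+ 2.
  by rewrite (partial_sumS i0); ring.
have ia := integrable_addr i2 (integrable_mulr 2 ip).
split; first by under eq_fun do rewrite eE; exact: integrable_addr.
under eq_Rintegral do rewrite eE.
rewrite RintegralD// RintegralD//; last exact: integrable_mulr.
rewrite RintegralZl// (Rintegral_indep (measurable_partial_sum j) (mY i0) ind i1 iY).
rewrite (Y0 i0) mulr0 mulr0 addr0 ie (Yv i0).
by rewrite -natr1 mulrDl mul1r.
Qed.

(** Replace one factor at a time. With u and u' the means of cos and sin of the partial sum plus b,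
    and C, S those of the next summand, the new error is u (C - q) - u' S plus q times the old
    error. Since |u|, |u'| and q are at most 1, each step adds at most delta. *)
Lemma cos_sum_bound (q delta b : R) : 0 <= q <= 1 ->
  (forall i, `|\int[P]_w cos (Y i w) - q| + `|\int[P]_w sin (Y i w)| <= delta) ->
  `|\int[P]_w cos (\sum_(i < k) Y i w + b) - q ^+ k * cos b| <= k%:R * delta.
Proof.
move=> /andP[q0 q1] Yd.
have mcos : measurable_fun setT (@cos R).
  by apply: continuous_measurable_fun; exact: continuous_cos.
have msin : measurable_fun setT (@sin R).
  by apply: continuous_measurable_fun; exact: continuous_sin.
have mcosb c : measurable_fun setT (fun x : R => cos (x + c)).
  by apply: measurableT_comp => //; exact: measurable_funD.
have icos c (f : O -> R) : measurable_fun setT f ->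
    P.-integrable setT (EFin \o (fun w => cos (f w + c))).
  move=> mf; apply: (@bounded_integrable _ _ _ P _ 1) => [|w]; last exact: cos_max.
  exact: (measurableT_comp (mcosb c) mf).
have isin (f : O -> R) : measurable_fun setT f ->
    P.-integrable setT (EFin \o (fun w => sin (f w))).
  move=> mf; apply: (@bounded_integrable _ _ _ P _ 1) => [|w]; last exact: sin_max.
  exact: (measurableT_comp msin mf).
have icos0 (f : O -> R) : measurable_fun setT f ->
    P.-integrable setT (EFin \o (fun w => cos (f w))).
  by move=> /(icos 0); under eq_fun do rewrite addr0.
have cos1 c (f : O -> R) : measurable_fun setT f ->
    `|\int[P]_w cos (f w + c)| <= 1.
  move=> mf; rewrite (le_trans (le_normr_Rintegral _ _))//; first exact: icos.
  rewrite -(@Rintegral_prob_cst _ _ _ P 1); apply: le_Rintegral => //.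
  - by apply: integrable_norm; exact: icos.
  - exact: integrable_cst.
  - by move=> x _; exact: cos_max.
suff H j : (j <= k)%N ->
    `|\int[P]_w cos (partial_sum j w + b) - q ^+ j * cos b| <= j%:R * delta.
  by have := H _ (leqnn k); rewrite partial_sum_full.
elim: j => [_|j ih jk].
  rewrite partial_sum0 /cst expr0 mul1r mul0r; under eq_Rintegral do rewrite add0r.
  by rewrite Rintegral_prob_cst subrr normr0.
pose i0 : 'I_k := Ordinal jk.
have {}ih := ih (ltnW jk).
have ind : independent_pair (partial_sum j) (Y i0).
  exact: (partial_sum_independent_pair i0).
have mp := measurable_partial_sum j.
have prod c (f : R -> R) : measurable_fun setT f ->
    P.-integrable setT (EFin \o (f \o Y i0)) ->
    P.-integrable setT (EFin \o (fun w => cos (partial_sum j w + c) * f (Y i0 w))) /\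
    \int[P]_w (cos (partial_sum j w + c) * f (Y i0 w)) =
    \int[P]_w cos (partial_sum j w + c) * \int[P]_w f (Y i0 w).
  move=> mf iff; have ind' := independent_pair_comp (mcosb c) mf ind.
  have m1 : measurable_fun setT ((fun x => cos (x + c)) \o partial_sum j).
    exact: measurableT_comp.
  have m2 : measurable_fun setT (f \o Y i0) by exact: measurableT_comp.
  split; first exact: (integrable_indep m1 m2 ind' (icos c _ mp) iff).
  exact: (Rintegral_indep m1 m2 ind' (icos c _ mp) iff).
have [ic ec] := prod b cos mcos (icos0 _ (mY i0)).
(* The sine of the partial sum is a cosine with phase b - pi/2, so [prod] covers both terms of the
   addition formula. *)
have [is_ es] := prod (b - pi / 2) sin msin (isin _ (mY i0)).
have eE w : cos (partial_sum j.+1 w + b) =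
    cos (partial_sum j w + b) * cos (Y i0 w) -
    cos (partial_sum j w + (b - pi / 2)) * sin (Y i0 w).
  rewrite (partial_sumS i0) [X in _ - cos X * _]addrA cosBpihalf -cosD.
  by congr cos; rewrite addrAC.
under eq_Rintegral do rewrite eE.
rewrite RintegralB// ec es.
set u := \int[P]_w cos (partial_sum j w + b) in ih *.
set u' := \int[P]_w cos (partial_sum j w + (b - _)).
have u1 : `|u| <= 1 by exact: cos1.
have u'1 : `|u'| <= 1 by exact: cos1.
have := Yd i0; set C := \int[P]_w cos _; set S := \int[P]_w sin _ => CS.
rewrite (_ : _ - _ = u * (C - q) - u' * S + q * (u - q ^+ j * cos b)); last first.
  by rewrite exprS; ring.
apply: le_trans (ler_normD _ _) _; rewrite -natr1 mulrDl mul1r addrC.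
apply: lerD.
  rewrite normrM ger0_norm//; apply: le_trans ih.
  by rewrite ler_piMl.
apply: le_trans (ler_normB _ _) _; apply: le_trans CS.
by apply: lerD; rewrite normrM ler_piMl.
Qed.

End partial_sums.
End independence.

Lemma mutually_independent_comp d (O : measurableType d) (R : realType)
    (P : probability O R) d1 (S1 : measurableType d1) d2 (S2 : measurableType d2)
    (k : nat) (U : 'I_k -> O -> S1) (f : S1 -> S2) :
  measurable_fun setT f -> mutually_independent P U ->
  mutually_independent P (fun i => f \o U i).
Proof.
move=> mf indU J B mB; apply: (indU J (fun i => f @^-1` B i)) => i.
by rewrite -[X in measurable X]setTI; exact: mf.
Qed.

Section row_bound.
Context d (O : measurableType d) (R : realType) (P : probability O R).
Variables (k : nat) (Y : 'I_k -> O -> R) (v e N b : R).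
Hypothesis k0 : (0 < k)%N.
Hypothesis mY : forall i, measurable_fun setT (Y i).
Hypothesis indY : mutually_independent P Y.
Hypothesis Y2 : forall i, P.-integrable setT (EFin \o (fun w => Y i w ^+ 2)).
Hypothesis Y0 : forall i, \int[P]_w Y i w = 0.
Hypothesis Yv : forall i, \int[P]_w (Y i w) ^+ 2 = v.
Hypotheses (N0 : 0 < N) (Nk : N <= Num.sqrt k%:R).
Hypothesis Ye : forall i, \int[P]_w truncated_sqr N (Y i w) <= e.

(** Apply [cos_sum_bound] to Y_i / sqrt(k) with q = exp(-v / (2k)), so that q^k = exp(-v / 2). Each
    summand costs e / k for the sine, 2 e / k for the cosine and (v / (2k))^2 for replacing 1 - v /
    (2k) by q; k times the total is the bound. *)
Lemma row_cos_bound :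
  `|\int[P]_w cos ((Num.sqrt k%:R)^-1 * (\sum_(i < k) Y i w) + b)
    - expR (- (v / 2)) * cos b| <= 3 * e + v ^+ 2 / (4 * k%:R).
Proof.
have Nk' := Nk; set s := Num.sqrt k%:R in Nk' *.
have k0' : 0 < k%:R :> R by rewrite ltr0n.
have s0 : 0 < s by rewrite sqrtr_gt0.
have s2 : s ^+ 2 = k%:R by rewrite sqr_sqrtr// ltW.
have kn0 : k%:R != 0 :> R by rewrite gt_eqF.
have v0 : 0 <= v.
  rewrite -(Yv (Ordinal k0)); apply: Rintegral_ge0 => w _; exact: sqr_ge0.
pose Z i w := Y i w / s.
have mZ i : measurable_fun setT (Z i).
  by apply: measurable_funM => //; exact: measurable_cst.
have indZ : mutually_independent P Z.
  have : measurable_fun setT (fun y : R => y / s).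
    by apply: measurable_funM => //; exact: measurable_cst.
  by move=> /(mutually_independent_comp (f := fun y : R => y / s)); apply.
have iY i := sqr_integrable_integrable (mY i) (Y2 i).
have iT i : P.-integrable setT (EFin \o (fun w => truncated_sqr N (Y i w))).
  apply: integrable_dominated (Y2 i).
    by apply: measurableT_comp => //; exact: measurable_truncated_sqr.
  by move=> w; rewrite ger0_norm ?truncated_sqr_le// truncated_sqr_ge0.
(* Rescaling produces the truncation level sqrt(k); lowering it to N enlarges the function. *)
have Zt i w : Z i w ^+ 2 * Num.min 1 `|Z i w| <= k%:R^-1 * truncated_sqr N (Y i w).
  rewrite truncated_sqrZ// s2 [leLHS]mulrC ler_wpM2l ?invr_ge0 ?ler0n//.
  exact: truncated_sqr_anti.
pose q := expR (- (v / (2 * k%:R))).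
have vk0 : 0 <= v / (2 * k%:R) by rewrite divr_ge0// mulr_ge0// ltW.
have q01 : 0 <= q <= 1 by rewrite expR_ge0/= -expR0 ler_expR oppr_le0.
have -> : expR (- (v / 2)) = q ^+ k.
  by rewrite /q -expRM_natl; congr expR; rewrite -mulr_natl; field.
under eq_Rintegral.
  move=> w _; rewrite mulr_sumr.
  under eq_bigr do rewrite mulrC.
  over.
rewrite (_ : 3 * e + _ = k%:R * (3 * (k%:R^-1 * e) + (v / (2 * k%:R)) ^+ 2)); last first.
  by field.
apply: (cos_sum_bound mZ indZ) => // i.
have ik : k%:R^-1 * \int[P]_w truncated_sqr N (Y i w) <= k%:R^-1 * e.
  by rewrite ler_wpM2l// invr_ge0 ltW.
have iZ : P.-integrable setT (EFin \o Z i).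
  rewrite (_ : Z i = (fun w => s^-1 * Y i w)); last first.
    by apply/funext => w; rewrite mulrC.
  exact: integrable_mulr.
have Z2E w : 1 - Z i w ^+ 2 / 2 = 1 - (2 * k%:R)^-1 * (Y i w) ^+ 2.
  by rewrite /Z expr_div_n s2; field.
have iZ2 : P.-integrable setT (EFin \o (fun w => 1 - Z i w ^+ 2 / 2)).
  under eq_fun do rewrite Z2E; apply: integrable_subr; first exact: integrable_cst.
  exact: integrable_mulr.
have mcos : measurable_fun setT (@cos R).
  by apply: continuous_measurable_fun; exact: continuous_cos.
have msin : measurable_fun setT (@sin R).
  by apply: continuous_measurable_fun; exact: continuous_sin.
have hS : `|\int[P]_w sin (Z i w)| <= k%:R^-1 * e.
  apply: le_trans ik; rewrite -RintegralZl//.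
  have Z0 : \int[P]_w Z i w = 0.
    under eq_Rintegral do rewrite /Z mulrC.
    by rewrite RintegralZl// Y0 mulr0.
  rewrite -[X in `|X|]subr0 -Z0; apply: Rintegral_dist_le => //.
  - by apply: (@bounded_integrable _ _ _ P _ 1) => [|w];
      [exact: measurableT_comp|exact: sin_max].
  - exact: integrable_mulr.
  - by move=> w; apply: le_trans (norm_sinBid_le _) (Zt i w).
have hC : `|\int[P]_w cos (Z i w) - (1 - v / (2 * k%:R))| <= 2 * (k%:R^-1 * e).
  have -> : 1 - v / (2 * k%:R) = \int[P]_w (1 - Z i w ^+ 2 / 2).
    under eq_Rintegral do rewrite Z2E.
    rewrite RintegralB//; last 2 first.
    - exact: integrable_cst.
    - exact: integrable_mulr.
    by rewrite Rintegral_prob_cst RintegralZl// Yv mulrC.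
  apply: (@le_trans _ _ (2 * (k%:R^-1 * \int[P]_w truncated_sqr N (Y i w)))); last first.
    by rewrite ler_wpM2l.
  rewrite -RintegralZl// -RintegralZl//; last exact: integrable_mulr.
  apply: Rintegral_dist_le => //.
  - by apply: (@bounded_integrable _ _ _ P _ 1) => [|w];
      [exact: measurableT_comp|exact: cos_max].
  - by apply: integrable_mulr; exact: integrable_mulr.
  - move=> w; apply: le_trans (norm_cosB1D_le _) _.
    by rewrite ler_wpM2l.
have := norm_expRN_le vk0; rewrite distrC -/q => hq.
have := ler_normD (\int[P]_w cos (Z i w) - (1 - v / (2 * k%:R)))
  ((1 - v / (2 * k%:R)) - q).
rewrite addrA subrK => ht.
lra.
Qed.

End row_bound.

(** * The normal law *)

Section density.
Context d (T : measurableType d) (R : realType).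
Variables (mu nu : {measure set T -> \bar R}) (h : T -> R).
Hypotheses (mh : measurable_fun setT h) (h0 : forall x, 0 <= h x).
Hypothesis nuE : forall A, measurable A -> nu A = (\int[mu]_(x in A) (h x)%:E)%E.

Import HBNNSimple.

Let integral_density_nnsfun (f : {nnsfun T >-> R}) :
  (\int[nu]_x (f x)%:E = \int[mu]_x (f x * h x)%:E)%E.
Proof.
under [LHS]eq_integral do rewrite fimfunE -fsumEFin//.
rewrite [LHS]ge0_integral_fsum//; last 2 first.
  - by move=> r; exact/measurable_EFinP/measurableT_comp.
  - by move=> n x _; rewrite EFinM nnfun_muleindic_ge0.
under [RHS]eq_integral.
  move=> x xD; rewrite EFinM fimfunE -fsumEFin// ge0_mule_fsuml; last first.
    by move=> r; rewrite EFinM nnfun_muleindic_ge0.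
  over.
rewrite [RHS]ge0_integral_fsum//; last 2 first.
  - move=> r; apply: emeasurable_funM; last exact/measurable_EFinP.
    by apply/measurable_EFinP; apply: measurableT_comp.
  - move=> n x _; rewrite EFinM mule_ge0//; first by rewrite nnfun_muleindic_ge0.
    by rewrite lee_fin.
apply: eq_fsbigr => r _.
rewrite !integralZl_indic_nnsfun//= integral_indic// setIT nuE//.
have [r0|r0] := ltP r 0.
  rewrite preimage_nnfun0// integral_set0 mule0; apply/esym.
  by apply: integral0_eq => x _; rewrite indicE in_set0 mulr0 mul0e.
rewrite integral_mkcond -ge0_integralZl//; last 2 first.
- apply/(measurable_restrictT (EFin \o h)) => //.
  exact/measurable_EFinP/measurable_funTS.
- by move=> x _; rewrite patchE; case: ifP => // _; rewrite lee_fin.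
apply: eq_integral => x _; rewrite patchE indicE; case: ifP => _.
  by rewrite mulr1.
by rewrite mule0 mulr0 mul0e.
Qed.

(** Simple functions first, then monotone convergence. It serves both the normal law and the law of
    a uniform point of T_n. *)
Lemma ge0_integral_density (f : T -> \bar R) :
  measurable_fun setT f -> (forall x, 0 <= f x)%E ->
  (\int[nu]_x f x = \int[mu]_x (f x * (h x)%:E))%E.
Proof.
move=> mf f0.
pose f_ := nnsfun_approx measurableT mf.
transitivity (lim (\int[nu]_x (f_ n x)%:E @[n --> \oo])%E).
  rewrite -monotone_convergence//=.
  - apply: eq_integral => ? /[!inE] xD; apply/esym/cvg_lim => //=.
    exact: cvg_nnsfun_approx.
  - by move=> n; exact/measurable_EFinP/measurable_funTS.
  - by move=> n ? _; rewrite lee_fin.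
  - by move=> ? _ ? ? mn; rewrite lee_fin; exact/lefP/nd_nnsfun_approx.
rewrite (_ : (fun n => \int[nu]_x (f_ n x)%:E)%E =
    (fun n => \int[mu]_x ((f_ n x)%:E * (h x)%:E))%E); last first.
  by apply/funext => n; rewrite integral_density_nnsfun.
rewrite -monotone_convergence//=.
- apply: eq_integral => x _; apply/cvg_lim => //=.
  have fx : (f_ n x)%:E @[n --> \oo] --> f x by exact: cvg_nnsfun_approx.
  exact: (cvgeZr (y := (h x)%:E) _ fx).
- by move=> n; apply/measurable_EFinP/measurable_funM.
- by move=> n x _; rewrite lee_fin mulr_ge0.
- move=> x _ a b ab; rewrite lee_fin ler_wpM2r//.
  exact/lefP/nd_nnsfun_approx.
Qed.

Lemma integrable_density (f : T -> R) : measurable_fun setT f ->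
  mu.-integrable setT (fun x => (f x * h x)%:E) ->
  nu.-integrable setT (EFin \o f).
Proof.
move=> mf /integrableP[_ fh]; apply/integrableP; split; first exact/measurable_EFinP.
rewrite ge0_integral_density//; last by apply: measurableT_comp => //; exact/measurable_EFinP.
by under eq_integral do rewrite /= -EFinM -{1}(ger0_norm (h0 _)) -normrM.
Qed.

Lemma Rintegral_density (f : T -> R) : measurable_fun setT f ->
  mu.-integrable setT (fun x => (f x * h x)%:E) ->
  \int[nu]_x f x = \int[mu]_x (f x * h x).
Proof.
move=> mf fh; congr fine.
have mf' : measurable_fun setT (EFin \o f) by exact/measurable_EFinP.
rewrite integralE [RHS]integralE; congr (_ - _)%E.
  rewrite ge0_integral_density//; last exact: measurable_funepos.
  apply: eq_integral => x _; rewrite !funeposE /=.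
  by rewrite maxe_pMl// ?mul0e// lee_fin.
rewrite ge0_integral_density//; last exact: measurable_funeneg.
apply: eq_integral => x _; rewrite !funenegE /=.
by rewrite maxe_pMl// ?mul0e ?lee_fin// -EFinM mulNr.
Qed.

End density.

(** * Stein's identity for the normal density *)

Section normal.
Context {R : realType}.
Variables (m s : R).
Hypothesis s0 : s != 0.
Notation leb := (@lebesgue_measure R).
Let p : R -> R := normal_pdf m s.

Let s2_gt0 : 0 < s ^+ 2. Proof. by rewrite exprn_even_gt0. Qed.
Let s2_neq0 : s ^+ 2 != 0. Proof. by rewrite gt_eqF. Qed.

Let pE x : p x = normal_peak s * normal_fun m s x.
Proof. by rewrite /p normal_pdfE. Qed.


Let pfE : p = fun x => normal_peak s * expR (- (x - m) ^+ 2 / (s ^+ 2 *+ 2)).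
Proof. by apply/funext => y; rewrite pE. Qed.

Let is_derive_p (x : R) : is_derive x (1 : R) p (- ((x - m) / s ^+ 2) * p x).
Proof.
rewrite pfE; apply: is_derive_eq.
rewrite scaler0 add0r subr0 /GRing.scale/=.
by field.
Qed.

Let continuous_p : continuous p.
Proof. exact: continuous_normal_pdf. Qed.

Let p_ge0 x : 0 <= p x. Proof. exact: normal_pdf_ge0. Qed.

Let mp : measurable_fun setT p. Proof. exact: measurable_normal_pdf. Qed.

(** K and Q give an integrable majorant of (1 + (x - m)^2) p x: doubling the standard deviation
    absorbs the quadratic factor. *)
Let K := normal_peak s * (1 + 3 * s ^+ 2).
Let Q x := K * normal_fun m (2 * s) x.

Let K_ge0 : 0 <= K.
Proof. by rewrite mulr_ge0 ?normal_peak_ge0// addr_ge0// mulr_ge0// ltW. Qed.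

Let integrable_Q : leb.-integrable setT (EFin \o Q).
Proof.
have s20 : 2 * s != 0 by rewrite mulf_neq0.
have := integrableZl measurableT (K / normal_peak (2 * s))
  (integrable_normal_pdf m (2 * s)).
apply: eq_integrable => // x _ /=.
rewrite normal_pdfE// -EFinM mulrA mulfVK// gt_eqF// normal_peak_gt0//.
Qed.

Let p_le_Q x : (1 + (x - m) ^+ 2) * p x <= Q x.
Proof.
rewrite pE /Q /K mulrCA -mulrA ler_wpM2l ?normal_peak_ge0//.
rewrite /normal_fun; set y := x - m.
(* The density decays like exp(-u) and the majorant like exp(-u/4). The spare exp(-3u/4) absorbs 1 +
   2 s^2 u, since 1 + 2 s^2 u <= (1 + 3 s^2)(1 + 3u/4) <= (1 + 3 s^2) exp(3u/4). *)
pose u := y ^+ 2 / (2 * s ^+ 2).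
have u0 : 0 <= u by rewrite divr_ge0 ?sqr_ge0// mulr_ge0// ltW.
rewrite (_ : - y ^+ 2 / (s ^+ 2 *+ 2) = - (u / 4) - (3 / 4 * u)); last first.
  by rewrite /u -mulr_natl; field.
rewrite (_ : - y ^+ 2 / ((2 * s) ^+ 2 *+ 2) = - (u / 4)); last first.
  by rewrite /u -mulr_natl; field.
have yu : y ^+ 2 = 2 * s ^+ 2 * u by rewrite /u mulrC divfK// mulf_neq0.
rewrite expRD mulrCA [leRHS]mulrC ler_wpM2l ?expR_ge0//.
have := expR_ge1Dx (3 / 4 * u).
have := expRxMexpNx_1 (3 / 4 * u); have := expR_gt0 (- (3 / 4 * u)).
rewrite yu; set a := expR (- (3 / 4 * u)); set b := expR (3 / 4 * u) => a0 ba b1.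
have sa : 1 + 2 * s ^+ 2 * u <= (1 + 3 * s ^+ 2) * b.
  apply: (@le_trans _ _ ((1 + 3 * s ^+ 2) * (1 + 3 / 4 * u))).
    by have := mulr_ge0 (ltW s2_gt0) u0; have := s2_gt0; lra.
  by rewrite ler_wpM2l// addr_ge0// mulr_ge0// ltW.
have : (1 + 2 * s ^+ 2 * u) * a <= (1 + 3 * s ^+ 2) * b * a by rewrite ler_wpM2r// ltW.
by rewrite -[X in _ <= X -> _]mulrA ba mulr1.
Qed.

Lemma integrable_mul_normal_pdf (f : R -> R) (C : R) : measurable_fun setT f ->
  (forall x, `|f x| <= C * (1 + (x - m) ^+ 2)) ->
  leb.-integrable setT (fun x => (f x * normal_pdf m s x)%:E).
Proof.
move=> mf fC; have C0 : 0 <= C.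
  by have := le_trans (normr_ge0 _) (fC m); rewrite subrr expr0n/= addr0 mulr1.
apply: le_integrable (integrableZl measurableT C integrable_Q) => //.
  exact/measurable_EFinP/measurable_funM.
move=> x _; rewrite /= lee_fin [leRHS]ger0_norm; last first.
  by rewrite mulr_ge0// mulr_ge0// normal_fun_ge0.
rewrite normrM (ger0_norm (p_ge0 x)).
apply: le_trans (_ : C * ((1 + (x - m) ^+ 2) * p x) <= _); last exact: ler_wpM2l.
by rewrite mulrA ler_wpM2r.
Qed.

(** The hypothesis fits both n + 1 and -(n + 1), so one limit serves both ends of a growing
    interval. *)
Let Q_cvg0 (u : nat -> R) : (forall n : nat, (n%:R - `|m|) <= `|u n - m|) ->
  Q (u n) @[n --> \oo] --> 0.
Proof.
move=> un; rewrite -[X in _ --> X](mulr0 K); apply: cvgMr.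
rewrite (_ : (fun n => _) = (fun x => expR (- x)) \o
  (fun n => (u n - m) ^+ 2 / ((2 * s) ^+ 2 *+ 2))); last first.
  by apply/funext => n; rewrite /normal_fun /= mulNr.
apply: cvg_comp; last exact: cvgr_expR.
set D := (2 * s) ^+ 2 *+ 2.
have D0 : 0 < D by rewrite pmulrn_lgt0// exprn_even_gt0//= mulf_neq0.
apply/cvgryPge => A; near=> n.
rewrite ler_pdivlMr// -(real_normK (num_real (u n - m))).
have : `|m| + `|A * D| + 1 <= n%:R by near: n; exact: nbhs_infty_ger.
have := un n; have := ler_norm (A * D); have := normr_ge0 (A * D).
nra.
Unshelve. all: by end_near. Qed.

(** Integration by parts. As p' = -((x - m) / s^2) p, the function g below is the derivative of F p.
    Its integral over [-n, n] is a boundary term, which vanishes in the limit because p beats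
    quadratic growth. *)
Lemma normal_stein (F F' : R -> R) (C : R) :
  (forall x : R, is_derive x (1 : R) F (F' x)) -> continuous F' ->
  (forall x, `|F x| <= C * (1 + (x - m) ^+ 2)) ->
  (forall x, `|F' x| <= C * (1 + (x - m) ^+ 2)) ->
  (forall x, `|F x * (x - m)| <= C * (1 + (x - m) ^+ 2)) ->
  \int[leb]_x ((F x * (x - m)) * normal_pdf m s x) =
  s ^+ 2 * \int[leb]_x (F' x * normal_pdf m s x).
Proof.
move=> dF cF' FC F'C FxC.
have cF : continuous F.
  move=> x; apply: differentiable_continuous; apply/derivable1_diffP.
  by have [] := dF x.
have cxm : continuous (fun x : R => x - m).
  by move=> x; apply: cvgB; [exact: cvg_id|exact: cvg_cst].
have mF' := continuous_measurable_fun cF'.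
have mF := continuous_measurable_fun cF.
have mxm := continuous_measurable_fun cxm.
have i1 : leb.-integrable setT (fun x => (F' x * normal_pdf m s x)%:E).
  exact: integrable_mul_normal_pdf F'C.
have i2 : leb.-integrable setT (fun x => ((F x * (x - m)) * normal_pdf m s x)%:E).
  by apply: integrable_mul_normal_pdf FxC; exact: measurable_funM.
pose g x := F' x * p x - (s ^+ 2)^-1 * ((F x * (x - m)) * p x).
have ig : leb.-integrable setT (EFin \o g).
  have i3 := integrableZl measurableT (s ^+ 2)^-1 i2.
  by have := integrableB measurableT i1 i3; apply: eq_integrable.
have cg : continuous g.
  move=> x; apply: cvgB; first by apply: cvgM; [exact: cF'|exact: continuous_p].
  apply: cvgM; first exact: cvg_cst.
  apply: cvgM; last exact: continuous_p.
  by apply: cvgM; [exact: cF|exact: cxm].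
have dG (x : R) : is_derive x (1 : R) (fun x => F x * p x) (g x).
  have ? := dF x; have ? := is_derive_p x.
  by apply: is_derive_eq; rewrite /g /GRing.scale/=; field.
have cG : continuous (fun x => F x * p x).
  by move=> x; apply: cvgM; [exact: cF|exact: continuous_p].
suff g0 : \int[leb]_x g x = 0.
  have i3 : leb.-integrable setT
      (EFin \o (fun x => (s ^+ 2)^-1 * ((F x * (x - m)) * p x))).
    exact: (integrableZl measurableT (s ^+ 2)^-1 i2).
  move: g0; rewrite /g RintegralB// RintegralZl//.
  by move/eqP; rewrite subr_eq0 => /eqP ->; rewrite mulrA divff// mul1r.
pose f_ (n : nat) x := (EFin \o g \_ `[- n%:R, n%:R]) x.
(* The index n + 1 keeps the interval nondegenerate, as the fundamental theorem of calculus
   requires. *)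
have f_E n : (\int[leb]_x f_ n.+1 x)%E =
    (F n.+1%:R * p n.+1%:R - F (- n.+1%:R) * p (- n.+1%:R))%:E.
  rewrite /f_ -restrict_EFin -integral_mkcond.
  rewrite (continuous_FTC2 (F := fun x => F x * p x))//.
  - by rewrite gtrN// ltr0n.
  - exact: continuous_subspaceT.
  - split; first by move=> x _; have [] := dG x.
      exact: cvg_at_right_filter (cG _).
    exact: cvg_at_left_filter (cG _).
  - by move=> x _; rewrite derive1E; have [_ ->] := dG x.
have fcvg : (\int[leb]_x f_ n x)%E @[n --> \oo] --> (\int[leb]_x (EFin \o g) x)%E.
  apply: (@dominated_cvg _ _ _ leb setT measurableT f_ (EFin \o g)
    (fun x => `|g x|%:E)).
  - move=> n; apply/measurable_EFinP.
    apply/(measurable_restrictT _ _).1 => //.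
    by apply: measurable_funTS; exact: continuous_measurable_fun.
  - move=> x _; apply: cvg_near_cst; near=> n.
    rewrite /f_ /= patchE ifT// inE/= in_itv/= -ler_norml.
    by near: n; exact: nbhs_infty_ger.
  - by [].
  - exact: integrable_norm.
  - move=> n x _; rewrite /f_ /= patchE lee_fin.
    by case: ifP => // _; rewrite normr0.
rewrite /Rintegral.
suff H : (\int[leb]_x f_ n x)%E @[n --> \oo] --> 0%E.
  by have /= -> := cvg_unique (@ereal_hausdorff R) fcvg H.
rewrite -cvg_shiftS/=; under eq_cvg do rewrite f_E.
apply: cvg_EFin; first by near=> n.
rewrite /comp/= -[X in _ --> X](subrr 0).
have lim (u : nat -> R) : (forall n : nat, (n%:R - `|m|) <= `|u n - m|) ->
    F (u n) * p (u n) @[n --> \oo] --> 0.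
  move=> un; apply/norm_cvg0P.
  apply: (@squeeze_cvgr _ _ _ _ (cst 0) (fun n => C * Q (u n))).
  - near=> n; rewrite normr_ge0/= normrM (ger0_norm (p_ge0 _)).
    have C0 : 0 <= C.
      by have := le_trans (normr_ge0 _) (FC m); rewrite subrr expr0n/= addr0 mulr1.
    apply: le_trans (_ : C * ((1 + (u n - m) ^+ 2) * p (u n)) <= _).
      by rewrite mulrA ler_wpM2r.
    exact: ler_wpM2l.
  - exact: cvg_cst.
  - by rewrite -[X in _ --> X](mulr0 C); apply: cvgMr; exact: Q_cvg0.
apply: cvgB.
  apply: (lim (fun n => n.+1%:R)) => n.
  have := ler_norm (n.+1%:R - m); have := ler_norm m; rewrite -natr1; lra.
apply: (lim (fun n => - n.+1%:R)) => n.
have := ler_norm (- (- n.+1%:R - m)); rewrite normrN.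
have := ler_norm (- m); rewrite normrN -natr1; lra.
Unshelve. all: by end_near. Qed.

End normal.

Section normal_moments.
Context {R : realType}.
Variables (m s b : R).
Hypothesis s0 : s != 0.
Notation leb := (@lebesgue_measure R).
Notation p := (normal_pdf m s).

Let bound1 (y : R) : `|y| <= 1 + y ^+ 2.
Proof.
rewrite ler_norml.
by have := sqr_ge0 (y + 1); have := sqr_ge0 (y - 1); nra.
Qed.

Let mxm : measurable_fun setT (fun x : R => x - m).
Proof. exact: measurable_funB. Qed.

Let Rintegral_pdf : \int[leb]_x p x = 1.
Proof. by rewrite /Rintegral integral_normal_pdf. Qed.

Let density_integrable (f : R -> R) (C : R) : measurable_fun setT f ->
  (forall x, `|f x| <= C * (1 + (x - m) ^+ 2)) ->
  (normal_prob m s).-integrable setT (EFin \o f) /\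
  \int[normal_prob m s]_x f x = \int[leb]_x (f x * p x).
Proof.
move=> mf fC; have i := integrable_mul_normal_pdf s0 mf fC.
split.
  apply: (integrable_density (mu := leb) (h := p)) => //.
  - exact: measurable_normal_pdf.
  - exact: normal_pdf_ge0.
apply: (Rintegral_density (mu := leb) (h := p)) => //.
- exact: measurable_normal_pdf.
- exact: normal_pdf_ge0.
Qed.

Lemma normal_prob_centered :
  (normal_prob m s).-integrable setT (EFin \o (fun x => x - m)) /\
  \int[normal_prob m s]_x (x - m) = 0.
Proof.
have [|x|i ->] := @density_integrable (fun x => x - m) 1 => //.
  by rewrite mul1r; exact: bound1.
split => //.
have := @normal_stein _ m s s0 (fun=> 1) (fun=> 0) 1.
under eq_Rintegral do rewrite mul1r.
move=> ->.
- under eq_Rintegral do rewrite mul0r.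
  by rewrite Rintegral_cst// mul0r mulr0.
- by move=> x; exact: cvg_cst.
- by move=> x; rewrite normr1 mul1r lerDl sqr_ge0.
- by move=> x; rewrite normr0 mul1r addr_ge0// sqr_ge0.
- by move=> x; rewrite !mul1r; exact: bound1.
Qed.

Lemma normal_prob_variance :
  (normal_prob m s).-integrable setT (EFin \o (fun x => (x - m) ^+ 2)) /\
  \int[normal_prob m s]_x (x - m) ^+ 2 = s ^+ 2.
Proof.
have [||i ->] := @density_integrable (fun x => (x - m) ^+ 2) 1 => //.
- exact: measurable_funX.
- by move=> x; rewrite mul1r ger0_norm ?sqr_ge0// lerDr.
split => //.
have dF (x : R) : is_derive x (1 : R) (fun x : R => x - m) 1.
  by apply: is_derive_eq; rewrite subr0.
have := @normal_stein _ m s s0 (fun x => x - m) (fun=> 1) 1 dF.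
under eq_Rintegral do rewrite -expr2.
move=> ->.
- under eq_Rintegral do rewrite mul1r.
  by rewrite Rintegral_pdf mulr1.
- by move=> x; exact: cvg_cst.
- by move=> x; rewrite mul1r; exact: bound1.
- by move=> x; rewrite normr1 mul1r lerDl sqr_ge0.
- by move=> x; rewrite -expr2 mul1r ger0_norm ?sqr_ge0// lerDr.
Qed.

(** A real characteristic function with phase b. Differentiation under the integral yields a sine
    times x - m, and Stein's identity for that sine turns this into phi' = - s^2 t phi. *)
Let phi (t : R) : R := \int[leb]_x (cos (t * (x - m) + b) * p x).

Let mcos : measurable_fun setT (@cos R).
Proof. by apply: continuous_measurable_fun; exact: continuous_cos. Qed.

Let msin : measurable_fun setT (@sin R).
Proof. by apply: continuous_measurable_fun; exact: continuous_sin. Qed.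

Let mlin (t : R) : measurable_fun setT (fun x : R => t * (x - m) + b).
Proof. by apply: measurable_funD => //; exact: measurable_funM. Qed.

Let icos (t : R) : leb.-integrable setT (EFin \o (fun x => cos (t * (x - m) + b) * p x)).
Proof.
apply: (@integrable_mul_normal_pdf _ m s s0 _ 1).
  exact: (measurableT_comp mcos (mlin t)).
by move=> x; rewrite mul1r (le_trans (cos_max _))// lerDl sqr_ge0.
Qed.

Let dcos (t x : R) :
  is_derive t (1 : R) (fun t => cos (t * (x - m) + b) * p x)
    (- (sin (t * (x - m) + b) * (x - m)) * p x).
Proof.
apply: is_derive_eq.
rewrite !scaler0 /GRing.scale/= ?add0r ?addr0 ?mulr1.
by ring.
Qed.

Let is_derive_phi (t : R) : is_derive t (1 : R) phi (- (s ^+ 2 * t) * phi t).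
Proof.
have pE t' x : partial1of2 (fun t x => cos (t * (x - m) + b) * p x) t' x =
    - (sin (t' * (x - m) + b) * (x - m)) * p x.
  by rewrite partial1of2E; have [_ ->] := dcos t' x.
pose G x := `|x - m| * p x.
have iG : leb.-integrable setT (EFin \o G).
  apply: (@integrable_mul_normal_pdf _ m s s0 (fun x => `|x - m|) 1).
    exact: measurableT_comp.
  by move=> x; rewrite mul1r normr_id; exact: bound1.
have It : `]t - 1, t + 1[%classic t by rewrite /= in_itv/= ltrDl ltrBlDr ltrDl ltr01.
have GB x y : `]t - 1, t + 1[%classic x -> setT y ->
    `|partial1of2 (fun t x => cos (t * (x - m) + b) * p x) x y| <= G y.
  move=> _ _; rewrite pE normrM normrN (ger0_norm (normal_pdf_ge0 _ _ _)).
  rewrite ler_wpM2r ?normal_pdf_ge0// normrM ler_piMl//.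
  exact: sin_max.
have G0 y : 0 <= G y by rewrite mulr_ge0 ?normal_pdf_ge0.
have der x y : `]t - 1, t + 1[%classic x -> setT y ->
    derivable ((fun t x => cos (t * (x - m) + b) * p x) ^~ y) x 1.
  by move=> _ _; have [] := dcos x y.
apply: DeriveDef.
  exact: (derivable_under_integral measurableT It (fun x _ => icos x) der G0 iG GB).
rewrite -derive1E.
rewrite (differentiation_under_integral measurableT It (fun x _ => icos x) der G0 iG GB).
under eq_Rintegral do rewrite pE mulNr -mulN1r.
rewrite RintegralZl//; last first.
  apply: (@integrable_mul_normal_pdf _ m s s0 (fun x => sin (t * (x - m) + b) * (x - m)) 1).
    by apply: measurable_funM => //; exact: (measurableT_comp msin (mlin t)).
  move=> x; rewrite mul1r normrM (le_trans _ (bound1 _))// ler_piMl//.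
  exact: sin_max.
have le1 (y : R) : 1 + y ^+ 2 <= (1 + `|t|) * (1 + y ^+ 2).
  by rewrite ler_peMl ?addr_ge0 ?sqr_ge0// lerDl.
have dF (x : R) : is_derive x (1 : R) (fun x : R => sin (t * (x - m) + b))
    (t * cos (t * (x - m) + b)).
  apply: is_derive_eq; rewrite ?scaler0 ?subr0 ?add0r ?addr0 /GRing.scale/=.
  by ring.
rewrite (normal_stein s0 (C := 1 + `|t|) dF).
- under eq_Rintegral do rewrite -mulrA.
  rewrite RintegralZl//.
  by rewrite mulN1r mulNr mulrA.
- move=> x; apply: cvgM; first exact: cvg_cst.
  apply: (continuous_comp (f := fun x => t * (x - m) + b)); last exact: continuous_cos.
  apply: cvgD; last exact: cvg_cst.
  apply: cvgM; first exact: cvg_cst.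
  by apply: cvgB; [exact: cvg_id|exact: cvg_cst].
- move=> x; apply: le_trans (le1 _); rewrite (le_trans (sin_max _))//.
  by rewrite lerDl sqr_ge0.
- move=> x; rewrite normrM; apply: (@le_trans _ _ (`|t| * 1)).
    by rewrite ler_wpM2l// cos_max.
  by apply: ler_pM => //; rewrite ?lerDr// lerDl sqr_ge0.
- move=> x; apply: le_trans (le1 _); rewrite normrM (le_trans _ (bound1 _))// ler_piMl//.
  exact: sin_max.
Qed.

Let phi0 : phi 0 = cos b.
Proof.
rewrite /phi; under eq_Rintegral do rewrite mul0r add0r.
rewrite RintegralZl// ?Rintegral_pdf ?mulr1//.
exact: integrable_normal_pdf.
Qed.

Let phiE : phi 1 = expR (- (s ^+ 2 / 2)) * cos b.
Proof.
(* The integrating factor of the differential equation: psi is constant, and psi 0 = cos b. *)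
pose psi (t : R) := phi t * expR (s ^+ 2 * t ^+ 2 / 2).
have dpsi (t : R) : is_derive t (1 : R) psi 0.
  have ? := is_derive_phi t.
  apply: is_derive_eq; rewrite !scaler0 /GRing.scale/=.
  by field.
have := is_derive_0_is_cst 1 0 dpsi.
rewrite /psi phi0 expr0n/= mulr0 mul0r expR0 mulr1 expr1n mulr1 => h.
by rewrite -h mulrCA [X in _ * X]mulrC expRxMexpNx_1 mulr1.
Qed.

Lemma normal_prob_cos : \int[normal_prob m s]_x cos ((x - m) + b) = expR (- (s ^+ 2 / 2)) * cos b.
Proof.
have [||i ->] := @density_integrable (fun x => cos ((x - m) + b)) 1.
- apply: (measurableT_comp mcos); exact: measurable_funD.
- by move=> x; rewrite mul1r (le_trans (cos_max _))// lerDl sqr_ge0.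
by rewrite -phiE /phi; apply: eq_Rintegral => x _; rewrite mul1r.
Qed.

End normal_moments.

(** * A criterion for convergence in law *)

Section row_measurability.
Context {R : realType} (d : nat).

Lemma continuous_row_measurable (g : 'rV[R]_d -> R) :
  continuous g -> measurable_fun setT g.
Proof.
move=> cg; apply: (measurability _ (RGenOpens.measurableE R)).
move=> _ [_ [a [b ->] <-]]; rewrite setTI.
apply: sub_sigma_algebra; rewrite /=.
apply: open_comp; last exact: interval_open.
by move=> x _; exact: cg.
Qed.

Lemma measurable_row_coord (l : 'I_d) :
  measurable_fun setT (fun x : 'rV[R]_d => x 0 l).
Proof. by apply: continuous_row_measurable => x; exact: coord_continuous. Qed.

Lemma measurable_row dO (O : measurableType dO) (f : 'I_d -> O -> R) :
  (forall l, measurable_fun setT (f l)) ->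
  measurable_fun setT (fun w => \row_(l < d) f l w).
Proof.
move=> mf.
rewrite (_ : (fun _ => _) = (fun t : d.-tuple R => \row_(i < d) tnth t i) \o
  (fun w => [tuple f i w | i < d])); last first.
  by apply/funext => w; apply/rowP => i; rewrite !mxE tnth_mktuple.
apply: measurableT_comp; first exact: measurable_row_of_tuple.
apply/measurable_fun_tnthP => i.
rewrite (_ : _ \o _ = f i)//.
by apply/funext => w; rewrite /= tnth_mktuple.
Qed.

(** Only x is confined to the cube; y may lie outside it. Near each point of the compact cube half
    of the continuity radius works, and compactness makes the radius uniform. *)
Lemma continuous_unif_box (g : 'rV[R]_d -> R) (L e : R) :
  continuous g -> 0 < e ->
  exists2 eta : R, 0 < eta & forall x y : 'rV[R]_d,
    (forall l, `|x 0 l| <= L) -> (forall l, `|x 0 l - y 0 l| < eta) ->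
    `|g x - g y| <= e.
Proof.
move=> cg e0.
pose K := [set x : 'rV[R]_d | forall l, `[- L, L]%classic (x ord0 l)].
have cK : compact K.
  exact: (@rV_compact R d (fun=> `[- L, L]%classic) (fun=> @segment_compact R (- L) L)).
pose Q (eta : R) (x : 'rV[R]_d) := forall y, ball x eta y -> `|g x - g y| <= e.
have /compact_near_coveringP cov := cK.
have [E [E0 KE]] : exists eta, 0 < eta /\ K `<=` Q eta.
  suff : \forall eta \near 0^'+, K `<=` Q eta.
    move=> H; near (0:R)^'+ => t; exists t; split; last by near: t.
    by near: t; exact: nbhs_right_gt.
  apply: (cov R (0^'+) Q) => x Kx.
  have /cvgrPdist_lt/(_ (e / 2) (divr_gt0 e0 (ltr0n R 2))) : g y @[y --> x] --> g x.
    exact: cg.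
  move=> /nbhs_ballP[dl /= dl0 xdl].
  exists (ball x (dl / 2), [set t | 0 < t < dl / 2]).
    split => /=; first by apply: nbhsx_ballx; exact: divr_gt0.
    near=> t; rewrite /=; apply/andP; split; first by near: t; exact: nbhs_right_gt.
    by near: t; apply: nbhs_right_lt; exact: divr_gt0.
  move=> [x' t] /= [xx' /andP[t0 tdl]] y x'y.
  rewrite [e]splitr (le_trans (ler_distD (g x) _ _))// lerD//.
    rewrite distrC ltW//; apply: xdl => /=.
    by apply: le_ball xx'; rewrite ler_pdivrMr// ler_pMr// ler1n.
  rewrite ltW//; apply: xdl => /=; rewrite [dl]splitr.
  apply: (ball_triangle xx'); apply: le_ball x'y; exact: ltW.
exists E => // x y xL xy; apply: (KE x) => [l|].
  by rewrite /= in_itv/= -ler_norml.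
by rewrite row_ballE// => l _; exact: xy.
Unshelve. all: by end_near. Qed.

End row_measurability.

(** * Bernstein polynomials as expectations of a random walk *)

Section random_walk.
Context {R : realType} (d : nat).
Implicit Types (y x : 'rV[R]_d) (F G : 'rV[R]_d -> R) (s : seq 'I_d).

(* Expectation of F at the end of a walk started at y which, for each l in s
   in turn, moves by delta in direction l with probability t l.  A multivariate
   Bernstein polynomial in t. *)
Fixpoint walk (t : 'I_d -> R) (delta : R) F s y : R :=
  if s is l :: s' then
    t l * walk t delta F s' (y + delta *: 'e_l)
    + (1 - t l) * walk t delta F s' y
  else F y.

Variables (t : 'I_d -> R) (delta : R).
Hypothesis t01 : forall l, 0 <= t l <= 1.

Let t_ge0 l : 0 <= t l. Proof. by have /andP[] := t01 l. Qed.
Let t'_ge0 l : 0 <= 1 - t l.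
Proof. by rewrite subr_ge0; have /andP[] := t01 l. Qed.

Lemma walk_cst (c : R) s y : walk t delta (cst c) s y = c.
Proof. by elim: s y => //= l s ih y; rewrite !ih; ring. Qed.

Lemma walkD F G s y :
  walk t delta (fun z => F z + G z) s y = walk t delta F s y + walk t delta G s y.
Proof. by elim: s y => //= l s ih y; rewrite !ih; ring. Qed.

Lemma walkZ (c : R) F s y :
  walk t delta (fun z => c * F z) s y = c * walk t delta F s y.
Proof. by elim: s y => //= l s ih y; rewrite !ih; ring. Qed.

Lemma walk_sum (I : Type) (r : seq I) (F : I -> 'rV[R]_d -> R) s y :
  walk t delta (fun z => \sum_(i <- r) F i z) s y =
  \sum_(i <- r) walk t delta (F i) s y.
Proof.
elim: r => [|i r ih].
  rewrite big_nil; under [X in walk _ _ X]eq_fun do rewrite big_nil.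
  exact: walk_cst.
rewrite big_cons -ih -walkD.
by under [X in walk _ _ X]eq_fun do rewrite big_cons.
Qed.

Lemma walk_le F G s y : (forall z, F z <= G z) ->
  walk t delta F s y <= walk t delta G s y.
Proof.
by move=> FG; elim: s y => //= l s ih y; rewrite lerD// ler_wpM2l.
Qed.

Lemma walk_norm F s y : `|walk t delta F s y| <= walk t delta (fun z => `|F z|) s y.
Proof.
elim: s y => //= l s ih y; apply: le_trans (ler_normD _ _) _.
by rewrite !normrM !(ger0_norm (t_ge0 _)) !(ger0_norm (t'_ge0 _)) lerD// ler_wpM2l.
Qed.

(** Squared bias plus variance: coordinate l receives [count_mem l s] independent moves, each of
    mean delta t_l and variance delta^2 t_l (1 - t_l). *)
Lemma walk_sqr (l : 'I_d) (c : R) s y :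
  walk t delta (fun z => (z 0 l - c) ^+ 2) s y =
  (y 0 l - c + (count_mem l s)%:R * (delta * t l)) ^+ 2 +
  (count_mem l s)%:R * (delta ^+ 2 * (t l * (1 - t l))).
Proof.
elim: s y => [|i s ih] y /=; first by rewrite !mul0r !addr0.
rewrite !ih !mxE eqxx /=; case: (eqVneq i l) => [->|il].
  by rewrite natrD [true%:R]mulr1n; ring.
by rewrite natrD [false%:R]mulr0n; ring.
Qed.

End random_walk.

(** * Trigonometric polynomials *)

Section trigonometric.
Context {R : realType} (d : nat).

Definition row_dot (a : 'I_d -> R) (x : 'rV[R]_d) : R := \sum_(l < d) a l * x 0 l.

Inductive trig_poly : ('rV[R]_d -> R) -> Prop :=
| trig_cos a b : trig_poly (fun x => cos (row_dot a x + b))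
| trig_add g h : trig_poly g -> trig_poly h -> trig_poly (fun x => g x + h x)
| trig_scale c g : trig_poly g -> trig_poly (fun x => c * g x).

Lemma trig_cst (c : R) : trig_poly (fun=> c).
Proof.
have := trig_scale c (trig_cos (fun=> 0) 0); congr trig_poly.
apply/funext => x; rewrite /row_dot big1 ?addr0 ?cos0 ?mulr1// => i _.
by rewrite mul0r.
Qed.

Lemma trig_mul g h : trig_poly g -> trig_poly h -> trig_poly (fun x => g x * h x).
Proof.
move=> + th; elim => [a b|g1 g2 _ ih1 _ ih2|c g1 _ ih].
- elim: th => [a' b'|h1 h2 _ ih1 _ ih2|c h1 _ ih].
  + have := trig_scale (1 / 2) (trig_add
      (trig_cos (fun l => a l + a' l) (b + b'))
      (trig_cos (fun l => a l - a' l) (b - b'))).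
    congr trig_poly; apply/funext => x.
    have -> : row_dot (fun l => a l + a' l) x = row_dot a x + row_dot a' x.
      by rewrite -big_split/=; apply: eq_bigr => l _; rewrite mulrDl.
    have -> : row_dot (fun l => a l - a' l) x = row_dot a x - row_dot a' x.
      by rewrite -sumrB; apply: eq_bigr => l _; rewrite mulrBl.
    rewrite (_ : _ + _ + (b + b') = (row_dot a x + b) + (row_dot a' x + b')).
      rewrite (_ : _ - _ + (b - b') = (row_dot a x + b) - (row_dot a' x + b')).
        by rewrite cosD cosB; field.
      by ring.
    by ring.
  + have := trig_add ih1 ih2; congr trig_poly; apply/funext => x.
    by rewrite mulrDr.
  + by have := trig_scale c ih; congr trig_poly; apply/funext => x; rewrite mulrCA.
- by have := trig_add ih1 ih2; congr trig_poly; apply/funext => x; rewrite mulrDl.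
- by have := trig_scale c ih; congr trig_poly; apply/funext => x; rewrite mulrA.
Qed.

Lemma trig_sin (c : R) (l : 'I_d) : trig_poly (fun x => sin (c * x 0 l)).
Proof.
have := trig_cos (fun i => if i == l then c else 0) (- (pi / 2)).
congr trig_poly; apply/funext => x; rewrite cosBpihalf; congr sin.
rewrite /row_dot (bigD1 l)//= eqxx big1 ?addr0// => i /negbTE ->.
by rewrite mul0r.
Qed.

(** F enters only through its values at finitely many end points, which are constants in x; the walk
    is a polynomial in the probabilities t x l. *)
Lemma trig_walk (t : 'rV[R]_d -> 'I_d -> R) delta F s y :
  (forall l, trig_poly (t ^~ l)) ->
  trig_poly (fun x => walk (t x) delta F s y).
Proof.
move=> tt; elim: s y => [|l s ih] y /=; first exact: trig_cst.
apply: trig_add; apply: trig_mul => //.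
have := trig_add (trig_cst 1) (trig_scale (-1) (tt l)).
by congr trig_poly; apply/funext => x; rewrite mulN1r.
Qed.

Lemma continuous_row_dot a : continuous (row_dot a).
Proof.
rewrite /row_dot; elim: (index_enum _) => [|l r ih] x.
  rewrite (_ : (fun _ => _) = cst 0); first exact: cst_continuous.
  by apply/funext => z; rewrite big_nil.
rewrite (_ : (fun _ => _) =
    fun z : 'rV[R]_d => a l * z 0 l + \sum_(i <- r) a i * z 0 i).
  have ca : {for x, continuous (cst (a l) \* (fun z : 'rV[R]_d => z 0 l))}.
    by apply: continuousM; [exact: cst_continuous|exact: coord_continuous].
  exact: (continuousD ca (ih x)).
by apply/funext => z; rewrite big_cons.
Qed.

Lemma trig_poly_measurable g : trig_poly g -> measurable_fun setT g.
Proof.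
elim => [a b|g1 g2 _ m1 _ m2|c g1 _ m1].
- apply: measurableT_comp.
    by apply: continuous_measurable_fun; exact: continuous_cos.
  apply: measurable_funD; last exact: measurable_cst.
  by apply: continuous_row_measurable; exact: continuous_row_dot.
- exact: measurable_funD.
- exact: measurable_funM.
Qed.

Lemma trig_poly_bounded g : trig_poly g -> exists M, forall x, `|g x| <= M.
Proof.
elim => [a b|g1 g2 _ [M1 h1] _ [M2 h2]|c g1 _ [M1 h1]].
- by exists 1 => x; exact: cos_max.
- by exists (M1 + M2) => x; rewrite (le_trans (ler_normD _ _))// lerD.
- by exists (`|c| * M1) => x; rewrite normrM ler_wpM2l.
Qed.

End trigonometric.

Section trig_approximation.
Context {R : realType} (d : nat).
Variables (g : 'rV[R]_d -> R) (M : R).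
Hypotheses (cg : continuous g) (gM : forall x, `|g x| <= M).

Let M0 : 0 <= M. Proof. exact: le_trans (normr_ge0 _) (gM 0). Qed.

(** Bernstein's proof by Chebyshev's inequality. The walk starts at the corner with all coordinates
    -r and has N + 1 chances to move by 2r / (N + 1) in each direction, with probability (1 + u_l /
    r) / 2. Its end point has mean u and variance at most r^2 / (N + 1) in every coordinate. *)
Lemma bernstein_approx (r e : R) : 0 < r -> 0 < e ->
  exists delta s y, forall u : 'rV[R]_d, (forall l, `|u 0 l| <= r) ->
    `|walk (fun l => (1 + u 0 l / r) / 2) delta g s y - g u| <= e.
Proof.
move=> r0 e0.
have [eta eta0 unif] := continuous_unif_box r cg (divr_gt0 e0 (ltr0n R 2)).
(* The Chebyshev error will be at most C / (N + 1); N is chosen to bring this below e / 2. *)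
pose C := d%:R * (2 * M / eta ^+ 2 * r ^+ 2).
have C0 : 0 <= C.
  by rewrite mulr_ge0// mulr_ge0 ?sqr_ge0// divr_ge0 ?sqr_ge0// mulr_ge0.
have [N NC] : exists N : nat, C / (e / 2) < N.+1%:R.
  exists (Num.truncn (C / (e / 2))); exact: truncnS_gt.
have N0 : 0 < N.+1%:R :> R by rewrite ltr0n.
pose s := flatten (nseq N.+1 (enum 'I_d)).
pose y : 'rV[R]_d := const_mx (- r).
exists (2 * r / N.+1%:R), s, y => u ur.
set t := fun l => _; set delta := 2 * r / _.
have cs l : count_mem l s = N.+1.
  rewrite /s count_flatten map_nseq sumn_nseq count_uniq_mem ?enum_uniq//.
  by rewrite mem_enum mul1n.
have t01 l : 0 <= t l <= 1.
  have : `|u 0 l / r| <= 1 by rewrite normrM normfV (gtr0_norm r0) ler_pdivrMr// mul1r.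
  by rewrite ler_norml /t => /andP[h1 h2]; apply/andP; split; lra.
have -> : walk t delta g s y - g u = walk t delta (fun z => g z + - g u) s y.
  by rewrite (walkD t delta g (cst (- g u))) walk_cst.
apply: le_trans (walk_norm _ t01 _ _ _) _.
(* Where some coordinate is off by at least eta, 2 M is at most 2 M / eta^2 times its squared error;
   elsewhere uniform continuity gives e / 2. *)
pose B (z : 'rV[R]_d) := e / 2 + 2 * M / eta ^+ 2 * \sum_(l < d) (z 0 l - u 0 l) ^+ 2.
have gB z : `|g z + - g u| <= B z.
  have S0 : 0 <= \sum_(l < d) (z 0 l - u 0 l) ^+ 2.
    by apply: sumr_ge0 => l _; exact: sqr_ge0.
  have c0 : 0 <= 2 * M / eta ^+ 2 by rewrite divr_ge0 ?sqr_ge0// mulr_ge0.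
  have [zu|] := pselect (forall l, `|u 0 l - z 0 l| < eta).
    by rewrite distrC (le_trans (unif _ _ ur zu))// lerDl mulr_ge0.
  move=> /existsNP[l /negP]; rewrite -leNgt => zu.
  apply: (@le_trans _ _ (2 * M)).
    by rewrite (le_trans (ler_normB _ _))// mulrDl mul1r lerD.
  apply: (@le_trans _ _ (2 * M / eta ^+ 2 * (z 0 l - u 0 l) ^+ 2)).
    rewrite -mulrA ler_peMr// ?mulr_ge0// ler_pdivlMl ?exprn_gt0// mulr1.
    by rewrite -(real_normK (num_real (z 0 l - _))) distrC !expr2 ler_pM// ltW.
  rewrite -[leLHS]add0r lerD//; first by rewrite ltW// divr_gt0.
  rewrite ler_wpM2l// (bigD1 l)//= lerDl sumr_ge0// => i _; exact: sqr_ge0.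
apply: le_trans (walk_le _ t01 _ _ gB) _.
rewrite /B (walkD t delta (cst (e / 2))) walk_cst walkZ walk_sum.
rewrite [leRHS]splitr lerD2l.
have wl l : walk t delta (fun z => (z 0 l - u 0 l) ^+ 2) s y <= r ^+ 2 / N.+1%:R.
  rewrite walk_sqr cs mxE.
  rewrite (_ : - r - u 0 l + _ = 0); last first.
    rewrite /delta /t; move: (N.+1%:R) N0 => n1 n10.
    by field; rewrite !gt_eqF.
  rewrite expr0n/= add0r.
  rewrite (_ : N.+1%:R * _ = r ^+ 2 / N.+1%:R * (4 * (t l * (1 - t l)))); last first.
    rewrite /delta; move: (N.+1%:R) N0 => n1 n10.
    by field; rewrite gt_eqF.
  rewrite ler_piMr//; first by rewrite divr_ge0 ?sqr_ge0// ltW.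
  by have := sqr_ge0 (2 * t l - 1); nra.
apply: (@le_trans _ _ (2 * M / eta ^+ 2 * \sum_(l < d) r ^+ 2 / N.+1%:R)).
  rewrite ler_wpM2l//; first by rewrite divr_ge0 ?sqr_ge0// mulr_ge0.
  by apply: ler_sum => l _; exact: wl.
rewrite sumr_const card_ord -[_ *+ d]mulr_natl.
rewrite (_ : _ * _ = C / N.+1%:R); last by rewrite /C; ring.
by rewrite ler_pdivrMr// [leRHS]mulrC -ler_pdivrMr ?divr_gt0// ltW.
Qed.

(* The sine of a small multiple of a coordinate stands in for the coordinate:
   it turns polynomials into trigonometric ones and stays in a fixed cube. *)
Lemma trig_approx (L e : R) : 0 < L -> 0 < e ->
  exists2 h, trig_poly h & forall x, `|g x - h x| <=
    e + 2 * M * \sum_(l < d) Num.min 1 (`|x 0 l| / L).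
Proof.
move=> L0 e0; have e20 : 0 < e / 2 by exact: divr_gt0.
have [eta eta0 unif] := continuous_unif_box L cg e20.
(* For |x_l| <= L the sine expansion gives |sin(c x_l) / c - x_l| <= c L^2 = eta / 2 < eta. *)
pose c := eta / (2 * L ^+ 2).
have c0 : 0 < c by rewrite divr_gt0// mulr_gt0// exprn_gt0.
have cV0 : 0 < c^-1 by rewrite invr_gt0.
have [delta [s [y hB]]] := bernstein_approx cV0 e20.
pose u (x : 'rV[R]_d) : 'rV[R]_d := \row_l (sin (c * x 0 l) / c).
exists (fun x => walk (fun l => (1 + u x 0 l / c^-1) / 2) delta g s y).
  apply: trig_walk => l.
  have := trig_add (trig_cst _ (1 / 2)) (trig_scale (1 / 2) (trig_sin c l)).
  congr trig_poly; apply/funext => x; rewrite mxE.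
  by field; rewrite gt_eqF.
move=> x.
have uc l : `|u x 0 l| <= c^-1.
  by rewrite mxE normrM (gtr0_norm cV0) ler_piMl ?sin_max// ltW.
have uB := hB _ uc; rewrite distrC in uB.
have S0 : 0 <= \sum_(l < d) Num.min 1 (`|x 0 l| / L).
  by apply: sumr_ge0 => l _; rewrite le_min ler01 divr_ge0// ltW.
have gu : `|g x - g (u x)| <= e / 2 + 2 * M * \sum_(l < d) Num.min 1 (`|x 0 l| / L).
  have [xL|] := pselect (forall l, `|x 0 l| <= L).
    apply: le_trans (unif x (u x) xL _) _; last by rewrite lerDl mulr_ge0// mulr_ge0.
    move=> l; rewrite mxE.
    rewrite (_ : _ - _ = - ((sin (c * x 0 l) - c * x 0 l) / c)); last first.
      by field; rewrite gt_eqF.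
    rewrite normrN normrM (gtr0_norm cV0) ltr_pdivrMr//.
    apply: le_lt_trans (norm_sinBid_le _) _.
    apply: (@le_lt_trans _ _ ((c * x 0 l) ^+ 2)).
      by rewrite ler_piMr ?sqr_ge0// ge_min lexx.
    rewrite exprMn expr2 -mulrA mulrC ltr_pM2r// -(real_normK (num_real (x 0 l))).
    apply: (@le_lt_trans _ _ (c * L ^+ 2)).
      by rewrite ler_pM2l// !expr2 ler_pM.
    rewrite /c (_ : _ * _ = eta / 2); last by field; rewrite gt_eqF.
    by rewrite ltr_pdivrMr// ltr_pMr// ltr1n.
  (* Outside the cube some term of the sum equals 1, which pays for the trivial bound 2 M. *)
  move=> /existsNP[l /negP]; rewrite -ltNge => xL.
  apply: (@le_trans _ _ (2 * M)).
    by rewrite (le_trans (ler_normB _ _))// mulrDl mul1r lerD.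
  rewrite -[leLHS]add0r lerD//; first exact: ltW.
  rewrite ler_peMr ?mulr_ge0// (bigD1 l)//=.
  rewrite (_ : Num.min _ _ = 1); last first.
    by apply/min_idPl; rewrite ler_pdivlMr// mul1r ltW.
  by rewrite lerDl sumr_ge0// => i _; rewrite le_min ler01 divr_ge0// ltW.
rewrite (le_trans (ler_distD (g (u x)) _ _))//.
by rewrite [e]splitr addrAC lerD.
Qed.

End trig_approximation.

(** * Tightness and convergence tested on cosines *)

Section convergence_criterion.
Context {R : realType} (d : nat).

(** A bounded, continuous and subadditive measure of size: large L expresses tightness, L = 1
    convergence to 0 in probability. *)
Definition tail (L y : R) : R := Num.min 1 (`|y| / L).

Lemma measurable_tail L : measurable_fun setT (tail L).
Proof.
apply: measurable_minr; first exact: measurable_cst.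
apply: measurable_funM; last exact: measurable_cst.
exact: normr_measurable.
Qed.

Lemma tail_ge0 L y : 0 < L -> 0 <= tail L y.
Proof. by move=> L0; rewrite le_min ler01 divr_ge0// ltW. Qed.

Lemma tail_le1 L y : tail L y <= 1.
Proof. by rewrite ge_min lexx. Qed.

Lemma norm_tail_le1 L y : 0 < L -> `|tail L y| <= 1.
Proof. by move=> L0; rewrite ger0_norm ?tail_le1// tail_ge0. Qed.

Lemma tailD L x y : 0 < L -> tail L (x + y) <= tail L x + tail L y.
Proof.
move=> L0; have x0 := tail_ge0 x L0; have y0 := tail_ge0 y L0.
move: x0 y0; rewrite /tail.
case: (lerP 1 (`|x| / L)) => [_ _ y0|_ x0].
  by rewrite (@le_trans _ _ 1) ?ge_min ?lexx// lerDl.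
case: (lerP 1 (`|y| / L)) => [_ y0|_ y0].
  by rewrite (@le_trans _ _ 1) ?ge_min ?lexx// lerDr.
by rewrite ge_min -mulrDl ler_wpM2r ?orbT ?ler_normD// invr_ge0 ltW.
Qed.

Lemma tail_le_sqr L y : 0 < L -> tail L y <= (1 + y ^+ 2) / L.
Proof.
move=> L0; rewrite ge_min; apply/orP; right; rewrite ler_pM2r ?invr_gt0//.
rewrite ler_norml.
by have := sqr_ge0 (y + 1); have := sqr_ge0 (y - 1); nra.
Qed.

(** Formulated with expectations of [tail], the very error term left by [trig_approx]. All levels
    beyond L0 are included so that the levels of two families can be joined by a maximum. *)
Definition tight dO (O : measurableType dO) (P : probability O R)
    (U : nat -> O -> 'rV[R]_d) : Prop :=
  forall e : R, 0 < e -> exists2 L0 : R, 0 < L0 & forall L, L0 <= L ->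
    \forall n \near \oo, forall l, \int[P]_w tail L (U n w 0 l) <= e.

Section tightness.
Context dO (O : measurableType dO) (P : probability O R).
Variable U : nat -> O -> 'rV[R]_d.
Hypothesis mU : forall n, measurable_fun setT (U n).

Lemma integrable_tail L n l : 0 < L ->
  P.-integrable setT (EFin \o (fun w => tail L (U n w 0 l))).
Proof.
move=> L0; apply: (@bounded_integrable _ _ _ P _ 1).
  apply: (measurableT_comp (measurable_tail L)).
  exact: (measurableT_comp (measurable_row_coord l) (mU n)).
by move=> w; exact: norm_tail_le1.
Qed.

Lemma tight_of_second_moment (C : R) :
  (\forall n \near \oo, forall l,
    P.-integrable setT (EFin \o (fun w => U n w 0 l ^+ 2)) /\
    \int[P]_w (U n w 0 l) ^+ 2 <= C) -> tight P U.
Proof.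
move=> UC e e0; exists ((1 + `|C|) / e) => [|L LC].
  by rewrite divr_gt0// ltr_pwDl.
have L0 : 0 < L by rewrite (lt_le_trans _ LC)// divr_gt0// ltr_pwDl.
apply: filterS UC => n UC l; have [i2 iC] := UC l.
have i1 := integrable_addr (integrable_cst P 1) i2.
apply: (@le_trans _ _ (\int[P]_w (L^-1 * (1 + U n w 0 l ^+ 2)))).
  apply: le_Rintegral => //; first exact: integrable_tail.
    exact: integrable_mulr.
  by move=> w _; rewrite mulrC tail_le_sqr.
rewrite RintegralZl// RintegralD//; last exact: integrable_cst.
rewrite Rintegral_prob_cst mulrC ler_pdivrMr//.
rewrite ler_pdivrMr// in LC.
by have := ler_norm C; lra.
Qed.

End tightness.

Section criterion.
Context dO (O : measurableType dO) (P : probability O R).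
Context dV (OV : measurableType dV) (Q : probability OV R).
Variables (U : nat -> O -> 'rV[R]_d) (V : OV -> 'rV[R]_d).
Hypotheses (mU : forall n, measurable_fun setT (U n)) (mV : measurable_fun setT V).
Hypothesis UVcos : forall a b,
  \int[P]_w cos (row_dot a (U n w) + b) @[n --> \oo] -->
  \int[Q]_w cos (row_dot a (V w) + b).
Hypotheses (tU : tight P U) (tV : tight Q (fun=> V)).

Let trig_integrable dO' (O' : measurableType dO') (P' : probability O' R)
    (W : O' -> 'rV[R]_d) h : measurable_fun setT W -> trig_poly h ->
  P'.-integrable setT (EFin \o (fun w => h (W w))).
Proof.
move=> mW th; have [M hM] := trig_poly_bounded th.
apply: (@bounded_integrable _ _ _ P' _ M) => //.
exact: (measurableT_comp (trig_poly_measurable th) mW).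
Qed.

Lemma trig_poly_cvg h : trig_poly h ->
  \int[P]_w h (U n w) @[n --> \oo] --> \int[Q]_w h (V w).
Proof.
elim => [//|g1 g2 t1 c1 t2 c2|c g1 t1 c1].
  rewrite RintegralD//; [|exact: trig_integrable..].
  rewrite (_ : (fun n => _) = fun n => \int[P]_w g1 (U n w) + \int[P]_w g2 (U n w)).
    exact: cvgD.
  by apply/funext => n; rewrite RintegralD//; exact: trig_integrable.
rewrite RintegralZl//; last exact: trig_integrable.
rewrite (_ : (fun n => _) = fun n => c * \int[P]_w g1 (U n w)).
  by apply: cvgM => //; exact: cvg_cst.
by apply/funext => n; rewrite RintegralZl//; exact: trig_integrable.
Qed.

Lemma cvg_in_law_of_cos : cvg_in_law P U Q V.
Proof.
move=> g cg [M gM].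
have M0 : 0 <= M by exact: le_trans (normr_ge0 _) (gM 0).
have mg := continuous_row_measurable cg.
apply/cvgrPdist_le => e e0.
(* Replacing g by h costs at most e' (1 + 2 M d) = e / 5 under either law, and the convergence for h
   another e' <= e / 5. *)
pose e' : R := e / (5 * (1 + 2 * M * d%:R)).
have D0 : 0 < 1 + 2 * M * d%:R by rewrite ltr_pwDl// mulr_ge0// mulr_ge0.
have e'0 : 0 < e' by rewrite divr_gt0// mulr_gt0.
have [LU LU0 hU] := tU e'0; have [LV LV0 hV] := tV e'0.
pose L := Num.max LU LV.
have L0 : 0 < L by rewrite lt_max LU0.
have [h th gh] := trig_approx cg gM L0 e'0.
have approx dO' (O' : measurableType dO') (P' : probability O' R)
    (W : O' -> 'rV[R]_d) : measurable_fun setT W ->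
    (forall l, \int[P']_w tail L (W w 0 l) <= e') ->
    `|\int[P']_w g (W w) - \int[P']_w h (W w)| <= e' * (1 + 2 * M * d%:R).
  move=> mW tW.
  have it l : P'.-integrable setT (EFin \o (fun w => tail L (W w 0 l))).
    exact: (integrable_tail P' (fun=> mW) 0).
  have [iS SE] := Rintegral_sum (index_enum 'I_d) it.
  have iS' := integrable_mulr (2 * M) iS.
  apply: (@le_trans _ _ (\int[P']_w (e' + 2 * M * \sum_(l < d) tail L (W w 0 l)))).
    apply: Rintegral_dist_le => //.
    - apply: (@bounded_integrable _ _ _ P' _ M) => //.
      exact: (measurableT_comp mg mW).
    - exact: trig_integrable.
    - by apply: integrable_addr iS'; exact: integrable_cst.
  rewrite RintegralD//; last exact: integrable_cst.
  rewrite Rintegral_prob_cst RintegralZl// mulrDr mulr1 lerD2l mulrCA ler_wpM2l//.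
    by rewrite mulr_ge0.
  rewrite SE.
  apply: (@le_trans _ _ (\sum_(l < d) e')); first exact: ler_sum.
  by rewrite sumr_const card_ord mulr_natr.
have aV : `|\int[Q]_w g (V w) - \int[Q]_w h (V w)| <= e' * (1 + 2 * M * d%:R).
  apply: approx => //; have : LV <= L by rewrite le_max lexx orbT.
  by move=> /hV[N _ /(_ N (leqnn N))].
have /cvgrPdist_le/(_ e' e'0) hc := trig_poly_cvg th.
have {}hU := hU L (ltac:(by rewrite le_max lexx)).
near=> n.
have aU : `|\int[P]_w g (U n w) - \int[P]_w h (U n w)| <= e' * (1 + 2 * M * d%:R).
  by apply: approx => //; near: n.
have cn : `|\int[Q]_w h (V w) - \int[P]_w h (U n w)| <= e' by near: n.
rewrite distrC in aU.
rewrite (le_trans (ler_distD (\int[Q]_w h (V w)) _ _))//.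
have := ler_distD (\int[P]_w h (U n w)) (\int[Q]_w h (V w)) (\int[P]_w g (U n w)).
have ee : e' * (1 + 2 * M * d%:R) = e / 5.
  by rewrite /e'; field; rewrite gt_eqF.
have ee' : e' <= e / 5.
  rewrite -ee ler_peMr ?(ltW e'0)// lerDl.
  by apply: mulr_ge0 => //; exact: mulr_ge0.
rewrite ee in aV aU; lra.
Unshelve. all: by end_near. Qed.

End criterion.
End convergence_criterion.

(** * Gaussian vectors and covariances *)

Section law.
Context dO (O : measurableType dO) (R : realType) (P : probability O R).

Lemma law_transfer dS (S : measurableType dS) (nu : {measure set S -> \bar R})
    (W : O -> S) (f : S -> R) :
  measurable_fun setT W ->
  (forall B, measurable B -> P (W @^-1` B) = nu B) ->
  measurable_fun setT f -> nu.-integrable setT (EFin \o f) ->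
  P.-integrable setT (EFin \o (f \o W)) /\ \int[P]_w f (W w) = \int[nu]_x f x.
Proof.
move=> mW Wnu mf fi.
pose W' : {mfun O >-> S} := mfun_Sub (mem_set mW).
have mf' : measurable_fun setT (EFin \o f) by exact/measurable_EFinP.
have nuE B : measurable B -> B `<=` setT -> nu B = distribution P W' B.
  by move=> mB _; exact/esym/Wnu.
have i : P.-integrable setT (EFin \o (f \o W)).
  apply/integrableP; split; first exact/measurable_EFinP/measurableT_comp.
  have /integrableP[_] := fi.
  rewrite (eq_measure_integral (distribution P W'))//.
  by rewrite ge0_integral_distribution//; exact: measurableT_comp.
split => //; congr fine.
rewrite (eq_measure_integral (distribution P W'))//.
by rewrite (integral_distribution (X := W')).
Qed.

Lemma normal_law_moments (W : O -> R) (m s : R) : measurable_fun setT W ->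
  (forall B, measurable B -> P (W @^-1` B) = normal_law m s B) ->
  [/\ P.-integrable setT (EFin \o (fun w => W w ^+ 2)),
      \int[P]_w W w = m, \int[P]_w (W w - m) ^+ 2 = s ^+ 2 &
      forall b, \int[P]_w cos (W w - m + b) = expR (- (s ^+ 2 / 2)) * cos b].
Proof.
move=> mW Wl.
have mm : measurable_fun setT (fun x : R => x - m) by exact: measurable_funB.
have m2 : measurable_fun setT (fun x : R => (x - m) ^+ 2) by exact: measurable_funX.
have mc b : measurable_fun setT (fun x : R => cos (x - m + b)).
  apply: measurableT_comp; last exact: measurable_funD.
  by apply: continuous_measurable_fun; exact: continuous_cos.
have [i1 [e1 [i2 [e2 ec]]]] :
  P.-integrable setT (EFin \o (fun w => W w - m)) /\
  \int[P]_w (W w - m) = 0 /\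
  P.-integrable setT (EFin \o (fun w => (W w - m) ^+ 2)) /\
  \int[P]_w (W w - m) ^+ 2 = s ^+ 2 /\
  forall b, \int[P]_w cos (W w - m + b) = expR (- (s ^+ 2 / 2)) * cos b.
  (* For s = 0 the law is a Dirac mass and every integral is an evaluation at m; Stein's identity
     handles s != 0. *)
  have [s0|s0] := eqVneq s 0.
    have WE B : measurable B -> P (W @^-1` B) = @dirac _ R m R B.
      by move=> mB; rewrite Wl// /normal_law s0 eqxx.
    have int f : measurable_fun setT f ->
        P.-integrable setT (EFin \o (f \o W)) /\ \int[P]_w f (W w) = f m.
      move=> mf.
      have fi : (@dirac _ R m R).-integrable setT (EFin \o f).
        apply/integrableP; split; first exact/measurable_EFinP.
        rewrite integral_dirac//; last by apply: measurableT_comp => //; exact/measurable_EFinP.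
        by rewrite diracT mul1e ltry.
      have [? ->] := law_transfer mW WE mf fi; split => //.
      rewrite /Rintegral integral_dirac//; last exact/measurable_EFinP.
      by rewrite diracT mul1e.
    have [? e1] := int _ mm; have [? e2] := int _ m2.
    split => //; split; first by rewrite e1 subrr.
    split => //; split; first by rewrite e2 subrr s0.
    by move=> b; have [_ ->] := int _ (mc b);
      rewrite subrr add0r s0 expr0n/= mul0r oppr0 expR0 mul1r.
  have WE B : measurable B -> P (W @^-1` B) = normal_prob m s B.
    by move=> mB; rewrite Wl// /normal_law (negbTE s0).
  have [j1 f1] := normal_prob_centered m s0.
  have [j2 f2] := normal_prob_variance m s0.
  pose lt := @law_transfer _ (measurableTypeR R) (normal_prob m s) W.
  have [? e1] := lt _ mW WE mm j1.
  have [? e2] := lt _ mW WE m2 j2.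
  split => //; split; first by rewrite e1.
  split => //; split; first by rewrite e2.
  move=> b; rewrite -(normal_prob_cos m b s0).
  apply: (lt _ mW WE (mc b) _).2.
  by apply: (@bounded_integrable _ _ _ (normal_prob m s) _ 1) => [|x];
    [exact: mc|exact: cos_max].
have iW : P.-integrable setT (EFin \o W).
  have := integrable_addr i1 (integrable_cst P m); apply: eq_integrable => // w _ /=.
  by rewrite subrK.
split => //.
  have := integrable_subr (integrable_addr i2 (integrable_mulr (2 * m) iW))
    (integrable_cst P (m ^+ 2)).
  by apply: eq_integrable => // w _ /=; congr EFin; ring.
move: e1; rewrite RintegralB//; last exact: integrable_cst.
by rewrite Rintegral_prob_cst => /eqP; rewrite subr_eq0 => /eqP.
Qed.

End law.

Section square_integrable.
Context dO (O : measurableType dO) (R : realType) (P : probability O R).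

Lemma sqr_integrable_mul (f g : O -> R) :
  measurable_fun setT f -> measurable_fun setT g ->
  P.-integrable setT (EFin \o (fun w => f w ^+ 2)) ->
  P.-integrable setT (EFin \o (fun w => g w ^+ 2)) ->
  P.-integrable setT (EFin \o (fun w => f w * g w)).
Proof.
move=> mf mg f2 g2.
apply: (integrable_dominated (g := fun w => f w ^+ 2 + g w ^+ 2)).
- exact: measurable_funM.
- move=> w; rewrite ler_norml.
  have := sqr_ge0 (f w + g w); have := sqr_ge0 (f w - g w).
  by have := sqr_ge0 (f w); have := sqr_ge0 (g w); nra.
- exact: integrable_addr.
Qed.

Lemma sqr_integrable_center (f : O -> R) (c : R) : measurable_fun setT f ->
  P.-integrable setT (EFin \o (fun w => f w ^+ 2)) ->
  P.-integrable setT (EFin \o (fun w => (f w - c) ^+ 2)).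
Proof.
move=> mf f2; have f1 := sqr_integrable_integrable mf f2.
have := integrable_addr (integrable_subr f2 (integrable_mulr (2 * c) f1))
    (integrable_cst P (c ^+ 2)).
by apply: eq_integrable => // w _ /=; congr EFin; ring.
Qed.

Lemma Rintegral_variance (f : O -> R) : measurable_fun setT f ->
  P.-integrable setT (EFin \o (fun w => f w ^+ 2)) ->
  \int[P]_w (f w - \int[P]_v f v) ^+ 2 =
  \int[P]_w f w ^+ 2 - (\int[P]_w f w) ^+ 2.
Proof.
move=> mf f2; have f1 := sqr_integrable_integrable mf f2.
set c := \int[P]_v f v.
transitivity (\int[P]_w (f w ^+ 2 - 2 * c * f w + c ^+ 2)).
  by apply: eq_Rintegral => w _; ring.
rewrite RintegralD//; last 2 first.
- by apply: integrable_subr => //; exact: integrable_mulr.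
- exact: integrable_cst.
rewrite RintegralB//; last exact: integrable_mulr.
by rewrite RintegralZl// -/c Rintegral_prob_cst; ring.
Qed.

Context (d : nat) (W : O -> 'rV[R]_d).
Hypothesis mW : measurable_fun setT W.
Hypothesis W2 : forall l, P.-integrable setT (EFin \o (fun w => W w 0 l ^+ 2)).

Let mWl l : measurable_fun setT (fun w => W w 0 l).
Proof. exact: (measurableT_comp (measurable_row_coord l) mW). Qed.

Let Wl l : P.-integrable setT (EFin \o (fun w => W w 0 l)).
Proof. exact: sqr_integrable_integrable. Qed.

Lemma measurable_row_dot (a : 'I_d -> R) :
  measurable_fun setT (fun w => row_dot a (W w)).
Proof.
apply: (measurableT_comp (f := row_dot a)) => //.
by apply: continuous_row_measurable; exact: continuous_row_dot.
Qed.

Lemma Rintegral_row_dot (a : 'I_d -> R) :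
  \int[P]_w row_dot a (W w) = \sum_(l < d) a l * \int[P]_w W w 0 l.
Proof.
have [_ ->] := Rintegral_sum (index_enum 'I_d)
  (fun l => integrable_mulr (a l) (Wl l)).
by apply: eq_bigr => l _; rewrite RintegralZl.
Qed.

(** The centre c is left free: c = 0 gives integrability of the square, and c equal to the mean
    gives the covariance matrix. *)
Let prodE (a : 'I_d -> R) (c : 'I_d -> R) w :
  (row_dot a (W w) - \sum_(l < d) a l * c l) ^+ 2 =
  \sum_(j < d) \sum_(l < d) a j * a l * ((W w 0 j - c j) * (W w 0 l - c l)).
Proof.
rewrite /row_dot -sumrB expr2 mulr_suml; apply: eq_bigr => j _.
by rewrite mulr_sumr; apply: eq_bigr => l _; ring.
Qed.

Let iprod (a : 'I_d -> R) (c : 'I_d -> R) j l :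
  P.-integrable setT (EFin \o
    (fun w => a j * a l * ((W w 0 j - c j) * (W w 0 l - c l)))).
Proof.
apply: integrable_mulr; apply: sqr_integrable_mul.
- exact: measurable_funB.
- exact: measurable_funB.
- exact: sqr_integrable_center.
- exact: sqr_integrable_center.
Qed.

Lemma row_dot_sqr_integrable (a : 'I_d -> R) :
  P.-integrable setT (EFin \o (fun w => row_dot a (W w) ^+ 2)).
Proof.
have [+ _] := Rintegral_sum (index_enum 'I_d) (fun j =>
  (Rintegral_sum (index_enum 'I_d) (fun l => iprod a (fun=> 0) j l)).1).
apply: eq_integrable => // w _ /=; rewrite -prodE big1 ?subr0// => l _.
by rewrite mulr0.
Qed.

Lemma Rintegral_row_dot_variance (a : 'I_d -> R) :
  \int[P]_w (row_dot a (W w) - \int[P]_v row_dot a (W v)) ^+ 2 =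
  \sum_(j < d) \sum_(l < d) a j * a l * covariance_mx P W j l.
Proof.
rewrite Rintegral_row_dot.
pose c l := \int[P]_w W w 0 l.
transitivity (\int[P]_w
   \sum_(j < d) \sum_(l < d) a j * a l * ((W w 0 j - c j) * (W w 0 l - c l))).
  by apply: eq_Rintegral => w _; rewrite prodE.
have H j := Rintegral_sum (index_enum 'I_d) (fun l => iprod a c j l).
have [_ ->] := Rintegral_sum (index_enum 'I_d) (fun j => (H j).1).
apply: eq_bigr => j _; rewrite (H j).2; apply: eq_bigr => l _.
rewrite RintegralZl//; last first.
  have := iprod (fun=> 1) c j l; rewrite mulr1.
  by under eq_fun do rewrite mul1r.
by rewrite mxE unlock /= unlock.
Qed.

End square_integrable.

(** * Averages and ergodicity *)

Section average_uniform.
Context (R : realType) (K : index_kind) (m : nat).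
Local Notation T := (index_set R K m).
Local Notation lambda := (index_measure T).
Context dO (O : measurableType dO) (P : probability O R).
Variables (A : set T) (U : O -> T).
Hypotheses (mA : measurable A) (AU : uniform_on P A U).

Let mU : measurable_fun setT U. Proof. by have [] := AU. Qed.
Let U' : {mfun O >-> T} := mfun_Sub (mem_set mU).

Let c := fine (lambda A).

(** If c were 0, the quotient in [uniform_on] would be 0 by the convention for division by zero, and
    P would have total mass 0. As [fine] sends +oo to 0, positivity of c also shows that lambda A is
    finite. *)
Let c_gt0 : 0 < c.
Proof.
rewrite lt_neqAle fine_ge0// andbT eq_sym; apply/eqP => c0.
have [_ /(_ setT measurableT)] := AU.
rewrite preimage_setT setIT -/c c0 mul0r => P0.
have := @probability_setT _ _ _ P.
by rewrite [LHS]P0 => /eqP; rewrite eqe eq_sym oner_eq0.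
Qed.

Let lambdaA : lambda A = c%:E.
Proof.
have := c_gt0; have := measure_ge0 lambda A.
by rewrite /c; case: (lambda A) => //= _; rewrite ltxx.
Qed.

Let h t : R := c^-1 * \1_A t.

Let h_ge0 t : 0 <= h t.
Proof. by rewrite mulr_ge0// invr_ge0 ltW. Qed.

Let mh : measurable_fun setT h.
Proof. by apply: measurable_funM => //; exact: measurable_indic. Qed.

Let lawE B : measurable B -> distribution P U' B = (\int[lambda]_(t in B) (h t)%:E)%E.
Proof.
move=> mB; transitivity (P (U @^-1` B)) => //.
have [_ ->//] := AU.
under eq_integral do rewrite /h EFinM.
rewrite ge0_integralZl//; last 2 first.
- by apply/measurable_EFinP/measurable_funTS; exact: measurable_indic.
- by rewrite lee_fin invr_ge0 ltW.
rewrite integral_indic// -[X in (_ * X)%E]fineK; last first.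
  rewrite ge0_fin_numE//; apply: (@le_lt_trans _ _ (lambda A)).
    by apply: le_measure; rewrite ?inE//; exact: measurableI.
  by rewrite lambdaA ltry.
by rewrite -EFinM mulrC.
Qed.

Let ge0_integral_uniform (f : T -> \bar R) :
  measurable_fun setT f -> (forall t, 0 <= f t)%E ->
  (\int[P]_w f (U w) = c^-1%:E * \int[lambda]_(t in A) f t)%E.
Proof.
move=> mf f0.
rewrite -[LHS](ge0_integral_distribution U')//.
rewrite (ge0_integral_density mh h_ge0 lawE)//.
rewrite [X in (_ * X)%E]integral_mkcond -ge0_integralZl//; last 3 first.
- by apply/(measurable_restrictT f) => //; exact: measurable_funTS.
- by move=> x _; rewrite patchE; case: ifP.
- by rewrite lee_fin invr_ge0 ltW.
apply: eq_integral => t _; rewrite /h patchE indicE; case: ifP => _.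
  by rewrite mulr1 muleC.
by rewrite mulr0 !mule0.
Qed.

(** Positive and negative parts are compared separately, so f may fail to be integrable: if one part
    has infinite integral, both sides take the default value 0 of [fine]. *)
Lemma average_uniform (f : T -> R) : measurable_fun setT f ->
  average A f = \int[P]_w f (U w).
Proof.
move=> mf; rewrite /average -/c /Rintegral.
have mf' : measurable_fun setT (EFin \o f) by exact/measurable_EFinP.
rewrite integralE [in RHS]integralE.
have -> : (\int[P]_x ((fun w => (f (U w))%:E)^\+ x) =
    c^-1%:E * \int[lambda]_(t in A) ((EFin \o f)^\+ t))%E.
  rewrite -ge0_integral_uniform//; last exact: measurable_funepos.
  by apply: eq_integral => w _; rewrite !funeposE.
have -> : (\int[P]_x ((fun w => (f (U w))%:E)^\- x) =
    c^-1%:E * \int[lambda]_(t in A) ((EFin \o f)^\- t))%E.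
  rewrite -ge0_integral_uniform//; last exact: measurable_funeneg.
  by apply: eq_integral => w _; rewrite !funenegE.
have : (0 <= \int[lambda]_(t in A) ((EFin \o f)^\+ t))%E by exact: integral_ge0.
have : (0 <= \int[lambda]_(t in A) ((EFin \o f)^\- t))%E by exact: integral_ge0.
have cV : (0 < c^-1%:E)%E by rewrite lte_fin invr_gt0.
move: (\int[_]_(_ in _) _)%E (\int[_]_(_ in _) _)%E => [b||] [a||] //= _ _.
- by rewrite mulrBr.
- by rewrite gt0_muley//= mulr0.
- by rewrite gt0_muley//= mulr0.
- by rewrite gt0_muley//= mulr0.
Qed.

End average_uniform.

(** * Scalar functions of an ergodic field *)

Section scalar_field.
Context (R : realType) (K : index_kind) (m d : nat).
Local Notation T := (index_set R K m).
Local Notation lambda := (index_measure T).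
Context dO (O : measurableType dO) (P : probability O R).
Variables (X : T -> O -> 'rV[R]_d) (phi : 'rV[R]_d -> R).
Hypotheses (X_field : random_field X) (X_hom : homogeneous P X).
Hypothesis X_erg : ergodic P X.
Hypothesis mphi : measurable_fun setT phi.

Let Y t w : R := phi (X t w).

Lemma random_field_comp : random_field Y.
Proof.
have [mX jX] := X_field; split => [t|/jX j].
  exact: (measurableT_comp mphi (mX t)).
exact: (measurableT_comp mphi j).
Qed.

Lemma homogeneous_comp : homogeneous P Y.
Proof.
move=> n t h B mB.
pose F (x : n.-tuple 'rV[R]_d) : n.-tuple R := [tuple phi (tnth x i) | i < n].
have mF : measurable_fun setT F.
  apply/measurable_fun_tnthP => i.
  rewrite (_ : _ \o _ = phi \o (fun x : n.-tuple 'rV[R]_d => tnth x i)).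
    by apply: measurableT_comp => //; exact: measurable_tnth.
  by apply/funext => x; rewrite /= tnth_mktuple.
have mFB : measurable (F @^-1` B).
  by rewrite -[X in measurable X]setTI; exact: mF.
have FE (s : 'I_n -> T) : [set w | B [tuple Y (s i) w | i < n]] =
    [set w | (F @^-1` B) [tuple X (s i) w | i < n]].
  apply/seteqP; split => w /=; suff -> : F [tuple X (s i) w | i < n] =
      [tuple Y (s i) w | i < n] by [].
    by apply: eq_from_tnth => i; rewrite !tnth_mktuple.
  by apply: eq_from_tnth => i; rewrite !tnth_mktuple.
by rewrite (FE (fun i => index_add (t i) h)) (FE t); exact: X_hom.
Qed.

Lemma product_sigma_algebra_comp A : @product_sigma_algebra R K m _ R A ->
  @product_sigma_algebra R K m _ 'rV[R]_d
    [set x | A (fun t => phi (x t))].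
Proof.
pose F (x : T -> 'rV[R]_d) : T -> R := fun t => phi (x t).
pose G := image_set_system setT F (@product_sigma_algebra R K m _ 'rV[R]_d).
suff : @product_sigma_algebra R K m _ R `<=` G.
  by move=> /[apply]; rewrite /G /image_set_system/= setTI.
apply: smallest_sub.
  by apply: sigma_algebra_image; exact: smallest_sigma_algebra.
move=> _ [t [B [mB ->]]]; rewrite /G /image_set_system/= setTI.
apply: sub_sigma_algebra; exists t, (phi @^-1` B); split => //.
by rewrite -[X in measurable X]setTI; exact: mphi.
Qed.

Lemma measurable_product_event A : @product_sigma_algebra R K m _ 'rV[R]_d A ->
  measurable [set w | A (fun t => X t w)].
Proof.
pose F (w : O) : T -> 'rV[R]_d := fun t => X t w.
pose G := image_set_system setT F (@measurable _ O).
suff : @product_sigma_algebra R K m _ 'rV[R]_d `<=` G.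
  by move=> /[apply]; rewrite /G /image_set_system/= setTI.
apply: smallest_sub.
  by apply: sigma_algebra_image; exact: sigma_algebra_measurable.
move=> _ [t [B [mB ->]]]; rewrite /G /image_set_system/= setTI.
have [mX _] := X_field.
by rewrite -[X in measurable X]setTI; exact: mX.
Qed.

(** Pulling the set of paths back along phi makes an invariant event of phi(X) one of X, so
    ergodicity is inherited. *)
Lemma invariant_events_comp E : invariant_events P Y E ->
  measurable E /\ (P E = 0%E \/ P E = 1%E).
Proof.
move=> [A /product_sigma_algebra_comp pA [-> inv]]; split.
  exact: measurable_product_event pA.
by apply: X_erg; exists [set x | A (fun t => phi (x t))].
Qed.

(** The constant mean is a version of the conditional expectation: over an event of probability 0
    both integrals vanish, over one of probability 1 both equal c, and preimages under a constant
    are empty or full, hence invariant. *)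
Lemma ergodic_averages (Tn : nat -> set T) (f : R -> R) :
  pointwise_averaging Tn -> measurable_fun setT f ->
  P.-integrable setT (EFin \o (fun w => f (Y (index_origin T) w))) ->
  {ae P, forall w, average (Tn n) (fun t => f (Y t w)) @[n --> \oo] -->
    \int[P]_w f (Y (index_origin T) w)}.
Proof.
move=> [_ _ avg] mf fY.
set c := \int[P]_w f (Y (index_origin T) w).
apply: (avg _ O P Y f random_field_comp homogeneous_comp mf fY (cst c)).
split; last 2 first.
- exact: integrable_cst.
- move=> E /invariant_events_comp[mE [PE|PE]].
    have z g : measurable_fun setT (EFin \o g) -> \int[P]_(w in E) g w = 0.
      by move=> mg; rewrite /Rintegral null_set_integral//; exact: measurable_funTS.
    rewrite (z (cst c)); last exact/measurable_EFinP/measurable_cst.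
    by rewrite z//; case/integrableP: fY.
  have PE' : P (~` E) = 0%E by rewrite probability_setC// PE subee.
  rewrite Rintegral_cst// /= [X in fine X](_ : _ = 1%E)// mulr1 /c.
  congr fine; rewrite (negligible_integral (measurableC mE))// setDE setCK setTI.
  by [].
have sG : sigma_algebra setT (@product_sigma_algebra R K m _ R).
  exact: smallest_sigma_algebra.
have G0 : @product_sigma_algebra R K m _ R set0 by case: sG.
have GT : @product_sigma_algebra R K m _ R setT.
  by case: sG => _ /(_ _ G0) + _; rewrite setD0.
have inv A : @product_sigma_algebra R K m _ R A ->
    A = setT \/ A = set0 -> invariant_events P Y [set w | A (Y ^~ w)].
  move=> GA A01; exists A => //; split => // t.
  rewrite (_ : _ `+` _ = set0) ?measure0//.
  by case: A01 => ->; apply/seteqP; split => w //= [[]|[]].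
move=> B mB; have [cB|cB] := pselect (B c).
  rewrite (_ : _ @^-1` _ = [set w | setT (Y ^~ w)]).
    by apply: inv => //; left.
  by apply/seteqP; split.
rewrite (_ : _ @^-1` _ = [set w | set0 (Y ^~ w)]).
  by apply: inv => //; right.
by apply/seteqP; split.
Qed.

End scalar_field.

(** * The conditional central limit theorem *)

Section dominated.
Context dO (O : measurableType dO) (R : realType) (P : probability O R).

Lemma dominated_Rintegral_cvg (F : nat -> O -> R) (f g : O -> R) :
  (forall n, measurable_fun setT (F n)) -> measurable_fun setT f ->
  P.-integrable setT (EFin \o g) -> (forall n w, `|F n w| <= g w) ->
  {ae P, forall w, F n w @[n --> \oo] --> f w} ->
  \int[P]_w F n w @[n --> \oo] --> \int[P]_w f w.
Proof.
move=> mF mf ig Fg Ff.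
have [] := @dominated_convergence _ _ _ P setT measurableT
  (fun n => EFin \o F n) (EFin \o f) (EFin \o g).
- by move=> n; exact/measurable_EFinP.
- exact/measurable_EFinP.
- apply: filterS Ff => w h _; apply/fine_cvgP; split; last exact: h.
  exact: nearW.
- exact: ig.
- by apply: aeW => w n _; rewrite /= lee_fin.
move=> fi _ c; apply: fine_cvg; rewrite fineK//.
exact: integrable_fin_num.
Qed.

End dominated.

Section truncated_sqr_limit.
Context dO (O : measurableType dO) (R : realType) (P : probability O R).

Lemma truncated_sqr_cvg0 (f : O -> R) : measurable_fun setT f ->
  P.-integrable setT (EFin \o (fun w => f w ^+ 2)) ->
  \int[P]_w truncated_sqr N.+1%:R (f w) @[N --> \oo] --> 0.
Proof.
move=> mf f2; rewrite -(Rintegral_prob_cst P 0).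
apply: (dominated_Rintegral_cvg (g := fun w => f w ^+ 2)) => //.
- by move=> N; exact: (measurableT_comp (measurable_truncated_sqr _) mf).
- by move=> N w; rewrite ger0_norm ?truncated_sqr_ge0// truncated_sqr_le.
apply: aeW => w.
have h : (fun N : nat => f w ^+ 2 * (`|f w| * N.+1%:R^-1)) @ \oo --> 0.
  rewrite -[X in _ --> X](mulr0 (f w ^+ 2)); apply: cvgMr.
  rewrite -[X in _ --> X](mulr0 `|f w|); apply: cvgMr.
  exact: cvg_harmonic.
apply: (@squeeze_cvgr _ _ _ _ (cst 0) _ _ _ _ _ h).
  near=> N; rewrite truncated_sqr_ge0//= ler_wpM2l ?sqr_ge0//.
  by rewrite ge_min lexx orbT.
exact: cvg_cst.
Unshelve. all: by end_near. Qed.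

End truncated_sqr_limit.

Section product_integral.
Context d1 (O1 : measurableType d1) d2 (O2 : measurableType d2) (R : realType).
Variables (P1 : probability O1 R) (P2 : probability O2 R).

(** The integral is [fine] of a difference of two nonnegative partial integrals, each measurable by
    Tonelli; sections need not be integrable. *)
Lemma measurable_Rintegral_section (f : O1 * O2 -> R) : measurable_fun setT f ->
  measurable_fun setT (fun x => \int[P2]_y f (x, y)).
Proof.
move=> mf; apply: measurableT_comp; first exact: fine_measurable.
have mf' : measurable_fun setT (EFin \o f) by exact/measurable_EFinP.
rewrite (_ : (fun x => _) = (fun x => (\int[P2]_y (EFin \o f)^\+ (x, y)) -
    (\int[P2]_y (EFin \o f)^\- (x, y)))%E).
  apply: emeasurable_funB.
    apply: (measurable_fun_fubini_tonelli_F (m2 := P2)) => //.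
    exact: measurable_funepos.
  apply: (measurable_fun_fubini_tonelli_F (m2 := P2)) => //.
  exact: measurable_funeneg.
apply/funext => x; rewrite integralE; congr (_ - _)%E; apply: eq_integral => y _.
  by rewrite !funeposE.
by rewrite !funenegE.
Qed.

Lemma bounded_Rintegral_prod (f : O1 * O2 -> R) (M : R) : measurable_fun setT f ->
  (forall p, `|f p| <= M) ->
  \int[(P1 \x P2)%E]_p f p = \int[P1]_x \int[P2]_y f (x, y).
Proof.
move=> mf fM.
have i : (P1 \x P2)%E.-integrable setT (EFin \o f).
  exact: (@bounded_integrable _ _ _ (P1 \x P2)%E _ M).
rewrite [LHS]/Rintegral -integral12_prod_meas1// /Rintegral; congr fine.
apply: eq_integral => x _; rewrite /fubini_F /= fineK//.
apply: integrable_fin_num => //.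
apply: (@bounded_integrable _ _ _ P2 (fun y => f (x, y)) M) => //.
exact: measurableT_comp.
Qed.

End product_integral.

(** * A central limit theorem for arrays with convergent row moments *)

Section conditional_clt.
Context dO (O : measurableType dO) (R : realType) (P : probability O R).
Variables (k : nat -> nat) (Z : forall n, 'I_(k n) -> O -> R).
Variables (mn qn : nat -> R) (pn : nat -> nat -> R) (p : nat -> R) (mu sigma2 b : R).
Hypothesis k_infty : k n @[n --> \oo] --> \oo.
Hypothesis mZ : forall n i, measurable_fun setT (@Z n i).
Hypothesis indZ : forall n, mutually_independent P (@Z n).
Hypothesis Z2 : forall n i, P.-integrable setT (EFin \o (fun w => @Z n i w ^+ 2)).
Hypothesis Zm : forall n i, \int[P]_w @Z n i w = mn n.
Hypothesis Zq : forall n i, \int[P]_w (@Z n i w) ^+ 2 = qn n.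
Hypothesis Zp : forall N n i,
  \int[P]_w truncated_sqr N.+1%:R (@Z n i w - mu) = pn N n.
Hypothesis mn_cvg : mn n @[n --> \oo] --> mu.
Hypothesis qn_cvg : qn n @[n --> \oo] --> sigma2 + mu ^+ 2.
Hypothesis pn_cvg : forall N, pn N n @[n --> \oo] --> p N.
Hypothesis p_cvg : p N @[N --> \oo] --> 0.

(** Changing the centre of the truncation from mn n to mu costs the factor 8 of [truncated_sqrD],
    hence 24 = 3 * 8; the shift itself contributes at most (mu - mn n)^2. *)
Let row_bound N n : (0 < k n)%N -> N.+1%:R <= Num.sqrt (k n)%:R :> R ->
  `|\int[P]_w cos ((Num.sqrt (k n)%:R)^-1 * (\sum_(i < k n) (@Z n i w - mn n)) + b)
    - expR (- ((qn n - mn n ^+ 2) / 2)) * cos b| <=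
  24 * (pn N n + (mu - mn n) ^+ 2) + (qn n - mn n ^+ 2) ^+ 2 / (4 * (k n)%:R).
Proof.
move=> k0 kN.
have mY i : measurable_fun setT (fun w => @Z n i w - mn n) by exact: measurable_funB.
have Y2 i : P.-integrable setT (EFin \o (fun w => (@Z n i w - mn n) ^+ 2)).
  exact: sqr_integrable_center.
have Z1 i := sqr_integrable_integrable (@mZ n i) (@Z2 n i).
have indY : mutually_independent P (fun i w => @Z n i w - mn n).
  have mB : measurable_fun setT (fun x : R => x - mn n) by exact: measurable_funB.
  exact: (mutually_independent_comp mB (@indZ n)).
have N0 : 0 < N.+1%:R :> R by rewrite ltr0n.
have it (c : R) i : P.-integrable setT
    (EFin \o (fun w => truncated_sqr N.+1%:R (@Z n i w - c))).
  apply: integrable_dominated (sqr_integrable_center c (@mZ n i) (@Z2 n i)).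
    apply: (measurableT_comp (measurable_truncated_sqr _)).
    exact: measurable_funB.
  by move=> w; rewrite ger0_norm ?truncated_sqr_ge0// truncated_sqr_le.
have := @row_cos_bound _ _ _ P (k n) (fun i w => @Z n i w - mn n)
  (qn n - mn n ^+ 2) (8 * (pn N n + (mu - mn n) ^+ 2)) N.+1%:R b k0 mY indY Y2.
rewrite mulrA -natrM; apply => //.
- move=> i; rewrite RintegralB//; last exact: integrable_cst.
  by rewrite Rintegral_prob_cst Zm subrr.
- move=> i; rewrite -(Zq i) -(Zm i) -Rintegral_variance//.
- move=> i; rewrite -(Zp N i).
  apply: (@le_trans _ _ (\int[P]_w (8 * (truncated_sqr N.+1%:R (@Z n i w - mu) +
      (mu - mn n) ^+ 2)))).
    apply: le_Rintegral => //.
    + apply: integrable_mulr; apply: integrable_addr; first exact: it.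
      exact: integrable_cst.
    + move=> w _; rewrite (_ : _ - mn n = (@Z n i w - mu) + (mu - mn n)); last by ring.
      apply: le_trans (truncated_sqrD _ _ N0) _.
      by rewrite ler_wpM2l// lerD2l truncated_sqr_le.
  rewrite RintegralZl//; last first.
    by apply: integrable_addr; [exact: it|exact: integrable_cst].
  rewrite RintegralD//; last exact: integrable_cst.
  by rewrite Rintegral_prob_cst.
Qed.

(** For fixed N the right side of [row_bound] tends to 24 p N as n grows, and p N is small for a
    suitable N. The field is remembered only through the limits of the row means, second moments and
    truncated moments. *)
Lemma conditional_clt :
  \int[P]_w cos ((Num.sqrt (k n)%:R)^-1 * (\sum_(i < k n) (@Z n i w - mn n)) + b)
    @[n --> \oo] --> expR (- (sigma2 / 2)) * cos b.
Proof.
have knear (A : nat) : \forall n \near \oo, (A <= k n)%N.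
  exact: (k_infty (nbhs_infty_ge A)).
have v_cvg : qn n - mn n ^+ 2 @[n --> \oo] --> sigma2.
  rewrite -[X in _ --> X](addrK (mu ^+ 2)); apply: cvgB => //.
  by rewrite expr2; apply: cvgM.
have kV_cvg : (4 * (k n)%:R)^-1 @[n --> \oo] --> (0 : R).
  apply/cvgr0Pnorm_le => e e0.
  near=> n.
  have kn : (Num.truncn (4 * e)^-1 < k n)%N by near: n; exact: knear.
  have k0 : 0 < (k n)%:R :> R by rewrite ltr0n (leq_trans _ kn).
  rewrite ger0_norm ?invr_ge0 ?mulr_ge0//.
  rewrite -[e]invrK lef_pV2 ?posrE ?invr_gt0 ?mulr_gt0//.
  have : (4 * e)^-1 <= (k n)%:R.
    by rewrite (le_trans (ltW (truncnS_gt _)))// ler_nat.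
  by rewrite invfM ler_pdivrMl.
have r_cvg N : 24 * (pn N n + (mu - mn n) ^+ 2) +
    (qn n - mn n ^+ 2) ^+ 2 / (4 * (k n)%:R) @[n --> \oo] --> 24 * p N.
  rewrite -[X in _ --> X]addr0 -(mulr0 (sigma2 ^+ 2)).
  apply: cvgD; last first.
    by apply: cvgM kV_cvg; rewrite expr2; apply: cvgM.
  apply: cvgM; first exact: cvg_cst.
  rewrite -[X in _ --> X]addr0; apply: cvgD => //.
  have h : mu - mn n @[n --> \oo] --> 0.
    by rewrite -(subrr mu); apply: cvgB => //; exact: cvg_cst.
  by rewrite -[X in _ --> X](mulr0 (0 : R)); exact: (cvgM h h).
have e_cvg : expR (- ((qn n - mn n ^+ 2) / 2)) * cos b @[n --> \oo] -->
    expR (- (sigma2 / 2)) * cos b.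
  apply: cvgM; last exact: cvg_cst.
  apply: (cvg_comp _ expR); last exact: continuous_expR.
  by apply: cvgN; apply: cvgM => //; exact: cvg_cst.
apply/cvgrPdist_le => e e0.
(* 72 = 24 * 3, so that 24 p N takes one third of e; the two limits in n take the other thirds. *)
have e4 : 0 < e / 72 by rewrite divr_gt0.
have e3 : 0 < e / 3 by rewrite divr_gt0.
have [N pN] : exists N, p N <= e / 72.
  have /cvgr0Pnorm_le/(_ _ e4)[N _ /(_ N (leqnn N))/= h] := p_cvg.
  by exists N; exact: le_trans (ler_norm _) h.
have /cvgrPdist_le/(_ _ e3) hr := r_cvg N.
have /cvgrPdist_le/(_ _ e3) he := e_cvg.
near=> n.
(* This is N + 1 <= sqrt(k n), the condition for lowering the truncation level. *)
have kn : (N.+1 ^ 2 <= k n)%N by near: n; exact: knear.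
have k0 : (0 < k n)%N by rewrite (leq_trans _ kn)// expn_gt0.
have kN : N.+1%:R <= Num.sqrt (k n)%:R :> R.
  rewrite -[leLHS]ger0_norm// -sqrtr_sqr ler_wsqrtr// -natrX ler_nat.
  exact: kn.
have hb := row_bound k0 kN.
have h1 : `|24 * p N - (24 * (pn N n + (mu - mn n) ^+ 2) +
    (qn n - mn n ^+ 2) ^+ 2 / (4 * (k n)%:R))| <= e / 3 by near: n; exact: hr.
have h2 : `|expR (- (sigma2 / 2)) * cos b -
   expR (- ((qn n - mn n ^+ 2) / 2)) * cos b| <= e / 3 by near: n; exact: he.
rewrite (le_trans (ler_distD (expR (- ((qn n - mn n ^+ 2) / 2)) * cos b) _ _))//.
rewrite distrC in hb.
have h3 := ler_norm (- (24 * p N - (24 * (pn N n + (mu - mn n) ^+ 2) +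
    (qn n - mn n ^+ 2) ^+ 2 / (4 * (k n)%:R)))).
rewrite normrN in h3.
move: hb h1 h2 h3; set r := 24 * _ + _ => hb h1 h2 h3.
lra.
Unshelve. all: by end_near. Qed.

End conditional_clt.

(** * Sampling a field at random points *)

Lemma add_index_origin (R : realType) (K : index_kind) (m : nat)
    (t : index_set R K m) : index_add (index_origin (index_set R K m)) t = t.
Proof. by case: K t => t /=; rewrite add0r. Qed.

Section field_measurability.
Context (R : realType) (K : index_kind) (m : nat).
Local Notation T := (index_set R K m).
Context dS (S : measurableType dS) dO (O : measurableType dO) (P : probability O R).
Variable X : T -> O -> S.

(** On the lattice the preimage of B is a countable union of slices. *)
Lemma random_field_measurable : random_field X ->
  measurable_fun [set: T * O] (fun p => X p.1 p.2).
Proof.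
case: K X => Y [mY jY]; first exact: jY.
move=> _ B mB; rewrite setTI.
rewrite (_ : _ @^-1` B =
    \bigcup_(t in [set: int_row m]) ([set t] `*` (Y t @^-1` B))).
  apply: countable_bigcupT_measurable; first exact: (@countableP 'rV[int]_m).
  move=> t; apply: measurableX => //.
  by rewrite -[X in measurable X]setTI; exact: mY.
apply/seteqP; split => [[t w] /= YB|[t w] [t' _ [/= -> ]]//].
by exists t.
Qed.

Lemma homogeneous_law (t : T) B : homogeneous P X -> measurable B ->
  P (X t @^-1` B) = P (X (index_origin T) @^-1` B).
Proof.
move=> hX mB.
pose B' := [set x : 1.-tuple S | B (tnth x ord0)].
have mB' : measurable B'.
  have := @measurable_tnth _ S 1 ord0 measurableT B mB; rewrite setTI; exact.
have := hX 1 (fun=> index_origin T) t B' mB'.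
rewrite add_index_origin => h.
rewrite (_ : X t @^-1` B = [set w | B' [tuple X t w | i < 1]]); last first.
  by apply/seteqP; split => w; rewrite /B' /= tnth_mktuple.
by rewrite h; congr (P _); apply/seteqP; split => w; rewrite /B' /= tnth_mktuple.
Qed.

End field_measurability.

Lemma ge0_integral_eq_law dO (O : measurableType dO) (R : realType)
    (P : probability O R) dS (S : measurableType dS) (W W' : O -> S)
    (f : S -> \bar R) :
  measurable_fun setT W -> measurable_fun setT W' ->
  (forall B, measurable B -> P (W @^-1` B) = P (W' @^-1` B)) ->
  measurable_fun setT f -> (forall x, 0 <= f x)%E ->
  (\int[P]_w f (W w) = \int[P]_w f (W' w))%E.
Proof.
move=> mW mW' WW' mf f0.
pose V : {mfun O >-> S} := mfun_Sub (mem_set mW).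
pose V' : {mfun O >-> S} := mfun_Sub (mem_set mW').
rewrite -[LHS](ge0_integral_distribution V)// -[RHS](ge0_integral_distribution V')//.
by apply: eq_measure_integral => B mB _; exact: WW'.
Qed.

(** * Normalized sums over random points *)

Section sampling.
Context (R : realType) (K : index_kind) (m d : nat).
Local Notation T := (index_set R K m).
Local Notation o := (index_origin T).
Context dX (OX : measurableType dX) (PX : probability OX R).
Variable X : T -> OX -> 'rV[R]_d.
Hypotheses (X_field : random_field X) (X_homogeneous : homogeneous PX X).
Hypothesis X_ergodic : ergodic PX X.
Hypothesis X2 : forall l, PX.-integrable setT (EFin \o (fun w => X o w 0 l ^+ 2)).
Variable Tn : nat -> set T.
Hypothesis Tn_averaging : pointwise_averaging Tn.
Variable k : nat -> nat.
Hypothesis k_infty : k n @[n --> \oo] --> \oo.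
Context dt (Ot : measurableType dt) (Pt : probability Ot R).
Variable tau : forall n, 'I_(k n) -> Ot -> T.
Hypothesis tau_uniform : forall n i, uniform_on Pt (Tn n) (@tau n i).
Hypothesis tau_independent : forall n, mutually_independent Pt (@tau n).

Let M n l w := average (Tn n) (fun t => X t w 0 l).

Let mTn n : measurable (Tn n).
Proof. by have [/(_ n)[]] := Tn_averaging. Qed.

Let mtau n i : measurable_fun setT (@tau n i).
Proof. by have [] := @tau_uniform n i. Qed.

Let mXt t : measurable_fun setT (X t). Proof. by have [] := X_field. Qed.

Let mXw w : measurable_fun setT (X ^~ w).
Proof.
rewrite (_ : X ^~ w = (fun p : T * OX => X p.1 p.2) \o (fun t => (t, w)))//.
apply: measurableT_comp; first exact: random_field_measurable.
by apply/measurable_fun_pairP; split; [exact: measurable_id|exact: measurable_cst].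
Qed.

Let mXwl w l : measurable_fun setT (fun t => X t w 0 l).
Proof. exact: (measurableT_comp (measurable_row_coord l) (mXw w)). Qed.

Let mXtau n i : measurable_fun [set: OX * Ot] (fun p => X (@tau n i p.2) p.1).
Proof.
apply: (@measurableT_comp _ _ _ _ _ _ (fun p : T * OX => X p.1 p.2) _
  (fun p : OX * Ot => (@tau n i p.2, p.1))).
  exact: random_field_measurable.
by apply/measurable_fun_pairP; split;
  [exact: (measurableT_comp (mtau i) measurable_snd)|exact: measurable_fst].
Qed.

Let mXtaul n i l : measurable_fun [set: OX * Ot] (fun p => X (@tau n i p.2) p.1 0 l).
Proof. exact: (measurableT_comp (measurable_row_coord l) (mXtau i)). Qed.

Let ME n i l w : M n l w = \int[Pt]_v X (@tau n i v) w 0 l.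
Proof. exact: (average_uniform (mTn n) (tau_uniform i) (mXwl w l)). Qed.

(** By [ME] this is a partial integral of a jointly measurable function. The index i stands for k n
    > 0 and supplies the uniform point. *)
Lemma measurable_sample_mean n (i : 'I_(k n)) l : measurable_fun setT (M n l).
Proof.
rewrite (_ : M n l = fun w => \int[Pt]_v X (@tau n i v) w 0 l).
  exact: (measurable_Rintegral_section Pt (mXtaul i l)).
by apply/funext => w; exact: ME.
Qed.

(** By Tonelli the order of integration can be exchanged; for fixed sampling outcome v the point is
    deterministic, and homogeneity gives the field there the law it has at the origin. *)
Let integral_sqr_tau n i l :
  (\int[PX]_w \int[Pt]_v ((X (@tau n i v) w 0 l) ^+ 2)%:E =
   \int[PX]_w ((X o w 0 l) ^+ 2)%:E)%E.
Proof.
have mf : measurable_fun [set: OX * Ot] (fun p => ((X (@tau n i p.2) p.1 0 l) ^+ 2)%:E).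
  by apply/measurable_EFinP; exact: measurable_funX.
have f0 p : (0 <= ((X (@tau n i p.2) p.1 0 l) ^+ 2)%:E)%E by rewrite lee_fin sqr_ge0.
rewrite (fubini_tonelli (m1 := PX) (m2 := Pt) _ mf f0)/=.
have mg : measurable_fun setT (fun x : 'rV[R]_d => ((x 0 l) ^+ 2)%:E).
  by apply/measurable_EFinP; apply: measurable_funX; exact: measurable_row_coord.
under eq_integral.
  move=> v _.
  rewrite (ge0_integral_eq_law (P := PX) (W := X (@tau n i v)) (W' := X o)
    (f := fun x : 'rV[R]_d => ((x 0 l) ^+ 2)%:E))//; last 2 first.
  - by move=> B mB; exact: homogeneous_law.
  - by move=> x; rewrite lee_fin sqr_ge0.
  over.
rewrite integral_cst// [X in (_ * X)%E](_ : _ = 1%E) ?mule1//.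
exact: probability_setT.
Qed.

(** The iterated integral is finite by [integral_sqr_tau], so the inner one is finite for almost all
    w; one exceptional set serves all n, i and l. *)
Let good_w : {ae PX, forall w, forall n (i : 'I_(k n)) l,
  Pt.-integrable setT (EFin \o (fun v => (X (@tau n i v) w 0 l) ^+ 2))}.
Proof.
have H n (i : 'I_(k n)) l : {ae PX, forall w,
    Pt.-integrable setT (EFin \o (fun v => (X (@tau n i v) w 0 l) ^+ 2))}.
  apply: (@ae_integrable1 _ _ _ _ _ PX Pt
    (fun p => ((X (@tau n i p.2) p.1 0 l) ^+ 2)%:E)).
  apply/integrable12ltyP.
    by apply/measurable_EFinP; exact: measurable_funX.
  under eq_integral.
    move=> w _.
    under eq_integral do rewrite gee0_abs ?lee_fin ?sqr_ge0//.
    over.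
  rewrite /= integral_sqr_tau.
  exact: (integrable_lty measurableT (X2 l)).
(* [ae_foralln] quantifies over naturals, so each ordinal is split into a number and a proof of its
   bound. *)
have H' : {ae PX, forall w, forall n j r (jk : (j < k n)%N) (rd : (r < d)%N),
    Pt.-integrable setT
      (EFin \o (fun v => (X (@tau n (Ordinal jk) v) w 0 (Ordinal rd)) ^+ 2))}.
  apply: ae_foralln => n; apply: ae_foralln => j; apply: ae_foralln => r.
  have [jk|jk] := pselect (j < k n)%N; last by apply: aeW => w jk'.
  have [rd|rd] := pselect (r < d)%N; last by apply: aeW => w jk' rd'.
  apply: filterS (H n (Ordinal jk) (Ordinal rd)) => w Hw jk' rd'.
  by rewrite (bool_irrelevance jk' jk) (bool_irrelevance rd' rd).
apply: filterS H' => w Hw n [j jk] [r rd]; exact: Hw.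
Qed.

Let U n (w : OX * Ot) : 'rV[R]_d := \row_(l < d) ((Num.sqrt (k n)%:R)^-1 *
  \sum_(i < k n) (X (@tau n i w.2) w.1 0 l - M n l w.1)).

Lemma measurable_sample_sum n : measurable_fun setT (U n).
Proof.
apply: measurable_row => l; apply: measurable_funM; first exact: measurable_cst.
apply: measurable_fun_bigsum => i; apply: measurable_funB; first exact: mXtaul.
exact: (measurableT_comp (measurable_sample_mean i l)).
Qed.

Let sampled_indep n w (phi : 'rV[R]_d -> R) : measurable_fun setT phi ->
  mutually_independent Pt (fun (i : 'I_(k n)) v => phi (X (tau i v) w)).
Proof.
move=> mphi.
have : measurable_fun setT (phi \o (X ^~ w)) by exact: measurableT_comp.
by move=> /(mutually_independent_comp (f := phi \o (X ^~ w))); apply.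
Qed.

Let sampled_same_law n (i i0 : 'I_(k n)) w l :
  (\int[Pt]_v ((X (tau i v) w 0 l) ^+ 2)%:E =
   \int[Pt]_v ((X (tau i0 v) w 0 l) ^+ 2)%:E)%E.
Proof.
apply: (ge0_integral_eq_law (W := tau i) (W' := tau i0)
  (f := fun t => ((X t w 0 l) ^+ 2)%:E)) => //.
- by move=> B mB; have [_ ->//] := tau_uniform i; have [_ ->] := tau_uniform i0.
- by apply/measurable_EFinP; exact: measurable_funX.
- by move=> t; rewrite lee_fin sqr_ge0.
Qed.

(** Given w the summands are independent and centred, so the second moment of the normalized sum is
    the variance of one sampled value, at most its second moment. Integrating over w gives the
    second moment at the origin. *)
Lemma sample_sum_second_moment n l : (0 < k n)%N ->
  (PX \x Pt)%E.-integrable setT (EFin \o (fun w => U n w 0 l ^+ 2)) /\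
  \int[(PX \x Pt)%E]_w (U n w 0 l) ^+ 2 <= \int[PX]_w (X o w 0 l) ^+ 2.
Proof.
move=> k0; pose i0 : 'I_(k n) := Ordinal k0.
have kR : 0 < (k n)%:R :> R by rewrite ltr0n.
have bound w : (\int[Pt]_v ((U n (w, v) 0 l) ^+ 2)%:E <=
    \int[Pt]_v ((X (tau i0 v) w 0 l) ^+ 2)%:E)%E.
  pose Z (i : 'I_(k n)) v := X (tau i v) w 0 l.
  have mZ i : measurable_fun setT (Z i).
    exact: (measurableT_comp (mXwl w l) (mtau i)).
  (* Where the conditional second moment is infinite the bound is trivial; thus it holds for every
     w. *)
  have [oo|] := eqVneq (\int[Pt]_v ((X (tau i0 v) w 0 l) ^+ 2)%:E)%E +oo%E.
    by rewrite oo leey.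
  rewrite -ltey => i0oo.
  have Z2 i : Pt.-integrable setT (EFin \o (fun v => Z i v ^+ 2)).
    apply/integrableP; split; first by apply/measurable_EFinP; exact: measurable_funX.
    under eq_integral do rewrite /= ger0_norm ?sqr_ge0//.
    by rewrite (sampled_same_law i i0).
  have Zq i : \int[Pt]_v (Z i v) ^+ 2 = \int[Pt]_v (Z i0 v) ^+ 2.
    by congr fine; exact: sampled_same_law.
  have ZM i : \int[Pt]_v Z i v = M n l w by rewrite (ME i).
  pose Y i v := Z i v - M n l w.
  have mY i : measurable_fun setT (Y i) by exact: measurable_funB.
  have Z1 i := sqr_integrable_integrable (mZ i) (Z2 i).
  have Y2 i : Pt.-integrable setT (EFin \o (fun v => Y i v ^+ 2)).
    exact: sqr_integrable_center.
  have Y0 i : \int[Pt]_v Y i v = 0.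
    rewrite RintegralB//; last exact: integrable_cst.
    by rewrite Rintegral_prob_cst ZM subrr.
  have Yv i : \int[Pt]_v (Y i v) ^+ 2 =
      \int[Pt]_v (Z i0 v) ^+ 2 - (M n l w) ^+ 2.
    rewrite -(Zq i) -(ZM i) -(Rintegral_variance (mZ i) (Z2 i)).
    by apply: eq_Rintegral => v _; rewrite /Y -(ZM i).
  have indY : mutually_independent Pt Y.
    apply: (@sampled_indep n w (fun x => x 0 l - M n l w)).
    by apply: measurable_funB => //; exact: measurable_row_coord.
  have [iS ES] := Rintegral_sqr_sum mY indY Y2 Y0 Yv.
  have UE v : (U n (w, v) 0 l) ^+ 2 = (k n)%:R^-1 * (\sum_(i < k n) Y i v) ^+ 2.
    by rewrite /U mxE exprMn exprVn sqr_sqrtr// ltW.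
  have -> : (\int[Pt]_v ((U n (w, v) 0 l) ^+ 2)%:E =
      (\int[Pt]_v (Z i0 v) ^+ 2 - (M n l w) ^+ 2)%:E)%E.
    under eq_integral do rewrite UE.
    have iU := integrable_mulr (k n)%:R^-1 iS.
    rewrite -[LHS](fineK (integrable_fin_num measurableT iU)); congr EFin.
    rewrite -[LHS]/(\int[Pt]_v ((k n)%:R^-1 * (\sum_(i < k n) Y i v) ^+ 2)).
    by rewrite RintegralZl// ES mulKf// gt_eqF.
  rewrite -[leRHS](fineK (integrable_fin_num measurableT (Z2 i0))) lee_fin.
  by rewrite lerBlDr lerDl sqr_ge0.
have mU2 : measurable_fun setT (fun w => ((U n w 0 l) ^+ 2)%:E).
  apply/measurable_EFinP; apply: measurable_funX.
  exact: (measurableT_comp (measurable_row_coord l) (measurable_sample_sum n)).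
have mX2 : measurable_fun [set: OX * Ot] (fun p => ((X (tau i0 p.2) p.1 0 l) ^+ 2)%:E).
  by apply/measurable_EFinP; exact: measurable_funX.
have U0 w : (0 <= ((U n w 0 l) ^+ 2)%:E)%E by rewrite lee_fin sqr_ge0.
have le : (\int[PX]_w \int[Pt]_v ((U n (w, v) 0 l) ^+ 2)%:E <=
    \int[PX]_w ((X o w 0 l) ^+ 2)%:E)%E.
  rewrite -(integral_sqr_tau i0); apply: ge0_le_integral => //.
  - by move=> w _; exact: integral_ge0.
  - exact: (measurable_fun_fubini_tonelli_F (m2 := Pt) _ mU2 U0).
  - apply: (measurable_fun_fubini_tonelli_F (m2 := Pt) _ mX2).
    by move=> w; rewrite lee_fin sqr_ge0.
have iU : (PX \x Pt)%E.-integrable setT (EFin \o (fun w => U n w 0 l ^+ 2)).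
  apply/integrable12ltyP => //.
  under eq_integral.
    move=> w _.
    under eq_integral do rewrite gee0_abs ?(U0 (_, _))//.
    over.
  by rewrite (le_lt_trans le)//; exact: (integrable_lty measurableT (X2 l)).
split => //; apply: fine_le.
- exact: (integrable_fin_num measurableT iU).
- exact: (integrable_fin_num measurableT (X2 l)).
- by rewrite (fubini_tonelli1 _ mU2 U0).
Qed.

Let mu a := \int[PX]_w row_dot a (X o w).
Let sigma2 a := \int[PX]_w (row_dot a (X o w) - mu a) ^+ 2.

Let mdot a : measurable_fun setT (@row_dot R d a).
Proof. by apply: continuous_row_measurable; exact: continuous_row_dot. Qed.

Let dot2 a : PX.-integrable setT (EFin \o (fun w => row_dot a (X o w) ^+ 2)).
Proof. exact: (row_dot_sqr_integrable (mXt o)). Qed.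

Let mdotX a : measurable_fun setT (fun w => row_dot a (X o w)).
Proof. exact: (measurableT_comp (mdot a) (mXt o)). Qed.

(** The average of a . X must be the combination of the averages M_n^l. Averages are additive only
    for integrable functions, hence the hypothesis on w. *)
Let sample_sum_row_dot a n w v :
  (forall (i : 'I_(k n)) l,
    Pt.-integrable setT (EFin \o (fun v => (X (tau i v) w 0 l) ^+ 2))) ->
  row_dot a (U n (w, v)) = (Num.sqrt (k n)%:R)^-1 *
    \sum_(i < k n) (row_dot a (X (tau i v) w) -
                    average (Tn n) (fun t => row_dot a (X t w))).
Proof.
move=> Hw; rewrite /row_dot.
transitivity (\sum_(l < d) \sum_(i < k n) (Num.sqrt (k n)%:R)^-1 *
    (a l * (X (tau i v) w 0 l - M n l w))).
  apply: eq_bigr => l _; rewrite mxE mulrCA !mulr_sumr.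
  by apply: eq_bigr.
rewrite exchange_big/= mulr_sumr; apply: eq_bigr => i _.
rewrite -mulr_sumr; congr (_ * _).
have mdw : measurable_fun setT (fun t => row_dot a (X t w)).
  exact: (measurableT_comp (mdot a) (mXw w)).
have mXi : measurable_fun setT (fun v => X (tau i v) w).
  exact: (measurableT_comp (mXw w) (mtau i)).
have := average_uniform (mTn n) (tau_uniform i) mdw.
rewrite (Rintegral_row_dot mXi (Hw i)) /row_dot => ->.
rewrite -sumrB; apply: eq_bigr => l _.
by rewrite (ME i) mulrBr.
Qed.

Lemma sample_sum_cos a b :
  \int[(PX \x Pt)%E]_w cos (row_dot a (U n w) + b) @[n --> \oo] -->
  expR (- (sigma2 a / 2)) * cos b.
Proof.
have mcosb : measurable_fun setT (fun x : R => cos (x + b)).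
  apply: measurableT_comp; last exact: measurable_funD.
  by apply: continuous_measurable_fun; exact: continuous_cos.
have mF n : measurable_fun setT (fun w => cos (row_dot a (U n w) + b)).
  apply: (measurableT_comp mcosb).
  exact: (measurableT_comp (mdot a) (measurable_sample_sum n)).
rewrite (_ : (fun n => _) =
    fun n => \int[PX]_w \int[Pt]_v cos (row_dot a (U n (w, v)) + b)); last first.
  apply/funext => n; rewrite (@bounded_Rintegral_prod _ _ _ _ _ PX Pt _ 1 (mF n))//.
  by move=> p; exact: cos_max.
rewrite -[expR _ * cos b](Rintegral_prob_cst PX).
apply: (dominated_Rintegral_cvg (g := cst 1)).
- by move=> n; exact: (measurable_Rintegral_section Pt (mF n)).
- exact: measurable_cst.
- exact: integrable_cst.
- move=> n w; rewrite -(Rintegral_prob_cst Pt 1).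
  have mG : measurable_fun setT (fun v => cos (row_dot a (U n (w, v)) + b)).
    exact: (measurableT_comp (mF n) (measurable_pair1 w)).
  have iG : Pt.-integrable setT (EFin \o (fun v => cos (row_dot a (U n (w, v)) + b))).
    by apply: (@bounded_integrable _ _ _ Pt _ 1) => // v; exact: cos_max.
  apply: le_trans (le_normr_Rintegral _ iG) _ => //.
  apply: le_Rintegral => //; [exact: integrable_norm|exact: integrable_cst|].
  by move=> v _; exact: cos_max.
have dot1 := sqr_integrable_integrable (mdotX a) (dot2 a).
have m_sqr : measurable_fun setT (fun x : R => x ^+ 2) by exact: measurable_funX.
have m_tr N : measurable_fun setT (fun x : R => truncated_sqr N.+1%:R (x - mu a)).
  apply: (measurableT_comp (measurable_truncated_sqr _)).
  exact: measurable_funB.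
have i_tr N : PX.-integrable setT (EFin \o (fun w =>
    truncated_sqr N.+1%:R (row_dot a (X o w) - mu a))).
  apply: integrable_dominated (sqr_integrable_center (mu a) (mdotX a) (dot2 a)).
    exact: (measurableT_comp (m_tr N) (mdotX a)).
  by move=> w; rewrite ger0_norm ?truncated_sqr_ge0// truncated_sqr_le.
have avg f := ergodic_averages X_field X_homogeneous X_ergodic (mdot a)
  (f := f) Tn_averaging.
have A1 := avg id (@measurable_id _ _ _) dot1.
have A2 := avg _ m_sqr (dot2 a).
have A3 : {ae PX, forall w, forall N,
    average (Tn n) (fun t => truncated_sqr N.+1%:R (row_dot a (X t w) - mu a))
      @[n --> \oo] -->
    \int[PX]_w truncated_sqr N.+1%:R (row_dot a (X o w) - mu a)}.
  by apply: ae_foralln => N; exact: (avg _ (m_tr N) (i_tr N)).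
(* From here on the field is fixed outside a null set and only the sampling is random. *)
apply: filterS2 (filterI A1 A2) (filterI A3 good_w) => w [{}A1 {}A2] [{}A3 Hw].
rewrite (_ : (fun n => _) = fun n => \int[Pt]_v cos ((Num.sqrt (k n)%:R)^-1 *
    (\sum_(i < k n) (row_dot a (X (tau i v) w) -
      average (Tn n) (fun t => row_dot a (X t w)))) + b)); last first.
  apply/funext => n; apply: eq_Rintegral => v _.
  by rewrite (sample_sum_row_dot _ _ (Hw n)).
have mdw : measurable_fun setT (fun t => row_dot a (X t w)).
  exact: (measurableT_comp (mdot a) (mXw w)).
have mXi n (i : 'I_(k n)) : measurable_fun setT (fun v => X (tau i v) w).
  exact: (measurableT_comp (mXw w) (mtau i)).
apply: (conditional_clt (P := Pt)
  (Z := fun n (i : 'I_(k n)) v => row_dot a (X (tau i v) w))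
  (qn := fun n => average (Tn n) (fun t => row_dot a (X t w) ^+ 2))
  (pn := fun N n => average (Tn n)
    (fun t => truncated_sqr N.+1%:R (row_dot a (X t w) - mu a)))
  (p := fun N => \int[PX]_w truncated_sqr N.+1%:R (row_dot a (X o w) - mu a))
  (mu := mu a)) => //.
- by move=> n i; exact: (measurableT_comp (mdot a) (mXi n i)).
- by move=> n; exact: (sampled_indep w (mdot a)).
- by move=> n i; exact: (row_dot_sqr_integrable (mXi n i) (Hw n i)).
- by move=> n i; rewrite -(average_uniform (mTn n) (tau_uniform i) mdw).
- move=> n i; rewrite -(average_uniform (mTn n) (tau_uniform i)
    (f := fun t => row_dot a (X t w) ^+ 2))//.
  exact: measurable_funX.
- move=> N n i; rewrite -(average_uniform (mTn n) (tau_uniform i)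
    (f := fun t => truncated_sqr N.+1%:R (row_dot a (X t w) - mu a)))//.
  exact: (measurableT_comp (m_tr N) mdw).
- by rewrite /sigma2 (Rintegral_variance (mdotX a) (dot2 a)) subrK.
- apply: truncated_sqr_cvg0; first exact: measurable_funB.
  exact: sqr_integrable_center.
Qed.

End sampling.

(** * Convergence in law *)

Section gaussian.
Context dV (OV : measurableType dV) (R : realType) (P : probability OV R) (d : nat).
Variable V : OV -> 'rV[R]_d.
Hypothesis V_gaussian : gaussian_vector P V.
Hypothesis V_mean : forall l : 'I_d, ('E_P[fun w => V w 0%R l] = 0)%E.

Let mV : measurable_fun setT V. Proof. by have [] := V_gaussian. Qed.

Lemma gaussian_sqr_integrable l : P.-integrable setT (EFin \o (fun w => V w 0 l ^+ 2)).
Proof.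
have [_ /(_ (fun i => (i == l)%:R))[m [s Vl]]] := V_gaussian.
have [i _ _ _] := normal_law_moments
  (measurable_row_dot mV (fun i : 'I_d => (i == l)%:R)) Vl.
apply: eq_integrable i => // w _ /=; rewrite /row_dot (bigD1 l)//= eqxx mul1r.
by rewrite big1 ?addr0// => i /negbTE ->; rewrite mul0r.
Qed.

(** The law of a . V is normal with unknown m and s: the zero mean forces m = 0, and s^2 is the
    variance of a . V, a quadratic form in the covariance matrix. *)
Lemma gaussian_cos a b : \int[P]_w cos (row_dot a (V w) + b) =
  expR (- ((\sum_(j < d) \sum_(l < d) a j * a l * covariance_mx P V j l) / 2)) * cos b.
Proof.
have V2 := gaussian_sqr_integrable.
have [_ /(_ a)[m [s Vl]]] := V_gaussian.
have [_ em es ec] := normal_law_moments (measurable_row_dot mV a) Vl.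
have m0 : m = 0.
  rewrite -em (Rintegral_row_dot mV V2) big1// => l _.
  have := V_mean l; rewrite unlock /Rintegral /= => ->.
  by rewrite mulr0.
rewrite -(Rintegral_row_dot_variance mV V2 a) em es -ec.
by apply: eq_Rintegral => w _; rewrite m0 subr0.
Qed.

End gaussian.

Section tail_properties.
Context {R : realType}.
Implicit Types (x y a L : R).

Lemma continuous_tail L : continuous (@tail R L).
Proof.
move=> x; apply: (@continuous_min _ _ (cst 1) (fun y : R => `|y| / L)).
  exact: cst_continuous.
apply: cvgM; last exact: cvg_cst.
exact: norm_continuous.
Qed.

Lemma tail_anti L L' y : 0 < L -> L <= L' -> tail L' y <= tail L y.
Proof.
move=> L0 LL'; rewrite le_min !ge_min lexx/=; apply/orP; right.
by rewrite ler_wpM2l// lef_pV2// posrE// (lt_le_trans L0).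
Qed.

Lemma tail_sum (I : Type) (r : seq I) (f : I -> R) L : 0 < L ->
  tail L (\sum_(i <- r) f i) <= \sum_(i <- r) tail L (f i).
Proof.
move=> L0; elim: r => [|i r ih].
  by rewrite !big_nil /tail normr0 mul0r ge_min lexx orbT.
by rewrite !big_cons (le_trans (tailD _ _ L0))// lerD2l.
Qed.

Lemma tail1M a x : tail 1 (a * x) <= (1 + `|a|) * tail 1 x.
Proof.
rewrite /tail !divr1 normrM.
have := normr_ge0 a; have := normr_ge0 x.
case: (lerP 1 `|x|) => x1 x0 a0.
  by rewrite ge_min mulr1 lerDl a0.
by rewrite ge_min; apply/orP; right; rewrite ler_wpM2r// lerDr.
Qed.

Lemma norm_cosB_tail x y : `|cos x - cos y| <= 2 * tail 1 (x - y).
Proof.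
rewrite /tail divr1; have := norm_cosB_le x y.
have := ler_normB (cos x) (cos y); have := cos_max x; have := cos_max y.
have := normr_ge0 (x - y).
case: (lerP 1 `|x - y|) => *; lra.
Qed.

End tail_properties.

(** * Perturbations that vanish in probability *)

Section perturbation.
Context dO (O : measurableType dO) (R : realType) (P : probability O R) (d : nat).
Variables U r : nat -> O -> 'rV[R]_d.
Hypotheses (mU : forall n, measurable_fun setT (U n))
  (mr : forall n, measurable_fun setT (r n)).
Hypothesis r0 : forall l, \int[P]_w tail 1 (r n w 0 l) @[n --> \oo] --> 0.

Lemma measurable_perturbation n : measurable_fun setT (fun w => U n w + r n w).
Proof.
rewrite (_ : (fun w => _) = fun w => \row_l (U n w 0 l + r n w 0 l)).
  apply: measurable_row => l; apply: measurable_funD.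
    exact: (measurableT_comp (measurable_row_coord l) (mU n)).
  exact: (measurableT_comp (measurable_row_coord l) (mr n)).
by apply/funext => w; apply/rowP => l; rewrite !mxE.
Qed.

(** Subadditivity of [tail] separates U from r. Taking L >= 1 bounds the part of r by its [tail 1],
    whose mean tends to 0. *)
Lemma tight_perturbation : tight P U -> tight P (fun n w => U n w + r n w).
Proof.
move=> tU e e0; have e2 : 0 < e / 2 by rewrite divr_gt0.
have [L0 L00 hU] := tU _ e2.
exists (Num.max 1 L0) => [|L]; first by rewrite lt_max ltr01.
rewrite ge_max => /andP[L1 LL0].
have Lp : 0 < L by exact: lt_le_trans L1.
have hr : \forall n \near \oo, forall l, `|\int[P]_w tail 1 (r n w 0 l)| <= e / 2.
  by apply: filter_forall => l; have /cvgr0Pnorm_le/(_ _ e2) := r0 l.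
near=> n.
have hUn : forall l, \int[P]_w tail L (U n w 0 l) <= e / 2 by near: n; exact: hU.
have hrn : forall l, `|\int[P]_w tail 1 (r n w 0 l)| <= e / 2 by near: n; exact: hr.
move=> l.
have iU := integrable_tail P mU n l Lp.
have ir := integrable_tail P mr n l (ltr01 : 0 < (1 : R)).
apply: (@le_trans _ _ (\int[P]_w (tail L (U n w 0 l) + tail 1 (r n w 0 l)))).
  apply: le_Rintegral => //.
  - exact: (integrable_tail P measurable_perturbation n l Lp).
  - exact: integrable_addr.
  - move=> w _; rewrite mxE (le_trans (tailD _ _ Lp))// lerD2l.
    exact: tail_anti.
rewrite RintegralD// [e]splitr lerD//.
exact: le_trans (ler_norm _) (hrn l).
Unshelve. all: by end_near. Qed.

(** The cosine is bounded and Lipschitz, so the change is at most 2 min(1, |a . r_n|), which splits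
    over the coordinates by subadditivity. *)
Lemma cos_perturbation a b (c : R) :
  \int[P]_w cos (row_dot a (U n w) + b) @[n --> \oo] --> c ->
  \int[P]_w cos (row_dot a (U n w + r n w) + b) @[n --> \oo] --> c.
Proof.
move=> Uc.
have icos (W : nat -> O -> 'rV[R]_d) n : (forall n, measurable_fun setT (W n)) ->
    P.-integrable setT (EFin \o (fun w => cos (row_dot a (W n w) + b))).
  move=> mW; apply: (@bounded_integrable _ _ _ P _ 1) => [|w]; last exact: cos_max.
  apply: measurableT_comp.
    by apply: continuous_measurable_fun; exact: continuous_cos.
  by apply: measurable_funD; [exact: measurable_row_dot|exact: measurable_cst].
have it n l := integrable_tail P mr n l (ltr01 : 0 < (1 : R)).
pose B n := \sum_(l < d) 2 * (1 + `|a l|) * \int[P]_w tail 1 (r n w 0 l).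
have B0 : B n @[n --> \oo] --> 0.
  rewrite [X in _ --> X](_ : 0 = \sum_(l < d) 2 * (1 + `|a l|) * 0); last first.
    by rewrite big1// => l _; rewrite mulr0.
  apply: cvg_big => [|l _]; first exact: add_continuous.
  by apply: cvgM; [exact: cvg_cst|exact: r0].
have UB n : `|\int[P]_w cos (row_dot a (U n w + r n w) + b) -
    \int[P]_w cos (row_dot a (U n w) + b)| <= B n.
  have [iS SE] := Rintegral_sum (index_enum 'I_d)
    (fun l => integrable_mulr (2 * (1 + `|a l|)) (it n l)).
  have -> : B n = \int[P]_w \sum_(l < d) 2 * (1 + `|a l|) * tail 1 (r n w 0 l).
    by rewrite SE; apply: eq_bigr => l _; rewrite RintegralZl.
  apply: Rintegral_dist_le => //.
  - exact: (icos _ n measurable_perturbation).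
  - exact: icos.
  - move=> w; apply: le_trans (norm_cosB_tail _ _) _.
    rewrite (_ : _ - _ = \sum_(l < d) a l * r n w 0 l); last first.
      rewrite opprD addrACA subrr addr0 /row_dot -sumrB.
      by apply: eq_bigr => l _; rewrite mxE; ring.
    apply: (@le_trans _ _ (2 * \sum_(l < d) tail 1 (a l * r n w 0 l))).
      by rewrite ler_wpM2l// tail_sum.
    rewrite mulr_sumr; apply: ler_sum => l _.
    by rewrite -mulrA ler_wpM2l// tail1M.
rewrite (_ : (fun n => _) = fun n => \int[P]_w cos (row_dot a (U n w) + b) +
   (\int[P]_w cos (row_dot a (U n w + r n w) + b) -
    \int[P]_w cos (row_dot a (U n w) + b))); last first.
  by apply/funext => n; rewrite addrC subrK.
rewrite -[X in _ --> X]addr0; apply: cvgD => //.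
apply/norm_cvg0P; apply: (@squeeze_cvgr _ _ _ _ (cst 0) _ _ _ _ _ B0).
  by near=> n; rewrite normr_ge0/= UB.
exact: cvg_cst.
Unshelve. all: by end_near. Qed.

End perturbation.

Theorem theorem5 (R : realType) (K : index_kind) (m : nat) (m_gt0 : (0 < m)%N)
    (d : nat) (d_gt0 : (0 < d)%N)
    (dX : measure_display) (OX : measurableType dX) (PX : probability OX R)
    (X : index_set R K m -> OX -> 'rV[R]_d)
    (X_field : random_field X)
    (X_homogeneous : homogeneous PX X)
    (X_ergodic : ergodic PX X)
    (X_L2 : forall l : 'I_d,
      ('E_PX[fun w => (`|X (index_origin _) w 0 l| ^+ 2)%R] < +oo)%E)
    (Sigma : 'M[R]_d)
    (Sigma_def : Sigma = covariance_mx PX (X (index_origin _)))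
    (Sigma_nonsingular : Sigma \in unitmx)
    (Tn : nat -> set (index_set R K m))
    (Tn_averaging : pointwise_averaging Tn)
    (k : nat -> nat)
    (k_nondecreasing : forall n p, (n <= p)%N -> (k n <= k p)%N)
    (k_infty : k n @[n --> \oo] --> \oo)
    (dtau : measure_display) (Otau : measurableType dtau)
    (Ptau : probability Otau R)
    (tau : forall n, 'I_(k n) -> Otau -> index_set R K m)
    (tau_uniform : forall n i, uniform_on Ptau (Tn n) (tau n i))
    (tau_independent : forall n, mutually_independent Ptau (tau n))
    (dV : measure_display) (OV : measurableType dV) (PV : probability OV R)
    (V : OV -> 'rV[R]_d)
    (V_gaussian : gaussian_vector PV V)
    (V_mean : forall l : 'I_d, ('E_PV[fun w => V w 0%R l] = 0)%E)
    (V_covariance : covariance_mx PV V = Sigma) :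
  let M n l w := average (Tn n) (fun t => X t w 0 l) in
  let mu l := fine ('E_PX[fun w => X (index_origin _) w 0%R l])%E in
  cvg_in_law (PX \x Ptau)%E
    (fun n w => \row_(l < d) ((Num.sqrt (k n)%:R)^-1 *
       \sum_(i < k n) (X (tau n i w.2) w.1 0 l - M n l w.1))) PV V
  /\
  ((forall l : 'I_d,
      cvg_in_law PX (fun n w => Num.sqrt (k n)%:R * (M n l w - mu l))
        PX (fun=> 0)) ->
   cvg_in_law (PX \x Ptau)%E
     (fun n w => \row_(l < d) ((Num.sqrt (k n)%:R)^-1 *
        \sum_(i < k n) (X (tau n i w.2) w.1 0 l - mu l))) PV V).
Proof.
move=> M mu.
have mXo l : measurable_fun setT (fun w => X (index_origin _) w 0 l).
  exact: (measurableT_comp (measurable_row_coord l) (X_field.1 _)).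
have X2 l : PX.-integrable setT (EFin \o (fun w => X (index_origin _) w 0 l ^+ 2)).
  apply/integrableP; split; first by apply/measurable_EFinP; exact: measurable_funX.
  have := X_L2 l; rewrite unlock; congr (_ < _)%E.
  by apply: eq_integral => w _; rewrite /= normrX.
have mV : measurable_fun setT V by have [] := V_gaussian.
have V2 := gaussian_sqr_integrable V_gaussian.
pose U n (w : OX * Otau) : 'rV[R]_d := \row_(l < d) ((Num.sqrt (k n)%:R)^-1 *
  \sum_(i < k n) (X (tau n i w.2) w.1 0 l - M n l w.1)).
have mU n : measurable_fun setT (U n).
  exact: (measurable_sample_sum X_field Tn_averaging tau_uniform).
have tU : tight (PX \x Ptau)%E U.
  (* Summing the second moments over l gives one constant for all coordinates. *)
  apply: (tight_of_second_moment mU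
    (C := \sum_(l < d) \int[PX]_w (X (index_origin _) w 0 l) ^+ 2)).
  have : \forall n \near \oo, (0 < k n)%N by exact: (k_infty _ (nbhs_infty_ge 1)).
  apply: filterS => n k0 l.
  have [iU le] := sample_sum_second_moment X_field X_homogeneous X2 Tn_averaging
    tau_uniform tau_independent l k0.
  split => //; apply: (le_trans le); rewrite (bigD1 l)//= lerDl sumr_ge0// => i _.
  by apply: Rintegral_ge0 => w _; exact: sqr_ge0.
have tV : tight PV (fun=> V).
  apply: (tight_of_second_moment (fun=> mV)
    (C := \sum_(l < d) \int[PV]_w (V w 0 l) ^+ 2)).
  apply: nearW => n l; split => //.
  rewrite (bigD1 l)//= lerDl sumr_ge0// => i _.
  by apply: Rintegral_ge0 => w _; exact: sqr_ge0.
have UVcos a b : \int[(PX \x Ptau)%E]_w cos (row_dot a (U n w) + b) @[n --> \oo] -->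
    \int[PV]_w cos (row_dot a (V w) + b).
  rewrite (gaussian_cos V_gaussian V_mean) V_covariance Sigma_def.
  rewrite -(Rintegral_row_dot_variance (X_field.1 _) X2).
  exact: (sample_sum_cos X_field X_homogeneous X_ergodic X2 Tn_averaging k_infty
    tau_uniform tau_independent).
split; first exact: (cvg_in_law_of_cos mU mV UVcos tU tV).
move=> Mmu.
pose r n (w : OX * Otau) : 'rV[R]_d :=
  \row_(l < d) (Num.sqrt (k n)%:R * (M n l w.1 - mu l)).
have UrE : (fun n w => \row_(l < d) ((Num.sqrt (k n)%:R)^-1 *
    \sum_(i < k n) (X (tau n i w.2) w.1 0 l - mu l))) = fun n w => U n w + r n w.
  apply/funext => n; apply/funext => w; apply/rowP => l; rewrite !mxE.
  have kE : (k n)%:R = Num.sqrt (k n)%:R * Num.sqrt (k n)%:R :> R.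
    by rewrite -expr2 sqr_sqrtr.
  transitivity ((Num.sqrt (k n)%:R)^-1 * \sum_(i < k n)
    ((X (tau n i w.2) w.1 0 l - M n l w.1) + (M n l w.1 - mu l))).
    by congr (_ * _); apply: eq_bigr => i _; rewrite addrA subrK.
  rewrite big_split/= mulrDr; congr (_ + _).
  rewrite sumr_const card_ord -[(M n l w.1 - mu l) *+ k n]mulr_natl.
  move: kE; set s := Num.sqrt _ => ->.
  (* For k n = 0 both sides are 0, because the inverse of 0 is 0. *)
  have [->|s0] := eqVneq s 0; first by rewrite !mul0r mulr0.
  by rewrite !mulrA mulVf// mul1r.
have mrl n l : measurable_fun setT (fun w => Num.sqrt (k n)%:R * (M n l w - mu l)).
  (* An empty row provides no sampled point to express M n by, but then the factor sqrt(k n) is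
     0. *)
  have [k0|k0] := posnP (k n).
    rewrite (_ : (fun w => _) = cst 0); first exact: measurable_cst.
    by apply/funext => w; rewrite k0 sqrtr0 mul0r.
  apply: measurable_funM; first exact: measurable_cst.
  apply: measurable_funB; last exact: measurable_cst.
  exact: (measurable_sample_mean X_field Tn_averaging tau_uniform (Ordinal k0)).
have mr n : measurable_fun setT (r n).
  by apply: measurable_row => l; exact: (measurableT_comp (mrl n l) measurable_fst).
(* Convergence in law to the constant 0 is tested on the bounded continuous function [tail 1], which
   vanishes at 0; as r does not depend on the sampling, its integral over the product is an integral
   over PX. *)
have r0 l : \int[(PX \x Ptau)%E]_w tail 1 (r n w 0 l) @[n --> \oo] --> 0.
  have := Mmu l (tail 1) (@continuous_tail R 1).
  have t0 : tail 1 0 = 0 :> R by rewrite /tail normr0 mul0r; apply/min_idPr; rewrite ler01.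
  rewrite t0 Rintegral_prob_cst (_ : (fun n => \int[PX]_w _) =
    fun n => \int[(PX \x Ptau)%E]_w tail 1 (r n w 0 l)).
    by apply; exists 1 => x; exact: norm_tail_le1.
  apply/funext => n; rewrite (@bounded_Rintegral_prod _ _ _ _ _ PX Ptau _ 1).
  - apply: eq_Rintegral => w _; rewrite -[LHS](Rintegral_prob_cst Ptau).
    by apply: eq_Rintegral => v _; rewrite mxE.
  - apply: (measurableT_comp (measurable_tail 1)).
    exact: (measurableT_comp (measurable_row_coord l) (mr n)).
  - by move=> w; exact: norm_tail_le1.
rewrite UrE; apply: cvg_in_law_of_cos => //.
- by move=> n; exact: measurable_perturbation.
- by move=> a b; exact: cos_perturbation.
- exact: tight_perturbation.
Qed.
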